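(* Let $\mathcal{A}$ be a finite alphabet and let $H\subset\mathcal{A}^{\mathbb{Z}}$ be a nearest-neighbor one-dimensional subshift of finite type. The language $$DP_I(H):=\{\langle V\rangle \mid V \subset \mathcal{A}^{\mathbb{Z}} \text{ is a subshift of finite type and } X_{H,V} \neq \emptyset\}$$ is decidable if and only if the Rauzy graph $\mathcal{G}(H)$ verifies condition D.
   Context: For one-dimensional subshifts of finite type (SFTs) $H,V\subset\mathcal{A}^{\mathbb{Z}}$, the combined subshift is $$X_{H,V} := \{ x \in \mathcal{A}^{\mathbb{Z}^2} \mid \forall i, j \in \mathbb{Z},\ (x_{k,j})_{k \in \mathbb{Z}} \in H \text{ and } (x_{i,\ell})_{\ell \in \mathbb{Z}} \in V \}.$$ $\langle V\rangle$ is an encoding of $V$ (by a finite set of forbidden words) suitable for a Turing machine; $H$ is fixed and only $V$ is the input. $H$ is nearest-neighbor if it is defined by a set of forbidden words of length $2$. Its Rauzy graph $\mathcal{G}(H)=(\mathcal{V},\vec{E})$ is the directed graph whose vertices are the letters appearing in configurations of $H$, with $(a,b)\in\vec{E}$ iff the word $ab$ appears in some configuration of $H$. The strongly connected components (SCCs) are the maximal sets of mutually reachable vertices; transient vertices (those with no nontrivial path to themselves) do not form SCCs. Condition D: the graph satisfies condition D if all its SCCs have a type in common among the following three (an SCC may have none, one or several types): - $S$ is of reflexive type if $(v,v)\in\vec{E}$ for all $v\in S$; - $S$ is of symmetric type if for all $v\neq w\in S$ with $(v,w)\in\vec{E}$ one has $(w,v)\in\vec{E}$; - $S$ is of state-split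 cycle type if there are $p\geq 1$ and a partition $S=\bigsqcup_{i=0}^{p-1}V_i$ such that for all $i$, all $v\in V_i$ and all $w\in S$: $(v,w)\in\vec{E}\Leftrightarrow w\in V_{i+1 \bmod p}$. *)

(* Defs.v *)
From Stdlib Require Export Relations.Relation_Operators.
From mathcomp Require Export all_boot all_order all_algebra.
From mathcomp Require Export classical_sets.

Set Implicit Arguments.
Unset Strict Implicit.
Unset Printing Implicit Defensive.

Local Open Scope classical_set_scope.
Local Open Scope ring_scope.

Definition appears (A : finType) (w : seq A) (x : int -> A) : Prop :=
  exists i : int, w = mkseq (fun k : nat => x (i + k%:Z)) (size w).

Definition sft (A : finType) (F : seq (seq A)) : set (int -> A) :=
  [set x | forall w, w \in F -> ~ appears w x].

Definition nearest_neighbor (A : finType) (H : set (int -> A)) : Prop :=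
  exists2 F : seq (seq A), (forall w, w \in F -> size w = 2%N) & H = sft F.

Definition combined (A : finType) (H V : set (int -> A)) :
    set (int * int -> A) :=
  [set x | forall i j : int,
     H (fun k => x (k, j)) /\ V (fun l => x (i, l))].

Record digraph (T : Type) := Digraph {
  vertex : set T;
  edge : T -> T -> Prop
}.

Definition rauzy (A : finType) (H : set (int -> A)) : digraph A :=
  Digraph [set a | exists2 x, H x & appears [:: a] x]
          (fun a b => exists2 x, H x & appears [:: a; b] x).

Section Graph.
Variables (T : Type) (G : digraph T).

Definition transient (v : T) : Prop := ~ clos_trans T (edge G) v v.

Definition mutually_reachable (S : set T) : Prop :=
  S `<=` vertex G /\
  forall v w, S v -> S w -> clos_refl_trans T (edge G) v w.

Definition scc (S : set T) : Prop :=
  [/\ S !=set0,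
      mutually_reachable S,
      forall S', mutually_reachable S' -> S `<=` S' -> S' `<=` S
    & forall v, S v -> ~ transient v].

Definition reflexive_type (S : set T) : Prop :=
  forall v, S v -> edge G v v.

Definition symmetric_type (S : set T) : Prop :=
  forall v w, S v -> S w -> v <> w -> edge G v w -> edge G w v.

(* [ordS i] is i + 1 mod p. *)
Definition state_split_cycle_type (S : set T) : Prop :=
  exists (p : nat) (W : 'I_p -> set T),
    [/\ (1 <= p)%N,
        forall i, W i !=set0,
        trivIset setT W,
        S = \bigcup_i W i
      & forall i v w, W i v -> S w -> (edge G v w <-> W (ordS i) w)].

Definition condition_D : Prop :=
  [\/ forall S, scc S -> reflexive_type S,
      forall S, scc S -> symmetric_type S
    | forall S, scc S -> state_split_cycle_type S].

End Graph.

Inductive move := MoveLeft | Stay | MoveRight.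

Definition displacement (m : move) : int :=
  match m with MoveLeft => -1 | Stay => 0 | MoveRight => 1 end.

(* Deterministic, with one bi-infinite tape. A tape cell is [None] (blank),
   [Some (inl a)] (input letter) or [Some (inr g)] (auxiliary symbol). The
   machine halts on entering a state whose verdict is [Some b]: it accepts if
   [b = true] and rejects if [b = false]. *)
Record turing_machine (Sigma : finType) := TuringMachine {
  state : finType;
  work_symbol : finType;
  start : state;
  verdict : state -> option bool;
  transition : state -> option (Sigma + work_symbol) ->
               state * option (Sigma + work_symbol) * move
}.

Section Run.
Variables (Sigma : finType) (M : turing_machine Sigma).

Definition cell : Type := option (Sigma + work_symbol M).

Record config := Config {
  cstate : state M;
  ctape : int -> cell;
  chead : int
}.

Definition initial (s : seq Sigma) : config :=
  Config (start M)
         (fun z => if z is Posz n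
                   then nth None [seq Some (inl a) | a <- s] n else None)
         0.

Definition step (c : config) : config :=
  if verdict (cstate c) is Some _ then c else
  let: (q, a, m) := transition (cstate c) (ctape c (chead c)) in
  Config q (fun z => if z == chead c then a else ctape c z)
         (chead c + displacement m).

Definition halts_with (s : seq Sigma) (b : bool) : Prop :=
  exists n : nat, verdict (cstate (iter n step (initial s))) = Some b.

Definition decides (L : set (seq Sigma)) : Prop :=
  forall s, (L s -> halts_with s true) /\ (~ L s -> halts_with s false).

End Run.

Definition turing_decidable (Sigma : finType) (L : set (seq Sigma)) : Prop :=
  exists M : turing_machine Sigma, decides M L.

(* A finite set of forbidden words is written on the tape as the concatenation
   of its words, each terminated by the separator [None]. *)
Definition encode (A : finType) (F : seq (seq A)) : seq (option A) :=
  flatten [seq rcons (map Some w) None | w <- F].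

Definition DP_I (A : finType) (H : set (int -> A)) : set (seq (option A)) :=
  [set encode F | F in [set F | combined H (sft F) !=set0]].

(* Main.v *)
Require Import Defs.
From mathcomp Require Import zify boolp.

(* If the Rauzy graph fails condition D, it has a component that is not reflexive,
   one that is not symmetric and one that is not a state-split cycle. For every
   Wang tile set, walks of a fixed period in these components separate all pairs
   of non-adjacent vertices of a template graph whose bi-infinite walks spell rows
   of tiles. Stacking all homomorphisms from the template to the Rauzy graph, and
   rotations of a closed walk with a missing chord that exclude vertical shifts,
   turns a tile into a block of letters; finitely many forbidden vertical words
   then force the configurations to code Wang tilings, and forbidding words of
   vertical successions of tiles remains possible.
   A self-similar tile set contains arbitrarily large zones in which a machine M
   is run. Stacks of tiles above the rows of a zone hold a number N in unary, which
   is imposed by forbidden words depending on N, and M receives N as its input: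
   there is a tiling if and only if M does not accept N. From a decision procedure
   for DP_I(H) one gets a machine M which decodes N as a table of codes and accepts
   if and only if the instance written with this table is nonempty. If N encodes
   the table of M itself, this is a contradiction.
   Conversely, every row is eventually inside a single component, and condition D
   gives a P such that P consecutive letters of a walk inside a component always
   form a cycle. Hence the configurations may be taken with rows of period P, and
   one has to decide the emptiness of a one-dimensional subshift of finite type
   over the cycles of length P, which is done by exhaustive search. *)

Set Implicit Arguments.
Unset Strict Implicit.
Unset Printing Implicit Defensive.

Import Order.TTheory GRing.Theory Num.Theory.

(** * Walks and homomorphisms into the Rauzy graph *)

Section Walks.
Variables (A : finType) (e : rel A).

(** The obstacle is a circle: the forbidden words that simulate M depend on the tile set of M, while
    M itself has to write them for the decision procedure. An order of quantifiers breaks it. M is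
    built from the decision procedure and the alphabet alone; the tile set comes from M; the codes
    of colours and the basic forbidden words come from the tile set; only then is N chosen. This is
    why N acts only through a few extra vertical words, and why [wang_coding] provides its codes
    before the list [Phi]. The period of the walks is 3p, where the p-th power of the Boolean
    adjacency matrix is idempotent: inside a component, a walk of length at most 2p closes up to
    length 3p, since its return then has at least p steps, and from p on only the residue mod p of a
    length matters. A closed walk must be able to miss the chord of any displacement other than 1:
    displacement 0 is missed where reflexivity fails, -1 where symmetry fails, and all the others in
    a component that is not a state-split cycle. *)

Fixpoint walk (n : nat) (a b : A) : bool :=
  if n is m.+1 then [exists c, e a c && walk m c b] else a == b.

Lemma walk1 a b : walk 1 a b = e a b.
Proof. by apply/existsP/idP => [[c /andP[ac /eqP <-]]//|ab]; exists b; rewrite ab /=. Qed.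

Lemma walkD m n a b : walk (m + n) a b = [exists c, walk m a c && walk n c b].
Proof.
elim: m a => [|m IH] a.
  by apply/idP/existsP => [w|[c /andP[/eqP <-]]//]; exists a; rewrite /= eqxx.
rewrite addSn /=; apply/existsP/existsP => [[c /andP[ac]]|[c /andP[/existsP[d /andP[ad dc]] cb]]].
  rewrite IH => /existsP[d /andP[cd db]]; exists d; rewrite db andbT.
  by apply/existsP; exists c; rewrite ac.
by exists d; rewrite ad IH; apply/existsP; exists c; rewrite dc.
Qed.

Lemma walk_cat m n a b c : walk m a b -> walk n b c -> walk (m + n) a c.
Proof. by move=> ab bc; rewrite walkD; apply/existsP; exists b; rewrite ab. Qed.

Lemma walkM m k a : walk m a a -> walk (k * m) a a.
Proof. by move=> aa; elim: k => [|k IH]; [rewrite /= eqxx | rewrite mulSn; apply: walk_cat IH]. Qed.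

Lemma walk_connect n a b : walk n a b -> connect e a b.
Proof.
elim: n a => [|n IH] a /=; first by move/eqP->.
by case/existsP=> c /andP[ac /IH]; apply: connect_trans; apply: connect1.
Qed.

Lemma connect_walk a b : connect e a b -> exists n, walk n a b.
Proof.
case/connectP=> p; elim: p a => [|c p IH] a /=; first by move=> _ ->; exists 0; rewrite /= eqxx.
by case/andP=> ac pc /(IH _ pc)[n w]; exists n.+1; apply/existsP; exists c; rewrite ac.
Qed.

Lemma walk_fun n a b : walk n a b ->
  exists g : nat -> A, [/\ g 0 = a, g n = b & forall i, i < n -> e (g i) (g i.+1)].
Proof.
elim: n a => [|n IH] a /=; first by move/eqP->; exists (fun=> b).
case/existsP=> c /andP[ac /IH[g [g0 gn ge]]].
exists (fun i => if i is j.+1 then g j else a); split=> // -[_|i /ge //].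
by rewrite g0.
Qed.

(** By finiteness two powers i and i + d of the Boolean adjacency matrix coincide, and a multiple of
    d that is at least i gives an idempotent power; the factor i + 2 also makes the exponent exceed
    1. *)
Lemma walk_idem : exists2 p, 1 < p & forall a b, walk (p + p) a b = walk p a b.
Proof.
pose f n := [ffun ab : A * A => walk n ab.1 ab.2].
have [i [d [d0 fE]]] : exists i d, 0 < d /\ f i = f (i + d).
  pose g (i : 'I_(#|{ffun A * A -> bool}|.+1)) := f i.
  have /injectiveP : ~~ injectiveb g.
    by apply/injectiveP => /leq_card; rewrite card_ord ltnn.
  have [[i [j [lij gE]]] _|no] := pselect (exists i j : 'I_#|{ffun A * A -> bool}|.+1, i < j /\ g i = g j).
    by exists i, (j - i); rewrite subn_gt0 lij subnKC // ltnW.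
  case=> i j gE; apply: val_inj; case: (ltngtP (val i) (val j)) => // l; case: no.
    by exists i, j.
  by exists j, i.
have walkE n : i <= n -> forall a b, walk (n + d) a b = walk n a b.
  move=> /subnK <-; set k := n - i => a b; rewrite -addnA !walkD.
  apply: eq_existsb => c; congr andb.
  by have := congr1 (fun F : {ffun A * A -> bool} => F (c, b)) fE; rewrite !ffunE.
have walkME n k : i <= n -> forall a b, walk (n + k * d) a b = walk n a b.
  move=> li a b; elim: k => [|k <-]; first by rewrite addn0.
  by rewrite mulSn addnC -addnA addnC walkE // addnC; lia.
have ld : i + 2 <= (i + 2) * d by rewrite leq_pmulr.
exists ((i + 2) * d); first lia.
by move=> a b; apply: walkME; lia.
Qed.

(* On strongly connected components the walks of length [p + n] depend on [n]
   only modulo the exponent [p], and they form a graded groupoid. *)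
Variable p : nat.
Hypothesis p1 : 1 < p.
Hypothesis walk_pp : forall a b, walk (p + p) a b = walk p a b.

Lemma walk_mod m n a b : p <= m -> p <= n -> m = n %[mod p] -> walk m a b = walk n a b.
Proof.
have red k r : walk (p + k * p + r) a b = walk (p + r) a b.
  elim: k => [|k IH]; first by rewrite addn0.
  rewrite -IH (_ : p + k.+1 * p + r = p + p + (k * p + r)); last lia.
  rewrite (_ : p + k * p + r = p + (k * p + r)); last lia.
  by rewrite ![walk (_ + (k * p + r)) a b]walkD; apply: eq_existsb => c; rewrite walk_pp.
have norm n' : p <= n' -> walk n' a b = walk (p + n' %% p) a b.
  move=> pn; rewrite -(red (n' %/ p).-1); congr (walk _ a b).
  have q0 : 0 < n' %/ p by rewrite divn_gt0; lia.
  by rewrite -mulSn prednK // -divn_eq.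
by move=> pm pn mn; rewrite norm // [RHS]norm // mn.
Qed.

Definition gwalk n := walk (p + n).

Lemma gwalk_mod m n a b : m = n %[mod p] -> gwalk m a b = gwalk n a b.
Proof. by move=> mn; apply: walk_mod; rewrite ?leq_addr // !modnDl. Qed.

Lemma gwalk_cat m n a b c : gwalk m a b -> gwalk n b c -> gwalk (m + n) a c.
Proof.
move=> ab bc; have := walk_cat ab bc.
rewrite (@walk_mod _ (p + (m + n))) //; try lia.
by rewrite (_ : p + m + (p + n) = p + (p + (m + n))) ?modnDl //; lia.
Qed.

(** Take any return walk, of length t, and then p - 1 turns of the closed walk of length p + m + t:
    the total length is congruent to -m mod p. *)
Lemma gwalk_inv m n a b : gwalk m a b -> connect e b a -> p %| m + n -> gwalk n b a.
Proof.
move=> ab /connect_walk[t ba] /eqP pmn.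
have aa : walk (p + m + t) a a by apply: walk_cat ab ba.
have := walk_cat ba (walkM p.-1 aa).
rewrite /gwalk (@walk_mod _ (p + n)) //; try by nia.
apply/eqP; rewrite -(eqn_modDl m) [m + (p + n)]addnCA modnDl pmn.
have -> : m + (t + p.-1 * (p + m + t)) = (m + t + p.-1) * p by case: p p1 => // q; nia.
by rewrite modnMl.
Qed.

Lemma gwalk_refl a b : e a b -> connect e b a -> gwalk 0 a a.
Proof.
move=> ab /connect_walk[t ba].
have aa : walk t.+1 a a by apply/existsP; exists b; rewrite ab.
have := walkM p aa; rewrite /gwalk (@walk_mod _ (p + 0)) //; try by nia.
by rewrite modnMr addn0 modnn.
Qed.

Lemma gwalk_walk n a b : gwalk 0 a a -> walk n a b -> gwalk n a b.
Proof. by rewrite /gwalk addn0 => aa ab; apply: walk_cat aa ab. Qed.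
End Walks.

(** * Strong components, and the patterns found in one that is not a state-split cycle *)

Section Component.
Variables (A : finType) (G : digraph A) (e : rel A).
Hypothesis eE : forall a b, edge G a b <-> e a b.
Variable p : nat.
Hypothesis p1 : 1 < p.
Hypothesis walk_pp : forall a b, walk e (p + p) a b = walk e p a b.

(** A form of [scc] that only involves the Boolean relation; the last clause rules out an isolated
    transient vertex. *)
Definition component (S : set A) : Prop :=
  [/\ exists v, S v, forall x y, S x -> S y -> connect e x y,
      forall x y, S x -> connect e x y -> connect e y x -> S y
    & forall x, S x -> exists2 y, S y & e x y].

Variable S : set A.
Hypothesis compS : component S.

Notation gwalk := (gwalk e p).

Let conn x y : S x -> S y -> connect e x y.
Proof. by case: compS => _ + _ _; apply. Qed.

Let between x y z : S x -> S z -> connect e x y -> connect e y z -> S y.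
Proof.
case: compS => _ c b _ Sx Sz xy yz; apply: b (Sx) xy _.
exact: connect_trans yz (c _ _ Sz Sx).
Qed.

Let succ x : S x -> exists2 y, S y & e x y.
Proof. by case: compS => _ _ _; apply. Qed.

Let walk_mid m n x z : S x -> S z -> walk e (m + n) x z ->
  exists y, [/\ S y, walk e m x y & walk e n y z].
Proof.
move=> Sx Sz; rewrite walkD => /existsP[y /andP[xy yz]]; exists y; split=> //.
exact: between Sx Sz (walk_connect xy) (walk_connect yz).
Qed.

Let loop x : S x -> gwalk 0 x x.
Proof.
move=> Sx; have [y Sy xy] := succ Sx.
by apply: gwalk_refl xy _ => //; apply: conn.
Qed.

Let walk_gwalk n x y : S x -> walk e n x y -> gwalk n x y.
Proof. by move=> /loop l; apply: gwalk_walk. Qed.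

Let inv m n x y : S x -> S y -> gwalk m x y -> p %| m + n -> gwalk n y x.
Proof. by move=> Sx Sy xy; apply: gwalk_inv xy _ => //; apply: conn. Qed.

Lemma component_pred x : S x -> exists2 y, S y & e y x.
Proof.
move=> Sx; have := loop Sx; rewrite /gwalk addn0 -(prednK (ltnW p1)) -addn1.
by case/(walk_mid Sx Sx)=> y [Sy _]; rewrite walk1; exists y.
Qed.

(** The inverse of a walk of length j has a length congruent to -j mod p; it is taken equal to p +
    (2p - j), whence the bound on j. *)
Lemma walk_back j a x : S a -> S x -> walk e j a x -> j <= 2 * p ->
  walk e (3 * p - j) x a.
Proof.
move=> Sa Sx ax lj.
have := inv (n := 2 * p - j) Sa Sx (walk_gwalk Sa ax).
rewrite subnKC // dvdn_mull // => /(_ isT).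
by rewrite /gwalk; congr walk; lia.
Qed.

Let same i v x y : S v -> S x -> S y -> gwalk i v x -> gwalk i v y -> gwalk 0 x y.
Proof.
move=> Sv Sx Sy vx vy.
have xv : gwalk (p.-1 * i) x v.
  by apply: inv Sv Sx vx _; rewrite -mulSn prednK ?dvdn_mulr // ltnW.
have := gwalk_cat p1 walk_pp xv vy.
by rewrite (gwalk_mod p1 walk_pp (n := 0)) // addnC -mulSn prednK ?modnMr ?mod0n // ltnW.
Qed.

(** The classes are the sets of vertices reached from a fixed v by walks of a given residue, and
    their number is the least positive residue that leads back to v. Edges always go from a class to
    the next one; the hypothesis is that all such pairs are edges. *)
Lemma state_splitP :
  (forall v i x w, S v -> S x -> S w -> gwalk i v x -> gwalk i.+1 v w -> e x w) ->
  state_split_cycle_type G S.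
Proof.
move=> full; have [[v Sv] _ _ _] := compS.
pose C i : set A := fun w => S w /\ gwalk i v w.
have Cv : C p v.
  by split=> //; rewrite (gwalk_mod p1 walk_pp (n := 0)) ?modnn ?mod0n //; apply: loop.
have ex : exists q, (0 < q) && `[< C q v >].
  by exists p; rewrite (ltnW p1); apply/asboolP.
case: (ex_minnP ex) => q /andP[q0 /asboolP[_ Cq]] qmin.
have per i w : C (q + i) w <-> C i w.
  split=> -[Sw vw]; split=> //; last exact: gwalk_cat vw.
  have back : gwalk (p.-1 * q) v v.
    by apply: inv Cq _ => //; rewrite -mulSn prednK ?dvdn_mulr // ltnW.
  have := gwalk_cat p1 walk_pp back vw.
  rewrite (gwalk_mod p1 walk_pp (n := i)) //.
  by rewrite addnA -mulSnr prednK ?(ltnW p1) // mulnC modnMDl.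
have next i x w : C i x -> S w -> e x w -> C i.+1 w.
  move=> [Sx vx] Sw xw; split=> //; rewrite -addn1.
  by apply: gwalk_cat vx _ => //; apply: walk_gwalk; rewrite ?walk1.
exists q, (fun i => C i); split=> //.
- have Cne i : exists w, C i w.
    elim: i => [|i [w Cw]]; first by exists v; split=> //; apply: loop.
    by have [u Su wu] := succ Cw.1; exists u; apply: next Cw Su wu.
  by move=> i; apply: Cne.
- have disj i j w : i < j -> j < q -> C i w -> C j w -> False.
    move=> lij ljq [Sw vi] [_ vj].
    have wv : gwalk (p.-1 * i) w v.
      by apply: inv Sv Sw vi _; rewrite -mulSn prednK ?dvdn_mulr // ltnW.
    have vv : C (j - i) v.
      split=> //; have := gwalk_cat p1 walk_pp vj wv.
      rewrite (gwalk_mod p1 walk_pp (n := j - i)) //.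
      rewrite -{1}(subnK (ltnW lij)) -addnA -mulSn prednK; last exact: ltnW.
      by rewrite mulnC addnC modnMDl.
    have := qmin (j - i); rewrite subn_gt0 lij /= => /(_ _)/wrap[]; first exact/asboolP.
    by lia.
  move=> i j _ _ [w [Ci Cj]]; apply: val_inj.
  by case: (ltngtP (val i) (val j)) => // l;
    [case: (disj _ _ _ l (ltn_ord j) Ci Cj) | case: (disj _ _ _ l (ltn_ord i) Cj Ci)].
- apply/seteqP; split=> [w Sw|w [i _ []//]].
  have [n vw] := connect_walk (conn Sv Sw).
  have : C n w by split=> //; apply: walk_gwalk.
  rewrite {1}(divn_eq n q); elim: (n %/ q) => [|k IH].
    by move=> Cw; exists (Ordinal (ltn_pmod n q0)).
  by rewrite mulSn -addnA per.
- have stepC i x w : C i x -> S w -> (edge G x w <-> C i.+1 w).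
    move=> Cx Sw; rewrite eE; split=> [/(next _ _ _ Cx Sw)//|[_ vw]].
    by case: Cx => Sx vx; apply: full Sv Sx Sw vx vw.
  move=> i x w Cx Sw; rewrite (stepC _ _ _ Cx Sw) /=.
  have [lt|ge] := ltnP i.+1 q; first by rewrite modn_small.
  have -> : i.+1 = q + 0 by rewrite addn0; have := ltn_ord i; lia.
  by rewrite addn0 modnn -{1}[q]addn0 per.
Qed.

(** Any successor of x lies in the same class as w, so that a walk of residue 0 leads from it to w,
    and the edge can be moved along this walk. *)
Lemma state_split_out :
  (forall x y z, S x -> S y -> S z -> e x y -> gwalk 0 y z -> e x z) ->
  state_split_cycle_type G S.
Proof.
move=> ez; apply: state_splitP => v i x w Sv Sx Sw vx vw.
have [y Sy xy] := succ Sx; apply: (ez x y) => //.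
apply: same vw => //; rewrite -addn1.
by apply: gwalk_cat vx _ => //; apply: walk_gwalk; rewrite ?walk1.
Qed.

Lemma state_split_in :
  (forall x y z, S x -> S y -> S z -> gwalk 0 x y -> e y z -> e x z) ->
  state_split_cycle_type G S.
Proof.
move=> ez; apply: state_splitP => v i x w Sv Sx Sw vx vw.
have [y Sy yw] := component_pred Sw; apply: (ez x y) => //.
apply: same vx _ => //.
have wy : gwalk p.-1 w y.
  apply: (inv (m := 1) Sy Sw); first by apply: walk_gwalk; rewrite ?walk1.
  by rewrite add1n prednK ?dvdnn // ltnW.
have := gwalk_cat p1 walk_pp vw wy.
rewrite (gwalk_mod p1 walk_pp (n := i)) //.
by rewrite addSnnS prednK ?modnDr // ltnW.
Qed.

Hypothesis nosplit : ~ state_split_cycle_type G S.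

(** Otherwise two successors of a common vertex have the same successors; by induction, so do the
    ends of two walks of equal positive length from a common vertex, and edges become invariant
    under walks of residue 0. *)
Lemma branching : exists a x y x' y', [/\ S a, S x, S y & S x' /\ S y'] /\
  [/\ e a x, e x y, e a x', e x' y' & ~~ e x y'].
Proof.
apply: contrapT => no; apply: nosplit.
have P0 a x x' y : S a -> S x -> S x' -> S y -> e a x -> e a x' -> e x' y -> e x y.
  move=> Sa Sx Sx' Sy ax ax' xy; apply: contrapT => /negP nxy; apply: no.
  by have [z Sz xz] := succ Sx; exists a, x, z, x', y.
have P n a x x' y : S a -> S x -> S x' -> S y -> walk e n.+1 a x -> walk e n.+1 a x' ->
    e x' y -> e x y.
  elim: n x x' y => [|n IH] x x' y Sa Sx Sx' Sy.
    by rewrite !walk1; apply: P0.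
  rewrite -(addn1 n.+1) => /(walk_mid Sa Sx)[z [Sz az zx]] /(walk_mid Sa Sx')[z' [Sz' az' zx']].
  move: zx zx'; rewrite !walk1 => zx zx'.
  by apply: (P0 z) => //; apply: (IH z z').
apply: state_split_in => x y z Sx Sy Sz xy yz.
have := loop Sx; move: xy; rewrite /gwalk addn0 -(prednK (ltnW p1)) => xy xx.
exact: (P p.-1 x x y z).
Qed.

(** The argument of [branching] with all arrows reversed. [branching] will serve near the beginning
    of a tile, [merging] near its end. *)
Lemma merging : exists x y x' y' b, [/\ S x, S y, S x' & S y' /\ S b] /\
  [/\ e x y, e y b, e x' y', e y' b & ~~ e x y'].
Proof.
apply: contrapT => no; apply: nosplit.
have P0 b x y y' : S b -> S x -> S y -> S y' -> e y b -> e y' b -> e x y -> e x y'.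
  move=> Sb Sx Sy Sy' yb yb' xy; apply: contrapT => /negP nxy; apply: no.
  by have [x' Sx' xy'] := component_pred Sy'; exists x, y, x', y', b.
have P n b x y y' : S b -> S x -> S y -> S y' -> walk e n.+1 y b -> walk e n.+1 y' b ->
    e x y -> e x y'.
  elim: n x y y' => [|n IH] x y y' Sb Sx Sy Sy'.
    by rewrite !walk1; apply: P0.
  rewrite -(add1n n.+1) => /(walk_mid Sy Sb)[z [Sz yz zb]] /(walk_mid Sy' Sb)[z' [Sz' yz' zb']].
  move: yz yz'; rewrite !walk1 => yz yz'.
  by apply: (P0 z' _ y) => //; apply: (IH y z z').
apply: state_split_out => x y z Sx Sy Sz xy yz.
have := loop Sz; move: yz; rewrite /gwalk addn0 -(prednK (ltnW p1)) => yz zz.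
exact: (P p.-1 z x y z).
Qed.

(** If walks of length j were edges, so would be those of length 1 + (j - 1)t for all t; with t = p,
    edges would be invariant under walks of residue 0. *)
Lemma walk_not_edge j : 1 < j -> exists x z, [/\ S x, S z, walk e j x z & ~~ e x z].
Proof.
move=> j1; apply: contrapT => no; apply: nosplit.
have ej x z : S x -> S z -> walk e j x z -> e x z.
  by move=> Sx Sz xz; apply: contrapT => /negP nxz; apply: no; exists x, z.
have et t x z : S x -> S z -> walk e (1 + j.-1 * t) x z -> e x z.
  elim: t x z => [|t IH] x z Sx Sz; first by rewrite muln0 walk1.
  rewrite (_ : 1 + j.-1 * t.+1 = j + j.-1 * t); last lia.
  case/(walk_mid Sx Sz)=> y [Sy /ej xy yz]; apply: IH => //.
  by apply: walk_cat yz; rewrite walk1 xy.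
apply: state_split_out => x y z Sx Sy Sz xy yz; apply: (et p) => //.
apply: (@walk_cat _ _ 1 _ _ y); rewrite ?walk1 //.
move: yz; rewrite /gwalk addn0 (@walk_mod _ _ p p1 walk_pp p (j.-1 * p)) //.
  by rewrite leq_pmull //; lia.
by rewrite modnn modnMl.
Qed.

(** If walks of length j were reversed edges, those of length j * j would reverse to walks of length
    j, hence become edges by a second reversal, against [walk_not_edge] for j * j. *)
Lemma walk_not_converse j : 1 < j -> exists x z, [/\ S x, S z, walk e j x z & ~~ e z x].
Proof.
move=> j1; apply: contrapT => no.
have ej x z : S x -> S z -> walk e j x z -> e z x.
  by move=> Sx Sz xz; apply: contrapT => /negP nxz; apply: no; exists x, z.
have et t x z : S x -> S z -> walk e (j * t) x z -> walk e t z x.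
  elim: t x z => [|t IH] x z Sx Sz; first by rewrite muln0 /= eq_sym.
  rewrite mulnS => /(walk_mid Sx Sz)[y [Sy /(ej _ _ Sx Sy) yx /(IH _ _ Sy Sz) zy]].
  by rewrite -addn1; apply: walk_cat zy _; rewrite walk1.
have jj : 1 < j * j by nia.
have [x [z [Sx Sz /(et _ _ _ Sx Sz) zx]]] := walk_not_edge jj.
by rewrite ej.
Qed.
End Component.

Lemma walk_via (A : finType) (e : rel A) m n a b b' c :
  walk e m a b -> e b b' -> walk e n b' c -> exists h : nat -> A,
  [/\ h 0 = a, h m = b, h m.+1 = b', h (m.+1 + n) = c &
    forall i, i < m.+1 + n -> e (h i) (h i.+1)].
Proof.
move=> /walk_fun[g [g0 gm ge]] bb' /walk_fun[g' [g0' gn ge']].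
exists (fun i => if i <= m then g i else g' (i - m.+1)); split=> //=.
- by rewrite leqnn.
- by rewrite ltnn subnn.
- by rewrite ifF ?addKn //; lia.
move=> i li; case: (ltngtP i m) => im.
- exact: ge.
- by rewrite subSn //; apply: ge'; lia.
- by rewrite im subnn gm g0'.
Qed.

Lemma closed_via (A : finType) (e : rel A) d m x z : 0 < m ->
  walk e d x z -> walk e m z x -> exists h : nat -> A,
  [/\ h 0 = x, h d = z, forall i, h (i %% (d + m)) = h i & forall i, e (h i) (h i.+1)].
Proof.
case: m => // m _ xz /existsP[z' /andP[zz' z'x]].
have [h [h0 hd _ hn he]] := walk_via xz zz' z'x.
rewrite addSnnS in hn he.
exists (fun i => h (i %% (d + m.+1))); split=> [||i|i]; rewrite ?mod0n ?modn_mod //.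
  by rewrite modn_small //; lia.
have lt : i %% (d + m.+1) < d + m.+1 by rewrite ltn_pmod; lia.
rewrite -[i.+1]addn1 -modnDml addn1; have := he _ lt.
have [l|l] := ltnP (i %% (d + m.+1)).+1 (d + m.+1); first by rewrite [_.+1 %% _]modn_small.
by have -> : (i %% (d + m.+1)).+1 = d + m.+1 by [lia]; rewrite modnn hn h0.
Qed.

(** * The template graph of a tile set and its homomorphisms to the Rauzy graph *)

Section Template.
Variables (A : finType) (G : digraph A) (e : rel A).
Hypothesis eE : forall a b, edge G a b <-> e a b.
Variable p : nat.
Hypothesis p1 : 1 < p.
Hypothesis walk_pp : forall a b, walk e (p + p) a b = walk e p a b.
Variables Sr Ss Sc : set A.
Hypotheses (compr : component e Sr) (comps : component e Ss) (compc : component e Sc).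
Hypothesis irreflexive : exists2 v, Sr v & ~~ e v v.
Hypothesis asymmetric : exists v w, [/\ Ss v, Ss w, e v w & ~~ e w v].
Hypothesis nosplit : ~ state_split_cycle_type G Sc.

Notation l := (3 * p).-1.

Lemma periodE : l.+1 = 3 * p. Proof. by lia. Qed.

Lemma closed_walk_avoiding d : d < l.+1 -> d != 1 -> exists h : nat -> A,
  [/\ forall i, h (i %% l.+1) = h i, forall i, e (h i) (h i.+1) & ~~ e (h 0) (h d)].
Proof.
move=> dl d1; rewrite periodE in dl *.
have [x [z [xz zx nxz]]] : exists x z,
    [/\ walk e d x z, walk e (3 * p - d) z x & ~~ e x z].
  have [d0|d0] := eqVneq d 0.
    have [v Sv nv] := irreflexive; exists v, v; rewrite d0; split=> //=.
    exact: (walk_back p1 walk_pp compr Sv Sv (j := 0)) (eqxx v) _.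
  have [dl1|dl1] := eqVneq d (3 * p - 1).
    have [v [w [Sv Sw vw wv]]] := asymmetric; exists w, v; split=> //.
      by rewrite dl1; apply: (walk_back p1 walk_pp comps Sv Sw (j := 1)); rewrite ?walk1 //; lia.
    by rewrite (_ : 3 * p - d = 1) ?walk1 //; lia.
  (* A walk longer than 2p cannot be closed by [walk_back]; there the complementary walk of length
     3p - d is chosen and the missing chord is a converse edge. *)
  have [d2|d2] := leqP d (2 * p).
    have [|x [z [Sx Sz xz nxz]]] := walk_not_edge eE p1 walk_pp compc nosplit (j := d).
      lia.
    exists x, z; split=> //.
    exact (walk_back p1 walk_pp compc Sx Sz xz d2).
  have [|x [z [Sx Sz xz nzx]]] := walk_not_converse eE p1 walk_pp compc nosplit (j := 3 * p - d).
    lia.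
  exists z, x; split=> //.
  have := walk_back p1 walk_pp compc Sx Sz xz; rewrite subKn; last lia.
  by apply; lia.
have [|h [h0 hd hm he]] := closed_via _ xz zx; first lia.
by rewrite subnKC in hm; [exists h; rewrite h0 hd | lia].
Qed.

Variables (Col Tile : finType) (west east : Tile -> Col).

(* A tile [t] is spelled by the walk [west t, (t, 0), ..., (t, l - 1), east t]. *)
Definition node : finType := (Col + Tile * 'I_l)%type.

Definition node_at (t : Tile) (k : nat) : node :=
  if k is j.+1 then
    if insub j is Some i then inr (t, i) else inl (east t)
  else inl (west t).

Definition tedge (u v : node) : bool :=
  [exists t, exists k : 'I_l.+1, (u == node_at t k) && (v == node_at t k.+1)].

Definition phase (u : node) : nat := if u is inr (_, k) then k.+1 else 0.

Definition hom (f : node -> A) : Prop := forall u v, tedge u v -> e (f u) (f v).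

Lemma node_atE t (k : 'I_l) : node_at t k.+1 = inr (t, k).
Proof. by rewrite /= valK. Qed.

Lemma node_at_last t : node_at t l.+1 = inl (east t).
Proof. by rewrite /node_at insubF // ltnn. Qed.

Lemma tedge_at t k : k < l.+1 -> tedge (node_at t k) (node_at t k.+1).
Proof. by move=> lk; apply/existsP; exists t; apply/existsP; exists (Ordinal lk); rewrite !eqxx. Qed.

Lemma phase_at t k : k <= l.+1 -> phase (node_at t k) = k %% l.+1.
Proof.
case: k => [|k]; first by rewrite mod0n.
rewrite leq_eqVlt => /orP[/eqP[->]|]; first by rewrite node_at_last modnn.
by move=> lk; rewrite modn_small // (node_atE t (Ordinal (lk : k < l))).
Qed.

Lemma phase_lt u : phase u < l.+1.
Proof. by case: u => //= -[t k]; rewrite ltnS. Qed.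

Lemma tedge_phase u v : tedge u v -> phase v = (phase u).+1 %% l.+1.
Proof.
case/existsP=> t /existsP[k /andP[/eqP-> /eqP->]].
have lk := ltn_ord k; rewrite !phase_at //; last exact: ltnW.
by rewrite (modn_small lk).
Qed.

Lemma hom_closed (h : nat -> A) (s : nat) :
  (forall i, h (i %% l.+1) = h i) -> (forall i, e (h i) (h i.+1)) -> hom (fun u => h (phase u + s)).
Proof.
move=> hm he u v /tedge_phase ->.
by rewrite -[h (_ %% _ + s)]hm modnDml hm addSn.
Qed.

(** Walks of distinct tiles share no node other than colours, so once the colours are placed each
    tile may choose its own walk, with a prescribed edge at step [m]. *)
Lemma hom_via (f0 : Col -> A) (b b' : Tile -> A) m n : m.+1 + n = l.+1 ->
  (forall t, walk e m (f0 (west t)) (b t)) -> (forall t, e (b t) (b' t)) ->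
  (forall t, walk e n (b' t) (f0 (east t))) ->
  exists f, [/\ hom f, forall c, f (inl c) = f0 c &
    forall t, f (node_at t m) = b t /\ f (node_at t m.+1) = b' t].
Proof.
move=> mn w1 w2 w3.
have /choice[g gP] : forall t, exists h : nat -> A,
  [/\ h 0 = f0 (west t), h m = b t, h m.+1 = b' t, h l.+1 = f0 (east t) &
    forall i, i < l.+1 -> e (h i) (h i.+1)].
  by move=> t; rewrite -mn; apply: walk_via (w1 t) (w2 t) (w3 t).
pose f (u : node) := match u with inl c => f0 c | inr (t, k) => g t k.+1 end.
have fE t k : k <= l.+1 -> f (node_at t k) = g t k.
  have [g0 _ _ gl _] := gP t.
  case: k => [|k]; first by rewrite g0.
  rewrite leq_eqVlt => /orP[/eqP[->]|]; first by rewrite node_at_last /= gl.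
  by move=> lk; rewrite (node_atE t (Ordinal (lk : k < l))).
exists f; split=> // [u v|t].
  case/existsP=> t /existsP[k /andP[/eqP-> /eqP->]].
  have lk := ltn_ord k; rewrite !fE //; last exact: ltnW.
  by have [_ _ _ _] := gP t; apply.
by have [_ gm gm' _ _] := gP t; rewrite !fE //; lia.
Qed.

(** A wrong phase is detected by a rotated closed walk. If the phases agree, the two uncrossable
    paths of [branching] detect a wrong west colour at the start of a tile, those of [merging] a
    wrong east colour at its end, and either pattern tells two tiles apart in between. *)
Lemma hom_sep u v : ~~ tedge u v -> exists2 f, hom f & ~~ e (f u) (f v).
Proof.
move=> nuv; have [pE|pN] := eqVneq (phase v) ((phase u).+1 %% l.+1); last first.
  have lu := phase_lt u; have lv := phase_lt v.
  have [||h [hm he nh]] := @closed_walk_avoiding ((phase v + (l.+1 - phase u)) %% l.+1).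
  - by rewrite ltn_pmod.
  - apply: contra pN => /eqP q.
    rewrite -addn1 -[X in _ + X]q modnDmr addnCA subnKC ?(ltnW lu) // modnDr.
    by rewrite modn_small.
  exists (fun w => h (phase w + (l.+1 - phase u))); first exact: hom_closed.
  by rewrite subnKC ?(ltnW lu) // -[h l.+1]hm modnn -[h (phase v + _)]hm.
case: u v pE nuv => [c|[t k]] [c'|[t' k']] /=.
- by rewrite modn_small //; lia.
- rewrite modn_small; last lia.
  move=> [k0] nuv; have t1 : node_at t' 1 = inr (t', k') by rewrite -node_atE k0.
  have wN : west t' <> c.
    by move=> wc; case/negP: nuv; have := @tedge_at t' 0 isT; rewrite t1 /node_at wc.
  have [a [x [y [x' [y' [[Sa Sx Sy [Sx' Sy']] [ax xy ax' xy' nxy]]]]]]] :=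
    branching eE p1 walk_pp compc nosplit.
  pose f0 d := if d == c then x else x'.
  pose b' s := if west s == c then y else y'.
  have af d : e a (f0 d) by rewrite /f0; case: ifP.
  have back z w : Sc z -> e a w -> e w z -> walk e (3 * p - 2) z a.
    move=> Sz aw wz; apply: (walk_back p1 walk_pp compc Sa Sz) => //; last lia.
    by apply: (@walk_cat _ _ 1 1 _ w); rewrite walk1.
  have [|s|s|s|f [fh f0E fE]] := @hom_via f0 (f0 \o west) b' 0 (3 * p - 1).
  + by lia.
  + exact: eqxx.
  + by rewrite /f0 /b' /=; case: ifP.
  + rewrite (_ : 3 * p - 1 = 3 * p - 2 + 1); last lia.
    apply: (@walk_cat _ _ _ 1 _ a); last by rewrite walk1.
    by rewrite /b'; case: ifP => _; [apply: back ax xy | apply: back ax' xy'].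
  exists f => //; have [_] := fE t'.
  by rewrite t1 => ->; rewrite f0E /f0 eqxx /b' (introF eqP wN).
- have lk := ltn_ord k; have [kl|kl] := ltnP k.+2 l.+1; first by rewrite modn_small.
  have kE : k.+1 = l by lia.
  move=> _ nuv; have wN : east t <> c'.
    move=> wc; case/negP: nuv; have := @tedge_at t k.+1 (ltac:(lia)).
    by rewrite node_atE kE node_at_last wc.
  have [x [y [x' [y' [b [[Sx Sy Sx' [Sy' Sb]] [xy yb xy' yb' nxy]]]]]]] :=
    merging eE p1 walk_pp compc nosplit.
  pose f0 d := if d == c' then y' else y.
  pose g s := if east s == c' then x' else x.
  have fb d : e (f0 d) b by rewrite /f0; case: ifP.
  have back z w : Sc z -> e z w -> e w b -> walk e (3 * p - 2) b z.
    move=> Sz aw wz; apply: (walk_back p1 walk_pp compc Sz Sb) => //; last lia.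
    by apply: (@walk_cat _ _ 1 1 _ w); rewrite walk1.
  have [|s|s|s|f [fh f0E fE]] := @hom_via f0 g (f0 \o east) l 0.
  + by rewrite addn0.
  + rewrite (_ : l = 1 + (3 * p - 2)); last lia.
    apply: (@walk_cat _ _ 1 _ _ b); first by rewrite walk1.
    by rewrite /g; case: ifP => _; [apply: back xy' yb' | apply: back xy yb].
  + by rewrite /f0 /g /=; case: ifP.
  + exact: eqxx.
  exists f => //; have [+ _] := fE t.
  rewrite -{1}kE node_atE => ->.
  by rewrite f0E /f0 eqxx /g (introF eqP wN).
have lk := ltn_ord k; have [kl|kl] := ltnP k.+2 l.+1; last first.
  by have -> : k.+2 = l.+1 by [lia]; rewrite modnn.
rewrite modn_small // => -[kk] nuv.
have atk s : node_at s k.+1 = inr (s, k) by rewrite node_atE.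
have atk' s : node_at s k.+2 = inr (s, k') by rewrite -kk node_atE.
have wN : t' <> t.
  by move=> wc; case/negP: nuv; have := @tedge_at t k.+1 (ltac:(lia)); rewrite atk atk' wc.
suff [f0 [b [b' [w1 w2 w3 nb]]]] : exists (f0 : A) b b', [/\ forall s, walk e k.+1 f0 (b s),
    forall s, e (b s) (b' s), forall s, walk e (l - k.+1) (b' s) f0 & ~~ e (b t) (b' t')].
  have [|f [fh _ fE]] := @hom_via (fun=> f0) b b' k.+1 (l - k.+1) _ w1 w2 w3.
    by lia.
  by exists f => //; rewrite -atk -atk' (fE t).1 (fE t').2.
have wN' : (t' == t) = false by apply/eqP.
(* All colours are sent to one vertex [q]. Near the start of the tile the pattern is entered freely
   from [q] and left by [walk_back]; near the end it is entered by [walk_back] and left freely. *)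
have [kp|kp] := leqP k.+2 (2 * p).
  have [a [x [y [x' [y' [[Sa Sx Sy [Sx' Sy']] [ax xy ax' xy' nxy]]]]]]] :=
    branching eE p1 walk_pp compc nosplit.
  have [q [Sq qa]] : exists q, Sc q /\ walk e k q a.
    elim: (k : nat) => [|n [q [Sq qa]]]; first by exists a; rewrite /= eqxx.
    have [r Sr' rq] := component_pred p1 walk_pp compc Sq.
    by exists r; split=> //; apply: (@walk_cat _ _ 1 _ _ q); rewrite ?walk1.
  exists q, (fun s => if s == t then x else x'), (fun s => if s == t then y else y').
  have q1 z : e a z -> walk e k.+1 q z.
    by rewrite -addn1 => az; apply: walk_cat qa _; rewrite walk1.
  have q2 z w : Sc w -> e a z -> e z w -> walk e (l - k.+1) w q.
    move=> Sw /q1 qz zw; rewrite (_ : l - k.+1 = 3 * p - k.+2); last lia.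
    apply: (walk_back p1 walk_pp compc Sq Sw) => //.
    by rewrite -addn1; apply: walk_cat qz _; rewrite walk1.
  split=> [s|s|s|]; last by rewrite eqxx wN'.
  - by case: ifP => _; apply: q1.
  - by case: ifP.
  - by case: ifP => _; [apply: (q2 x) | apply: (q2 x')].
have [x [y [x' [y' [b [[Sx Sy Sx' [Sy' Sb]] [xy yb xy' yb' nxy]]]]]]] :=
  merging eE p1 walk_pp compc nosplit.
have [q [Sq bq]] : exists q, Sc q /\ walk e (l - k.+2) b q.
  elim: (l - k.+2) => [|n [q [Sq bq]]]; first by exists b; rewrite /= eqxx.
  have [_ _ _ /(_ q Sq)[r Sr' qr]] := compc.
  by exists r; split=> //; rewrite -addn1; apply: walk_cat bq _; rewrite walk1.
exists q, (fun s => if s == t then x else x'), (fun s => if s == t then y else y').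
have q1 z : e z b -> walk e (l - k.+1) z q.
  rewrite (_ : l - k.+1 = 1 + (l - k.+2)); last lia.
  by move=> zb; apply: walk_cat bq; rewrite walk1.
have q2 z w : Sc w -> e w z -> e z b -> walk e k.+1 q w.
  move=> Sw wz /q1 zq; have := walk_back p1 walk_pp compc Sw Sq (j := 1 + (l - k.+1)).
  rewrite (_ : 3 * p - (1 + _) = k.+1); last lia.
  by apply; [apply: walk_cat zq; rewrite walk1 | lia].
split=> [s|s|s|]; last by rewrite eqxx wN'.
- by case: ifP => _; [apply: (q2 y) | apply: (q2 y')].
- by case: ifP.
- by case: ifP => _; apply: q1.
Qed.
End Template.

(* Short cyclic shifts are seen inside the runs of length [n ^ 2] of [E]; the
   others, up to half of the period, move a run of [D] into the final part. *)
Lemma aligning_rows (T : eqType) (I : seq T) (marker : nat -> T) (n : nat) : 0 < n ->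
  exists rows : seq T, [/\ {subset I <= rows},
    forall f, f \in rows -> f \in I \/ exists a, f = marker a, 0 < size rows &
    forall x0 s a b, 0 < s < size rows -> a < n -> b < n ->
      exists2 r, r < size rows & nth x0 rows r = marker a /\
        nth x0 rows ((r + s) %% size rows) = marker b].
Proof.
move=> n0; pose K := n * n.
pose pairs := [seq (a, b) | a <- iota 0 n, b <- iota 0 n].
(* Every ordered pair of markers occurs as two adjacent runs of length K; at their seam it is seen
   under every shift from 1 to K. *)
pose piece ab := nseq K (marker ab.1) ++ nseq K (marker ab.2).
pose E := flatten [seq piece ab | ab <- pairs].
pose D := flatten [seq nseq n (marker a) | a <- iota 0 n].
pose m := size (I ++ E ++ D).
pose B := mkseq (fun i => marker (i %% n)) m.
have sF (s : seq nat) : size (flatten [seq nseq n (marker a) | a <- s]) = size s * n.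
  by elim: s => //= a s IH; rewrite size_cat size_nseq IH.
have sD : size D = n * n by rewrite /D sF size_iota.
have mE : m = size I + (size E + n * n) by rewrite /m !size_cat sD.
pose rows := (I ++ E ++ D) ++ B.
have sR : size rows = m + m by rewrite size_cat size_mkseq.
have m0 : 0 < m by rewrite mE; nia.
exists rows; split.
- by move=> f fI; rewrite !mem_cat fI.
- move=> f; rewrite !mem_cat => /orP[/or3P[]|].
  + by left.
  + case/flattenP=> s /mapP[ab _ ->]; rewrite mem_cat !mem_nseq => /orP[]/andP[_ /eqP ->]; right.
      by exists ab.1.
    by exists ab.2.
  + by case/flattenP=> s /mapP[a _ ->]; rewrite mem_nseq => /andP[_ /eqP ->]; right; exists a.
  + by case/mapP=> i _ ->; right; exists (i %% n).
- by rewrite sR addn_gt0 m0.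
move=> x0.
have half s a b : 0 < s <= m -> a < n -> b < n -> exists2 r, r < size rows &
    nth x0 rows r = marker a /\ nth x0 rows ((r + s) %% size rows) = marker b.
  move=> /andP[s0 sm] an bn; have K0 : 0 < K by rewrite muln_gt0 n0.
  have [sK|Ks] := leqP s K.
    have [p1 [p2 pE]] : exists p1 p2, pairs = p1 ++ (a, b) :: p2.
      have : (a, b) \in pairs by apply/allpairsP; exists (a, b); rewrite /= !mem_iota !add0n.
      by case/splitPr=> p1 p2; exists p1, p2.
    pose pre := I ++ flatten [seq piece ab | ab <- p1].
    have [post rE] : exists post, rows = pre ++ piece (a, b) ++ post.
      exists (flatten [seq piece ab | ab <- p2] ++ D ++ B).
      by rewrite /rows /E pE map_cat flatten_cat /= -!catA.
    have sz : size pre + (K + K) <= size rows by rewrite rE !size_cat !size_nseq; lia.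
    have at_ k : k < K + K -> nth x0 rows (size pre + k) = if k < K then marker a else marker b.
      move=> kK; rewrite rE nth_cat ifF ?addKn; last by lia.
      rewrite nth_cat size_cat !size_nseq kK nth_cat size_nseq !nth_nseq.
      by case: ifP => // ?; rewrite ifT //; lia.
    exists (size pre + K.-1); first by lia.
    rewrite modn_small; last by lia.
    rewrite -addnA !at_; try lia.
    by split; [rewrite ifT; last lia | rewrite ifF; last lia]; reflexivity.
  have [d1 [d2 dE]] : exists d1 d2, iota 0 n = d1 ++ a :: d2.
    have : a \in iota 0 n by rewrite mem_iota.
    by case/splitPr=> d1 d2; exists d1, d2.
  pose pre := I ++ E ++ flatten [seq nseq n (marker a) | a <- d1].
  have sn : size d1 + (1 + size d2) = n by rewrite -[RHS](size_iota 0) dE size_cat.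
  have spre : size pre + n + size d2 * n = m by rewrite /pre !size_cat sF mE; nia.
  have preK : m <= size pre + K by rewrite /K; nia.
  have [post rE] : exists post, rows = pre ++ nseq n (marker a) ++ post.
    exists (flatten [seq nseq n (marker a) | a <- d2] ++ B).
    by rewrite /rows /D dE map_cat flatten_cat /= -!catA.
  (* The n rows of the run of [marker a], once shifted, cover a full period of [B]; [k] is the row
     of the run that meets [marker b]. *)
  pose u := size pre + s - m.
  pose k := (b + (n - u %% n)) %% n.
  have kn : k < n by rewrite ltn_pmod.
  have uk : (u + k) %% n = b.
    have lu : u %% n <= n by apply: ltnW; rewrite ltn_pmod.
    by rewrite modnDmr -modnDml addnCA (subnKC lu) modnDr modn_small.
  exists (size pre + k); first by rewrite sR; lia.
  rewrite modn_small; last by rewrite sR; lia.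
  split; first by rewrite rE nth_cat ifF ?addKn ?nth_cat ?size_nseq ?kn ?nth_nseq ?kn //; lia.
  rewrite /rows nth_cat ifF -/m; last by lia.
  rewrite nth_mkseq; last by lia.
  by rewrite -uk; congr (marker (_ %% n)); lia.
(* A shift beyond half of the period is the inverse of a shorter one, with the two markers
   exchanged. *)
move=> s a b /andP[s0 sl] an bn; have [sm|ms] := leqP s m; first by apply: half; rewrite ?s0.
have [|r lr [rb ra]] := half (m + m - s) b a _ bn an; first lia.
rewrite sR in lr ra *.
exists ((r + (m + m - s)) %% (m + m)); first by rewrite ltn_pmod //; lia.
by rewrite ra modnDml -addnA subnK ?modnDr ?modn_small //; lia.
Qed.

(** * The substitutive skeleton *)

Notation digit := (option bool).
Notation d0 := (None : digit).
Notation d1 := (Some false : digit).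
Notation d2 := (Some true : digit).
Definition dsucc (d : digit) : digit :=
  match d with None => d1 | Some false => d2 | Some true => d0 end.

(* The centre of every block is the seed of a zone. Inside a zone, the first
   component of a content is [hoff] off the rows of cells, and [hmid] (or [htop] in
   a zone of a single cell) on the row of the origin of the machine tape; the
   second one tells whether the tile lies on a column of cells. *)
Notation hkind := (option (option bool)).
Notation hoff := (None : hkind).
Notation hnorm := (Some None : hkind).
Notation hmid := (Some (Some false) : hkind).
Notation htop := (Some (Some true) : hkind).
Notation content := (hkind * bool)%type.

(** Each refinement doubles the rows of cells, and the middle row, of rank 2^(n-1) among 2^n, is the
    lower child of the former middle row. At the first refinement it is instead the upper child of
    the only row; [htop] records this case. *)
Definition hsub (h : hkind) (b : digit) : hkind :=
  match b, h with
  | Some false, _ => hoff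
  | None, Some (Some true) => hnorm
  | None, _ => h
  | Some true, None => hoff
  | Some true, Some (Some true) => hmid
  | Some true, _ => hnorm
  end.
Definition zone : content := (htop, true).
Definition csub (k : content) (p : digit * digit) : content :=
  if p == (d1, d1) then zone else (hsub k.1 p.2, k.2 && (p.1 != d1)).

(* The plane is cut into blocks of 3 x 3 tiles, these into blocks of 3 x 3 blocks,
   and so on. An edge carries its two digits inside its block ([cst] is constant
   along its line, [mv] moves) and the content [kk] of the block. The middle line
   of a block carries in [ln] and [cnt] the same data one level up, and its bottom
   line those of all higher levels, so that the blocks obey the same rule again;
   [msg] brings the place announced by the corner of a block to the crossing of
   lines that knows it. *)
Notation skedge :=
  (digit * digit * content * digit * (digit * content) * option (digit * digit))%type.
Definition cst (e : skedge) : digit := e.1.1.1.1.1.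
Definition mv (e : skedge) : digit := e.1.1.1.1.2.
Definition kk (e : skedge) : content := e.1.1.1.2.
Definition ln (e : skedge) : digit := e.1.1.2.
Definition cnt (e : skedge) : digit * content := e.1.2.
Definition msg (e : skedge) : option (digit * digit) := e.2.

(** Passage to the next block: the content of the parent may change only when the digit wraps
    around, at the border of the parent. *)
Definition cstep (G G' : digit * content) : Prop :=
  G'.1 = dsucc G.1 /\ (G.1 <> d2 -> G'.2 = G.2).

(** On the middle row the moving digit is the horizontal place of the block and the constant one its
    vertical place; on the middle column the roles are exchanged. *)
Definition crossing (W S : skedge) : Prop :=
  [/\ (cnt W).1 = ln S, (cnt S).1 = ln W & (cnt W).2 = (cnt S).2].

(** The bottom line meets the middle column, which knows the place of the block. It absorbs the
    message of a block on the left side of its parent but above its bottom; any other message comes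
    from a higher level and passes. *)
Definition rowmsg (W E S : skedge) : Prop :=
  match ln S, (cnt S).1 with
  | None, Some b => msg W = Some (d0, Some b) /\ msg E = None
  | _, _ => msg E = msg W
  end.

Definition rowpass (W E S : skedge) : Prop :=
  [/\ rowmsg W E S,
      (if (ln S, (cnt S).1) == (d2, d1) then cstep (cnt W) (cnt E)
       else cnt E = cnt W)
    & (ln S, (cnt S).1) = (d1, d1) ->
      (cnt S).2 = csub (cnt W).2 ((cnt W).1, ln W)].

Definition colmsg (S N W : skedge) : Prop :=
  match (cnt W).1 with
  | Some a => msg S = Some (Some a, ln W) /\ msg N = None
  | None => msg N = msg S
  end.

Definition colpass (S N W : skedge) : Prop :=
  colmsg S N W /\
  (if ((cnt W).1, ln W) == (d1, d2) then cstep (cnt S) (cnt N)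
   else cnt N = cnt S).

Definition rowsilent (W E : skedge) := msg W = None /\ msg E = None.

Ltac pp := repeat match goal with
  | H : _ /\ _ |- _ => case: H => ? ?
  | H : and3 _ _ _ |- _ => case: H => ? ? ?
  | H : and4 _ _ _ _ |- _ => case: H => ? ? ? ?
  | H : and5 _ _ _ _ _ |- _ => case: H => ? ? ? ? ?
  end.

Definition origin_rule (W E S N : skedge) (r : digit * digit) : Prop :=
  match r with
  | (None, None) => False
  | (None, Some false) =>
    [/\ msg W = None, msg E = Some r, cnt E = cnt W & colpass S N W]
  | (None, Some true) =>
    [/\ msg W = None, msg E = Some r, cnt E = cnt W, cnt N = cnt S & msg N = msg S]
  | (Some false, None) =>
    [/\ msg S = None, msg N = Some r, cnt N = cnt S & rowpass W E S]
  | (Some true, None) =>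
    [/\ msg S = None, msg N = Some r, cnt N = cnt S, cnt E = cnt W & msg E = msg W]
  | (Some a, Some b) =>
    [/\ rowsilent W E, msg S = None, msg N = Some r, cnt E = cnt W & cnt N = cnt S]
    /\ (r = (d1, d1) -> crossing W S)
  end.

Lemma origin_north W E S N r a b : origin_rule W E S N r ->
  msg S = None -> msg N = Some (Some a, b) -> r = (Some a, b).
Proof.
move=> H s n; case: r H => [[[]|] [[]|]] //=; rewrite /colpass ?s ?n => H; pp; try congruence.
match goal with H : colmsg _ _ _ |- _ => move: H end.
by rewrite /colmsg s n; case: (cnt W).1 => [?|] // [].
Qed.

Lemma origin_east W E S N r b : origin_rule W E S N r ->
  msg W = None -> msg E = Some (d0, Some b) -> r = (d0, Some b).
Proof.
move=> H w e; case: r H => [[[]|] [[]|]] //=; rewrite /rowpass /rowsilent ?w ?e => H; pp;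
  try congruence.
match goal with H : rowmsg _ _ _ |- _ => move: H end.
by rewrite /rowmsg w e; case: (ln S) (cnt S).1 => [?|] [?|] // [].
Qed.

Definition base_rule (W E S N : skedge) (K : content) (r : digit * digit) : Prop :=
  match mv W, mv S with
  | None, None =>
    origin_rule W E S N r
  | Some false, None => [/\ rowsilent S N, cnt N = cnt S & rowpass W E S]
  | Some true, None => [/\ rowsilent S N, cnt E = cnt W & msg E = msg W]
  | None, Some false => [/\ rowsilent W E, cnt E = cnt W & colpass S N W]
  | None, Some true => [/\ rowsilent W E, cnt N = cnt S & msg N = msg S]
  | Some a, Some b =>
    [/\ rowsilent W E, rowsilent S N &
    match a, b with
    | false, false =>
      [/\ crossing W S, cnt E = cnt W, cnt N = cnt S & K = csub (cnt W).2 (ln S, ln W)]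
    | true, false => cstep (cnt W) (cnt E)
    | false, true => cstep (cnt S) (cnt N)
    | true, true => True
    end]
  end.

Definition skrule (W E S N : skedge) (K : content) (r : digit * digit) : Prop :=
  [/\ [/\ mv S = cst W, cst S = mv W, cst E = cst W & cst N = cst S],
      [/\ mv E = dsucc (mv W), mv N = dsucc (mv S), ln E = ln W & ln N = ln S],
      [/\ mv W <> d0 -> kk W = K, mv W <> d2 -> kk E = K,
          mv S <> d0 -> kk S = K & mv S <> d2 -> kk N = K]
    & base_rule W E S N K r].

Definition mkedge c m k l g p : skedge := (c, m, k, l, g, p).

Lemma edgeE c m k l g p :
  ((cst (mkedge c m k l g p) = c) * (mv (mkedge c m k l g p) = m) *
   (kk (mkedge c m k l g p) = k) * (ln (mkedge c m k l g p) = l) *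
   (cnt (mkedge c m k l g p) = g) * (msg (mkedge c m k l g p) = p))%type.
Proof. by []. Qed.

(* The nine tiles of one block; [h a b] is the west edge of the tile at
   [(a, b)] and [v a b] its south edge. *)
Section Block.
Variables (h v : nat -> nat -> skedge) (K : nat -> nat -> content)
  (r : nat -> nat -> digit * digit).
Hypothesis rule : forall a b, (a < 3)%N -> (b < 3)%N ->
  skrule (h a b) (h a.+1 b) (v a b) (v a b.+1) (K a b) (r a b).
Hypothesis pos0 : mv (h 0 0) = d0 /\ cst (h 0 0) = d0.

Definition bx := ln (v 1 1).
Definition by_ := ln (h 1 1).
Definition bK := (cnt (h 1 1)).2.

Lemma block_pos a b : (a <= 3)%N -> (b < 3)%N ->
  mv (h a b) = iter a dsucc d0 /\ cst (h a b) = iter b dsucc d0.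
Proof.
case: pos0 => p0 q0.
have col b' : (b' < 3)%N -> mv (h 0 b') = d0 /\ cst (h 0 b') = iter b' dsucc d0.
  elim: b' => [//|b' IH] lb.
  have {}IH := IH (ltnW lb).
  have [[s1 s2 _ s4] [_ t2 _ _] _ _] := rule (isT : (0 < 3)%N) (ltnW lb).
  have [[u1 u2 _ _] _ _ _] := rule (isT : (0 < 3)%N) lb.
  by rewrite -u1 t2 s1 -u2 s4 s2; case: IH => -> ->.
elim: a => [//|a IH] la lb; first exact: col.
have [[_ _ s3 _] [t1 _ _ _] _ _] := rule la lb.
by case: (IH (ltnW la) lb) => p q; rewrite t1 s3 p q.
Qed.

Lemma block_posv a b : (a < 3)%N -> (b <= 3)%N ->
  cst (v a b) = iter a dsucc d0 /\ mv (v a b) = iter b dsucc d0.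
Proof.
move=> la; case: b => [|b] lb.
  have [[-> -> _ _] _ _ _] := rule la (isT : (0 < 3)%N).
  by case: (block_pos (ltnW la) (isT : (0 < 3)%N)).
have [[s1 s2 _ s4] [_ t2 _ _] _ _] := rule la lb.
by case: (block_pos (ltnW la) lb) => p q; rewrite s4 t2 s1 s2 p q.
Qed.

Lemma block_lnh b : (b < 3)%N -> ln (h 1 b) = ln (h 0 b) /\
  ln (h 2 b) = ln (h 0 b) /\ ln (h 3 b) = ln (h 0 b).
Proof.
move=> lb.
have [_ [_ _ e1 _] _ _] := rule (isT : (0 < 3)%N) lb.
have [_ [_ _ e2 _] _ _] := rule (isT : (1 < 3)%N) lb.
have [_ [_ _ e3 _] _ _] := rule (isT : (2 < 3)%N) lb.
by rewrite e3 e2 e1.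
Qed.

Lemma block_lnv a : (a < 3)%N -> ln (v a 1) = ln (v a 0) /\
  ln (v a 2) = ln (v a 0) /\ ln (v a 3) = ln (v a 0).
Proof.
move=> la.
have [_ [_ _ _ e1] _ _] := rule la (isT : (0 < 3)%N).
have [_ [_ _ _ e2] _ _] := rule la (isT : (1 < 3)%N).
have [_ [_ _ _ e3] _ _] := rule la (isT : (2 < 3)%N).
by rewrite e3 e2 e1.
Qed.

Lemma block_base a b : (a < 3)%N -> (b < 3)%N ->
  [/\ mv (h a b) = iter a dsucc d0, mv (v a b) = iter b dsucc d0 &
  base_rule (h a b) (h a.+1 b) (v a b) (v a b.+1) (K a b) (r a b)].
Proof.
move=> la lb; have [_ _ _ B] := rule la lb; split=> //.
  by case: (block_pos (ltnW la) lb).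
by case: (block_posv la (ltnW lb)).
Qed.

Lemma block_row1 : cnt (h 0 1) = (bx, bK) /\ cnt (h 2 1) = (bx, bK) /\
  cstep (bx, bK) (cnt (h 3 1)).
Proof.
have [p1 p2 +] := block_base (isT : (0 < 3)%N) (isT : (1 < 3)%N).
rewrite /base_rule p1 p2 {p1 p2} => /= -[_ e1 _].
have [p1 p2 +] := block_base (isT : (1 < 3)%N) (isT : (1 < 3)%N).
rewrite /base_rule p1 p2 {p1 p2} => /= -[_ _ [[c1 c2 c3] e2 _ _]].
have [p1 p2 +] := block_base (isT : (2 < 3)%N) (isT : (1 < 3)%N).
rewrite /base_rule p1 p2 {p1 p2} => /= -[_ _].
have E : cnt (h 1 1) = (bx, bK) by rewrite [LHS]surjective_pairing c1.
by rewrite e2 -e1 E.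
Qed.

Lemma block_col1 : cnt (v 1 0) = (by_, bK) /\ cnt (v 1 2) = (by_, bK) /\
  cstep (by_, bK) (cnt (v 1 3)).
Proof.
have [p1 p2 +] := block_base (isT : (1 < 3)%N) (isT : (0 < 3)%N).
rewrite /base_rule p1 p2 {p1 p2} => /= -[_ e1 _].
have [p1 p2 +] := block_base (isT : (1 < 3)%N) (isT : (1 < 3)%N).
rewrite /base_rule p1 p2 {p1 p2} => /= -[_ _ [[c1 c2 c3] _ e2 _]].
have [p1 p2 +] := block_base (isT : (1 < 3)%N) (isT : (2 < 3)%N).
rewrite /base_rule p1 p2 {p1 p2} => /= -[_ _].
have E : cnt (v 1 1) = (by_, bK) by rewrite [LHS]surjective_pairing c2 /bK c3.
by rewrite e2 -e1 E.
Qed.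

Lemma block_K a b : (a < 3)%N -> (b < 3)%N -> K a b = csub bK (bx, by_).
Proof.
have K11 : K 1 1 = csub bK (bx, by_).
  have [p1 p2 +] := block_base (isT : (1 < 3)%N) (isT : (1 < 3)%N).
  by rewrite /base_rule p1 p2 {p1 p2} => /= -[_ _ [_ _ _ ->]].
have row a' b' : (a'.+1 < 3)%N -> (b' < 3)%N -> K a'.+1 b' = K a' b'.
  move=> la lb.
  have [_ _ [_ k1 _ _] _] := rule (ltnW la) lb.
  have [_ _ [k2 _ _ _] _] := rule la lb.
  rewrite -k1 -?k2 //.
    by case: (block_pos (ltnW la) lb) => -> _; case: a' la {k1 k2} => [|[]].
  by case: (block_pos (ltnW (ltnW la)) lb) => -> _; case: a' la {k1 k2} => [|[]].
have col a' b' : (a' < 3)%N -> (b'.+1 < 3)%N -> K a' b'.+1 = K a' b'.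
  move=> la lb.
  have [_ _ [_ _ _ k1] _] := rule la (ltnW lb).
  have [_ _ [_ _ k2 _] _] := rule la lb.
  rewrite -k1 -?k2 //.
    by case: (block_posv la (ltnW lb)) => _ ->; case: b' lb {k1 k2} => [|[]].
  by case: (block_posv la (ltnW (ltnW lb))) => _ ->; case: b' lb {k1 k2} => [|[]].
move=> la lb.
have rows b' : (b' < 3)%N -> K 0 b' = K 1 b' /\ K 2 b' = K 1 b'.
  by move=> lb'; rewrite -row // [K 2 b']row.
have c1 : K 1 0 = K 1 1 /\ K 1 2 = K 1 1 by rewrite -col // [K 1 2]col.
have [c10 c12] := c1.
by case: a la => [|[|[|]]] // _; case: b lb => [|[|[|]]] // _;
  rewrite ?(proj1 (rows _ _)) ?(proj2 (rows _ _)) // ?c10 ?c12.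
Qed.

Hypothesis below : bx <> d0 -> msg (v 0 0) = None.
Hypothesis leftmsg : bx = d0 -> by_ <> d0 -> msg (h 0 0) = None.

Lemma block_above : bx <> d0 -> msg (v 0 3) = None.
Proof.
move=> bx0.
have [p1 p2 +] := block_base (isT : (0 < 3)%N) (isT : (1 < 3)%N).
have [e0 _] := block_row1.
rewrite /base_rule p1 p2 {p1 p2} => /= -[_ _ [+ _]]; rewrite /colmsg e0 /=.
have [p1 p2 +] := block_base (isT : (0 < 3)%N) (isT : (2 < 3)%N).
rewrite /base_rule p1 p2 {p1 p2} => /= -[_ _ ->].
by move: bx0; case: bx => [a|//] _ [].
Qed.

(** No message enters the block from outside on the relevant line, so the one absorbed by its middle
    line was emitted by its own corner. *)
Lemma block_r : (bx, by_) <> (d0, d0) -> r 0 0 = (bx, by_).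
Proof.
move=> nz.
have [p1 p2 +] := block_base (isT : (0 < 3)%N) (isT : (0 < 3)%N).
rewrite /base_rule p1 p2 {p1 p2} /= => O.
have [bx0|bx0] := eqVneq bx d0; last first.
  have [p1 p2 +] := block_base (isT : (0 < 3)%N) (isT : (1 < 3)%N).
  have [e0 _] := block_row1.
  rewrite /base_rule p1 p2 {p1 p2} => /= -[_ _ [+ _]]; rewrite /colmsg e0 /=.
  have by1 : ln (h 0 1) = by_ by rewrite /by_; case: (block_lnh (isT : (1 < 3)%N)) => ->.
  rewrite by1.
  have /eqP/below b0 := bx0.
  case: bx bx0 => [a|//] _ [m1 _].
  exact: origin_north O b0 m1.
have by0 : by_ <> d0 by move=> q; apply: nz; rewrite bx0 q.
have l0 := leftmsg bx0 by0.
have [p1 p2 +] := block_base (isT : (1 < 3)%N) (isT : (0 < 3)%N).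
have [e0 _] := block_col1.
rewrite /base_rule p1 p2 {p1 p2} => /= -[_ _ [+ _ _]]; rewrite /rowmsg e0 /=.
have bx1 : ln (v 1 0) = bx by rewrite /bx; case: (block_lnv (isT : (1 < 3)%N)) => ->.
rewrite bx1 bx0; case: by_ by0 => [b|//] _ [m1 _].
exact: origin_east O l0 m1.
Qed.

Lemma block_right : bx <> d0 -> by_ <> d0 -> msg (h 3 0) = None.
Proof.
move=> bx0 by0.
have rE : r 0 0 = (bx, by_) by apply: block_r => -[].
have [p1 p2 +] := block_base (isT : (0 < 3)%N) (isT : (0 < 3)%N).
rewrite /base_rule p1 p2 {p1 p2} /= rE => O.
have {O} : msg (h 1 0) = None.
  by move: O; case: bx by_ bx0 by0 => [[]|] [[]|] //= _ _ [[[_ ->]]].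
have [p1 p2 +] := block_base (isT : (1 < 3)%N) (isT : (0 < 3)%N).
have [e0 _] := block_col1.
rewrite /base_rule p1 p2 {p1 p2} => /= -[_ _ [+ _ _]]; rewrite /rowmsg e0 /=.
have -> : ln (v 1 0) = bx by rewrite /bx; case: (block_lnv (isT : (1 < 3)%N)) => ->.
have [p1 p2 +] := block_base (isT : (2 < 3)%N) (isT : (0 < 3)%N).
rewrite /base_rule p1 p2 {p1 p2} => /= -[_ _ ->].
by case: bx bx0 => // a _ -> ->.
Qed.

Definition bE : skedge := mkedge by_ bx bK (ln (h 0 0)) (cnt (h 0 0)) (msg (h 0 0)).

(** If the block is not the corner of its parent, [block_r] makes its own corner apply the clause
    asked of the block, and the middle lines add what the corner cannot see. If it is, the clause
    asked is again [origin_rule] with the same role, and the middle lines let everything pass. *)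
Lemma block_coarse K1 K2 :
  (bx <> d2 -> K1 = bK) -> (by_ <> d2 -> K2 = bK) ->
  skrule (mkedge by_ bx bK (ln (h 0 0)) (cnt (h 0 0)) (msg (h 0 0)))
         (mkedge by_ (dsucc bx) K1 (ln (h 3 0)) (cnt (h 3 0)) (msg (h 3 0)))
         (mkedge bx by_ bK (ln (v 0 0)) (cnt (v 0 0)) (msg (v 0 0)))
         (mkedge bx (dsucc by_) K2 (ln (v 0 3)) (cnt (v 0 3)) (msg (v 0 3)))
         bK (r 0 0).
Proof.
move=> K1E K2E; split; [by []| |by []|].
  have [_ [_ h3]] := block_lnh (isT : (0 < 3)%N).
  by have [_ [_ v3]] := block_lnv (isT : (0 < 3)%N).
have [p1 p2 +] := block_base (isT : (0 < 3)%N) (isT : (0 < 3)%N).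
rewrite /base_rule p1 p2 {p1 p2} /= => O.
have [p1 p2 +] := block_base (isT : (1 < 3)%N) (isT : (0 < 3)%N).
have [e0 _] := block_col1; have [f0 _] := block_row1.
have bx1 : ln (v 1 0) = bx by rewrite /bx; case: (block_lnv (isT : (1 < 3)%N)) => ->.
have by1 : ln (h 0 1) = by_ by rewrite /by_; case: (block_lnh (isT : (1 < 3)%N)) => ->.
have lnh1 : ln (h 1 0) = ln (h 0 0) by case: (block_lnh (isT : (0 < 3)%N)).
have lnv1 : ln (v 0 1) = ln (v 0 0) by case: (block_lnv (isT : (0 < 3)%N)).
rewrite /base_rule p1 p2 {p1 p2} => /= -[_ _]; rewrite /rowpass /rowmsg e0 bx1 /= lnh1 => -[rm rc rk].
have [p1 p2 +] := block_base (isT : (2 < 3)%N) (isT : (0 < 3)%N).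
rewrite /base_rule p1 p2 {p1 p2} => /= -[_ r2c r2m].
have [p1 p2 +] := block_base (isT : (0 < 3)%N) (isT : (1 < 3)%N).
rewrite /base_rule p1 p2 {p1 p2} => /= -[_ _]; rewrite /colpass /colmsg f0 by1 /= => -[cm cc].
have [p1 p2 +] := block_base (isT : (0 < 3)%N) (isT : (2 < 3)%N).
rewrite /base_rule p1 p2 {p1 p2} => /= -[_ c2c c2m].
have h3c : cnt (h 3 0) = cnt (h 2 0) by [].
have v3c : cnt (v 0 3) = cnt (v 0 2) by [].
rewrite /base_rule !edgeE.
have [z|/eqP nz] := eqVneq (bx, by_) (d0, d0).
  move: z rm rc rk cm cc; case=> -> -> /= rm rc _ cm cc.
  have e1 : cnt (h 3 0) = cnt (h 1 0) by rewrite h3c.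
  have e2 : msg (h 3 0) = msg (h 1 0) by rewrite r2m.
  have e3 : cnt (v 0 3) = cnt (v 0 1) by rewrite v3c.
  have e4 : msg (v 0 3) = msg (v 0 1) by rewrite c2m.
  move: O; rewrite /origin_rule.
  case: (r 0 0) => [[[]|] [[]|]] //=;
    rewrite /rowsilent /colpass /colmsg /rowpass /rowmsg /crossing !edgeE ?e1 ?e2 ?e3 ?e4;
    by [].
have rE := block_r nz; rewrite rE in O *.
move: nz O rm rc rk cm cc; rewrite -h3c -v3c -r2m -c2m.
move: (h 0 0) (h 1 0) (h 3 0) (v 0 0) (v 0 1) (v 0 3) bx by_ bK lnh1 lnv1.
clear=> h0 h1 h3 v0 v1 v3 x y k e1 e2.
rewrite /origin_rule /rowsilent /colpass /colmsg /rowpass /rowmsg /crossing !edgeE.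
case: x y => [[]|] [[]|] // _.
- by move=> [[[-> m1] -> _ _ _] _] -> _ _ [_ ->] _.
- by move=> [[[-> m1] -> _ <- _] _] -> st _ [_ ->] _.
- by move=> [-> _ _ <- <-] -> -> _ [_ ->] _.
- by move=> [[[-> m1] -> _ _ <-] _] -> _ _ [_ ->] st.
- move=> [[[-> m1] -> _ c1 <-] /(_ erefl)[x1 x2 x3]] -> -> /(_ erefl) kE [_ ->] ->.
  by split; rewrite ?m1 // c1 x1 in kE *.
- by move=> [-> _ <- [r1 r2 r3]] -> -> _ [_ ->] ->.
- by move=> [-> _ _ <- <-] [_ ->] _ _ -> ->.
- by move=> [-> _ <- [r1 r2]] [_ ->] -> _ -> ->.
Qed.

End Block.

Definition skeleton (h v : nat -> nat -> skedge) (K : nat -> nat -> content)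
    (r : nat -> nat -> digit * digit) : Prop :=
  forall x y, skrule (h x y) (h x.+1 y) (v x y) (v x y.+1) (K x y) (r x y).

Definition dig (n : nat) : digit := iter (n %% 3) dsucc d0.

Lemma iter_dsucc3 n d : iter (3 * n) dsucc d = d.
Proof. by elim: n => // n IH; rewrite mulnS iterD IH; case: d {IH} => [[]|]. Qed.

Lemma iter_dsucc_add m n d : iter (m + 3 * n) dsucc d = iter m dsucc d.
Proof. by rewrite iterD iter_dsucc3. Qed.

Section Coarsen.
Variables (h v : nat -> nat -> skedge) (K : nat -> nat -> content)
  (r : nat -> nat -> digit * digit).
Hypothesis sk : skeleton h v K r.

Lemma skel_cst_h x y : cst (h x y) = cst (h 0 y).
Proof. by elim: x => // x <-; case: (sk x y) => -[]. Qed.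

Lemma skel_mv_h x y : mv (h x y) = iter x dsucc (mv (h 0 0)).
Proof.
have cv : cst (v x y) = cst (v x 0).
  by elim: y => // y <-; case: (sk x y) => -[].
have [[_ e1 _ _] _ _ _] := sk x y; rewrite -e1 cv.
have [[_ -> _ _] _ _ _] := sk x 0.
by elim: x {cv e1} => // x IH; have [_ [-> _ _ _] _ _] := sk x 0; rewrite IH.
Qed.

Lemma skel_cst_hE x y : cst (h x y) = iter y dsucc (cst (h 0 0)).
Proof.
rewrite skel_cst_h; elim: y => // y IH.
have [[_ _ _ _] [_ e2 _ _] _ _] := sk 0 y.
by have [[<- _ _ _] _ _ _] := sk 0 y.+1; rewrite e2; have [[-> _ _ _] _ _ _] := sk 0 y; rewrite IH.
Qed.

Lemma skel_ln_h x y : ln (h x y) = ln (h 0 y).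
Proof. by elim: x => // x <-; case: (sk x y) => _ []. Qed.

Lemma skel_ln_v x y : ln (v x y) = ln (v x 0).
Proof. by elim: y => // y <-; case: (sk x y) => _ []. Qed.

Section At.
Variables X Y : nat.
Hypothesis pos : mv (h X Y) = d0 /\ cst (h X Y) = d0.

Definition hb a b := h (X + a) (Y + b).
Definition vb a b := v (X + a) (Y + b).
Definition Kb a b := K (X + a) (Y + b).
Definition rb a b := r (X + a) (Y + b).

Lemma blk_rule a b : (a < 3)%N -> (b < 3)%N ->
  skrule (hb a b) (hb a.+1 b) (vb a b) (vb a b.+1) (Kb a b) (rb a b).
Proof. by move=> _ _; rewrite /hb /vb /Kb /rb !addnS; apply: sk. Qed.

Lemma blk_pos : mv (hb 0 0) = d0 /\ cst (hb 0 0) = d0.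
Proof. by rewrite /hb !addn0. Qed.
End At.

Lemma aligned_shift X Y i j : mv (h X Y) = d0 /\ cst (h X Y) = d0 ->
  mv (h (X + 3 * i) (Y + 3 * j)) = d0 /\ cst (h (X + 3 * i) (Y + 3 * j)) = d0.
Proof.
rewrite (skel_mv_h X) (skel_cst_hE X) (skel_mv_h (X + _)) (skel_cst_hE (X + _)).
by rewrite !iter_dsucc_add.
Qed.

Lemma blk_below X Y : mv (h X Y) = d0 /\ cst (h X Y) = d0 ->
  bx (vb X (3 + Y)) <> d0 -> msg (vb X (3 + Y) 0 0) = None.
Proof.
move=> p; have : bx (vb X (3 + Y)) = bx (vb X Y).
  by rewrite /bx /vb (skel_ln_v (_ + _)) [RHS](skel_ln_v (_ + _)).
move=> -> b0; have := block_above (@blk_rule X Y) (blk_pos p) b0.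
by rewrite /vb !addn0 addnC.
Qed.

Lemma blk_step X Y : mv (h X Y) = d0 /\ cst (h X Y) = d0 ->
  bx (vb (3 + X) Y) = dsucc (bx (vb X Y)) /\
  (bx (vb X Y) <> d2 -> bK (hb (3 + X) Y) = bK (hb X Y)).
Proof.
move=> p; have [_ [_ [/= c1 c2]]] := block_row1 (@blk_rule X Y) (blk_pos p).
have p' : mv (h (3 + X) Y) = d0 /\ cst (h (3 + X) Y) = d0.
  by have := aligned_shift 1 0 p; rewrite addn0 addnC.
have [d1 _] := block_row1 (@blk_rule (3 + X) Y) (blk_pos p').
have E : hb X Y 3 1 = hb (3 + X) Y 0 1 by rewrite /hb addn0 (addnC X).
by move: c1 c2; rewrite E d1.
Qed.

Lemma blk_stepv X Y : mv (h X Y) = d0 /\ cst (h X Y) = d0 ->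
  by_ (hb X (3 + Y)) = dsucc (by_ (hb X Y)) /\
  (by_ (hb X Y) <> d2 -> bK (hb X (3 + Y)) = bK (hb X Y)).
Proof.
move=> p; have [_ [_ [/= c1 c2]]] := block_col1 (@blk_rule X Y) (blk_pos p).
have p' : mv (h X (3 + Y)) = d0 /\ cst (h X (3 + Y)) = d0.
  by have := aligned_shift 0 1 p; rewrite addn0 addnC.
have [d1 _] := block_col1 (@blk_rule X (3 + Y)) (blk_pos p').
have E : vb X Y 1 3 = vb X (3 + Y) 1 0 by rewrite /vb addn0 (addnC Y).
by move: c1 c2; rewrite E d1.
Qed.

Lemma blk_left X Y : mv (h X Y) = d0 /\ cst (h X Y) = d0 ->
  bx (vb (3 + X) (3 + Y)) = d0 -> by_ (hb (3 + X) (3 + Y)) <> d0 ->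
  msg (hb (3 + X) (3 + Y) 0 0) = None.
Proof.
move=> p x0 y0.
have p' : mv (h X (3 + Y)) = d0 /\ cst (h X (3 + Y)) = d0.
  by have := aligned_shift 0 1 p; rewrite addn0 addnC.
have [s _] := blk_step p'.
have bn : bx (vb X (3 + Y)) <> d0 by move=> q; move: s; rewrite x0 q.
have yE : by_ (hb (3 + X) (3 + Y)) = by_ (hb X (3 + Y)).
  by rewrite /by_ /hb (skel_ln_h (_ + _)) [RHS](skel_ln_h (_ + _)).
rewrite yE in y0.
have := block_right (@blk_rule X (3 + Y)) (blk_pos p') (fun _ => blk_below p bn)
  (fun q => False_ind _ (bn q)) bn y0.
by rewrite /hb !addn0 addnC.
Qed.

Lemma coarsen : exists x0 y0 h' v' K' r', skeleton h' v' K' r' /\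
  forall i j a b, (a < 3)%N -> (b < 3)%N ->
  [/\ mv (h (x0 + 3 * i + a) (y0 + 3 * j + b)) = dig a,
      mv (v (x0 + 3 * i + a) (y0 + 3 * j + b)) = dig b &
      K (x0 + 3 * i + a) (y0 + 3 * j + b) =
        csub (K' i j) (mv (h' i j), mv (v' i j))].
Proof.
have [p pos] : exists p : nat * nat, mv (h p.1 p.2) = d0 /\ cst (h p.1 p.2) = d0.
  have e d : exists n, iter n dsucc d = d0.
    by case: d => [[]|]; [exists 1 | exists 2 | exists 0].
  have [m mE] := e (mv (h 0 0)); have [n nE] := e (cst (h 0 0)).
  by exists (m, n); rewrite (skel_mv_h m n) (skel_cst_hE m n).
case: p pos => X Y /= pos.
(* The first row and column of aligned blocks are dropped, so that each remaining block has
   neighbours below and on the left, which are known to send no stray message. *)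
pose x i := (3 + (X + 3 * i))%N; pose y j := (3 + (Y + 3 * j))%N.
have al i j := aligned_shift i j pos.
have al' i j : mv (h (x i) (y j)) = d0 /\ cst (h (x i) (y j)) = d0.
  have := aligned_shift 1 1 (al i j).
  by rewrite /x /y [3 + (X + _)]addnC [3 + (Y + _)]addnC.
pose h' i j := mkedge (by_ (hb (x i) (y j))) (bx (vb (x i) (y j))) (bK (hb (x i) (y j)))
  (ln (h (x i) (y j))) (cnt (h (x i) (y j))) (msg (h (x i) (y j))).
pose v' i j := mkedge (bx (vb (x i) (y j))) (by_ (hb (x i) (y j))) (bK (hb (x i) (y j)))
  (ln (v (x i) (y j))) (cnt (v (x i) (y j))) (msg (v (x i) (y j))).
exists (x 0), (y 0), h', v', (fun i j => bK (hb (x i) (y j))),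
  (fun i j => rb (x i) (y j) 0 0).
have xS i : x i.+1 = (3 + x i)%N by rewrite /x; lia.
have yS j : y j.+1 = (3 + y j)%N by rewrite /y; lia.
split.
  move=> i j.
  have [sx sK] := blk_step (al' i j); have [sy sKv] := blk_stepv (al' i j).
  have bel : bx (vb (x i) (y j)) <> d0 -> msg (vb (x i) (y j) 0 0) = None.
    apply: (@blk_below (x i) (Y + 3 * j)).
    have := aligned_shift 1 0 (al i j).
    by rewrite /x [3 + (X + _)]addnC muln0 addn0.
  have lef : bx (vb (x i) (y j)) = d0 -> by_ (hb (x i) (y j)) <> d0 ->
      msg (hb (x i) (y j) 0 0) = None.
    exact: (@blk_left (X + 3 * i) (Y + 3 * j)).
  have := block_coarse (@blk_rule (x i) (y j)) (blk_pos (al' i j)) bel lef sK sKv.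
  rewrite /h' /v' xS yS sx sy.
  have -> : by_ (hb (3 + x i) (y j)) = by_ (hb (x i) (y j)).
    by rewrite /by_ /hb (skel_ln_h (_ + _)) [RHS](skel_ln_h (_ + _)).
  have -> : bx (vb (x i) (3 + y j)) = bx (vb (x i) (y j)).
    by rewrite /bx /vb (skel_ln_v (_ + _)) [RHS](skel_ln_v (_ + _)).
  by rewrite /hb /vb !addn0 ![_ + 3]addnC.
move=> i j a b la lb.
have -> : (x 0 + 3 * i + a = x i + a)%N by rewrite /x; lia.
have -> : (y 0 + 3 * j + b = y j + b)%N by rewrite /y; lia.
have [mE _] := block_pos (@blk_rule (x i) (y j)) (blk_pos (al' i j)) (ltnW la) lb.
have [_ mvE] := block_posv (@blk_rule (x i) (y j)) (blk_pos (al' i j)) la (ltnW lb).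
have KE := block_K (@blk_rule (x i) (y j)) (blk_pos (al' i j)) la lb.
by rewrite /dig !modn_small.
Qed.
End Coarsen.

(** * Rows and columns of cells in a zone, as finite Cantor sets *)

Fixpoint supertile (n : nat) (k : content) (u w : nat) : content :=
  if n is n'.+1 then csub (supertile n' k (u %/ 3) (w %/ 3)) (dig u, dig w) else k.

Fixpoint cantor (n u : nat) : bool :=
  if n is n'.+1 then (u %% 3 != 1) && cantor n' (u %/ 3) else true.

(** The counting function of [cantor n]: the number of its elements below [u], as [crank0] and
    [crankS] show. It is the rank of a row or column of cells. *)
Fixpoint crank (n u : nat) : nat :=
  if n is n'.+1 then 2 * crank n' (u %/ 3) + (cantor n' (u %/ 3) && (0 < u %% 3)) else u.

Lemma digE u : (dig u == d1) = (u %% 3 == 1).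
Proof. by rewrite /dig; move: (ltn_pmod u (isT : 0 < 3)); case: (u %% 3) => [|[|[|]]]. Qed.

Lemma digit_cases u : exists q a, [/\ u = 3 * q + a, a < 3, u %/ 3 = q & u %% 3 = a].
Proof. by exists (u %/ 3), (u %% 3); split=> //; lia. Qed.

Lemma crankS n u : crank n u.+1 = crank n u + cantor n u.
Proof.
elim: n u => [|n IH] u /=; first by rewrite addn1.
have [q [a [uE la -> ->]]] := digit_cases u.
case: a la uE => [|[|[|]]] // _ uE.
- have -> : u.+1 %/ 3 = q by lia.
  have -> : u.+1 %% 3 = 1 by lia.
  by rewrite andbT andbF addn0.
- have -> : u.+1 %/ 3 = q by lia.
  have -> : u.+1 %% 3 = 2 by lia.
  by rewrite andbT addn0.
- have -> : u.+1 %/ 3 = q.+1 by lia.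
  have -> : u.+1 %% 3 = 0 by lia.
  by rewrite andbF andbT IH; case: cantor; lia.
Qed.

Lemma crank0 n : crank n 0 = 0.
Proof. by elim: n => //= n IH; rewrite div0n mod0n IH andbF. Qed.

Lemma cantor0 n : cantor n 0.
Proof. by elim: n => //= n IH; rewrite div0n mod0n IH. Qed.

Lemma crank_onto n r : r < 2 ^ n -> exists2 w, w < 3 ^ n & cantor n w /\ crank n w = r.
Proof.
elim: n r => [|n IH] r lr; first by exists r.
rewrite expnS in lr; have [|w lw [cw rw]] := IH r./2; first by lia.
exists (3 * w + 2 * odd r); first by rewrite expnS; lia.
rewrite /=; have -> : (3 * w + 2 * odd r) %/ 3 = w by lia.
have -> : (3 * w + 2 * odd r) %% 3 = 2 * odd r by lia.
by rewrite cw rw /=; split; [case: odd | lia].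
Qed.

Lemma crank_full n : crank n (3 ^ n) = 2 ^ n.
Proof.
elim: n => // n IH; rewrite /= expnS mulKn // IH.
have -> : 3 * 3 ^ n %% 3 = 0 by lia.
by rewrite andbF addn0 expnS.
Qed.

Lemma crank_le n u w : u <= w -> crank n u <= crank n w.
Proof.
move=> /subnK <-; elim: (w - u) => // m IH.
by rewrite addSn crankS (leq_trans IH) // leq_addr.
Qed.

Lemma cantorS n u : cantor n u -> u.+1 < 3 ^ n -> ~~ cantor n u.+1.
Proof.
elim: n u => [|n IH] u /=; first by rewrite expn0; lia.
have [q [a [uE la -> ->]]] := digit_cases u; rewrite expnS.
case: a la uE => [|[|[|]]] // _ uE /andP[_ cq] lu.
- by have -> : u.+1 %% 3 = 1 by lia.
- have -> : u.+1 %/ 3 = q.+1 by lia.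
  have -> : u.+1 %% 3 = 0 by lia.
  by rewrite /= IH //; lia.
Qed.

Lemma supertile_off n k u w : k.1 = hoff -> cantor n w ->
  (supertile n k u w).1 = hoff.
Proof.
move=> k0; elim: n u w => //= n IH u w /andP[w1 cw].
rewrite /csub; case: eqP => [[_ /eqP]|_]; first by rewrite digE (negPf w1).
by rewrite /= IH //; case: (dig w) => [[]|].
Qed.

Lemma supertile_offv n k u w : k.2 = false -> cantor n u ->
  (supertile n k u w).2 = false.
Proof.
move=> k0; elim: n u w => //= n IH u w /andP[u1 cu].
rewrite /csub; case: eqP => [[/eqP]|_]; first by rewrite digE (negPf u1).
by rewrite /= IH.
Qed.

Definition rowkind n w : hkind :=
  if ~~ cantor n w then hoff else if n == 0 then htop
  else if crank n w == 2 ^ n.-1 then hmid else hnorm.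

(** Places off both Cantor sets are left out, since smaller zones grow there from the centres of
    inner blocks. *)
Lemma zone_content n u w : w < 3 ^ n -> cantor n u || cantor n w ->
  supertile n zone u w = (rowkind n w, cantor n u).
Proof.
elim: n u w => [//|n IH] u w /= lw cc.
have lw3 : w %/ 3 < 3 ^ n by rewrite ltn_divLR // mulnC -expnS.
have cc3 : cantor n (u %/ 3) || cantor n (w %/ 3).
  by case/orP: cc => /andP[_ ->] //; rewrite orbT.
rewrite IH // /csub; case: eqP => [[/eqP + /eqP]|_].
  by rewrite !digE => u1 w1; move: cc; rewrite u1 w1.
rewrite /= digE [_ && (_ != 1)]andbC; congr pair.
rewrite /rowkind /= -/(dig w).
have [q [a [wE la wq wa]]] := digit_cases w; rewrite wq wa /dig wa.
rewrite wq in lw3.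
case: cantor; last by case: a la {wE wa} => [|[|[|]]] //.
case: n lw3 {IH lw cc cc3} => [|n] lw3 /=.
  have -> : q = 0 by move: lw3; rewrite expn0; lia.
  by case: a la {wE wa} => [|[|[|]]].
case: a la {wE wa} => [|[|[|]]] // _ /=; rewrite expnS.
  by rewrite addn0 eqn_pmul2l //; case: eqP.
have -> : (2 * (2 * crank n (q %/ 3) + (cantor n (q %/ 3) && (0 < q %% 3))) + 1 == 2 * 2 ^ n) = false by lia.
by case: eqP.
Qed.

Definition tile_content (h v : nat -> nat -> skedge) (K : nat -> nat -> content) x y :=
  csub (K x y) (mv (h x y), mv (v x y)).

Lemma coarsen_iter n h v K r : skeleton h v K r ->
  exists x0 y0 h' v' K' r', skeleton h' v' K' r' /\
  forall i j u w, u < 3 ^ n -> w < 3 ^ n ->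
  tile_content h v K (x0 + 3 ^ n * i + u) (y0 + 3 ^ n * j + w) =
  supertile n (tile_content h' v' K' i j) u w.
Proof.
elim: n h v K r => [|n IH] h v K r sk.
  exists 0, 0, h, v, K, r; split=> // i j u w.
  by rewrite expn0 !ltnS !leqn0 => /eqP-> /eqP->; rewrite !mul1n !addn0.
have [x1 [y1 [h1 [v1 [K1 [r1 [sk1 E1]]]]]]] := coarsen sk.
have [x2 [y2 [h2 [v2 [K2 [r2 [sk2 E2]]]]]]] := IH _ _ _ _ sk1.
exists (x1 + 3 * x2), (y1 + 3 * y2), h2, v2, K2, r2; split=> // i j u w lu lw.
have lu3 : u %/ 3 < 3 ^ n by rewrite ltn_divLR // mulnC -expnS.
have lw3 : w %/ 3 < 3 ^ n by rewrite ltn_divLR // mulnC -expnS.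
rewrite /= -E2 // {1}/tile_content.
have -> : x1 + 3 * x2 + 3 ^ n.+1 * i + u =
   x1 + 3 * (x2 + 3 ^ n * i + u %/ 3) + u %% 3 by rewrite expnS; lia.
have -> : y1 + 3 * y2 + 3 ^ n.+1 * j + w =
   y1 + 3 * (y2 + 3 ^ n * j + w %/ 3) + w %% 3 by rewrite expnS; lia.
have [-> -> ->] := E1 (x2 + 3 ^ n * i + u %/ 3) (y2 + 3 ^ n * j + w %/ 3)
  (u %% 3) (w %% 3) (ltn_pmod u (isT : 0 < 3)) (ltn_pmod w (isT : 0 < 3)).
by rewrite /dig !modn_mod.
Qed.

(** A block of level n at the centre of its parent is a zone. Its neighbours on the left, below and
    above lie on the middle row or column of the same parent, where the substitution erases the
    rows, respectively the columns, of cells: nothing enters the zone from these sides. *)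
Lemma zone_exists n h v K r : skeleton h v K r -> exists X Y,
  [/\ forall u w, u < 3 ^ n -> w < 3 ^ n ->
        tile_content h v K (X.+1 + u) (Y.+1 + w) = supertile n zone u w,
      forall w, w < 3 ^ n -> cantor n w -> (tile_content h v K X (Y.+1 + w)).1 = hoff,
      forall u, u < 3 ^ n -> cantor n u -> (tile_content h v K (X.+1 + u) Y).2 = false
    & forall u, u < 3 ^ n -> cantor n u ->
        (tile_content h v K (X.+1 + u) (Y.+1 + 3 ^ n)).2 = false].
Proof.
move=> /(coarsen_iter n)[x0 [y0 [h' [v' [K' [r' [sk E]]]]]]].
have e d : exists n, iter n.+1 dsucc d = d1.
  by case: d => [[]|]; [exists 1 | exists 2 | exists 0].
have [i iE] := e (mv (h' 0 0)); have [j jE] := e (cst (h' 0 0)).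
have p1 : mv (h' i.+1 j.+1) = d1 by rewrite (skel_mv_h sk).
have hE x : mv (h' i.+1 x) = d1 by rewrite (skel_mv_h sk).
have cE x : cst (h' x j.+1) = d1 by rewrite (skel_cst_hE sk).
have vE x : mv (v' x j.+1) = d1 by have [[-> _ _ _] _ _ _] := sk x j.+1.
have e3 : 0 < 3 ^ n by rewrite expn_gt0.
exists (x0 + 3 ^ n * i + (3 ^ n).-1), (y0 + 3 ^ n * j + (3 ^ n).-1).
have XE : (x0 + 3 ^ n * i + (3 ^ n).-1).+1 = x0 + 3 ^ n * i.+1.
  by rewrite mulnS; lia.
have YE : (y0 + 3 ^ n * j + (3 ^ n).-1).+1 = y0 + 3 ^ n * j.+1.
  by rewrite mulnS; lia.
rewrite XE YE; split.
- by move=> u w lu lw; rewrite E // /tile_content hE vE.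
- move=> w lw cw; rewrite E //; last by rewrite prednK.
  apply: supertile_off => //; rewrite /tile_content vE /csub /=.
  suff -> : (mv (h' i j.+1), Some false) == (Some false, Some false) = false by [].
  apply/negP=> /eqP[q]; have := hE j.+1; have [_ [-> _ _ _] _ _] := sk i j.+1.
  by rewrite q.
- move=> u lu cu; rewrite E //; last by rewrite prednK.
  apply: supertile_offv => //; rewrite /tile_content hE /csub /=.
  case: eqP => [[q]|_]; last by rewrite andbF.
  by have := vE i.+1; have [_ [_ -> _ _] _ _] := sk i.+1 j; rewrite q.
- move=> u lu cu.
  have -> : y0 + 3 ^ n * j.+1 + 3 ^ n = y0 + 3 ^ n * j.+2 + 0 by rewrite addn0 (mulnS _ j.+1); lia.
  rewrite E //; apply: supertile_offv => //; rewrite /tile_content hE /csub /=.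
  case: eqP => [[q]|_]; last by rewrite andbF.
  by move: q; have [_ [_ -> _ _] _ _] := sk i.+1 j.+1; rewrite vE.
Qed.

(** * Machine runs in the zones of the skeleton *)

Section Loader.
Variable M : turing_machine unit.

(* States of a machine that first copies a counter in unary onto the tape and
   then runs [M]: [None] reads the counter at the origin, [Some None] carries a
   symbol up, [Some (Some None)] comes back. *)
Notation lstate := (option (option (option (state M)))).
Notation LRead := (None : lstate).
Notation LUp := (Some None : lstate).
Notation LDown := (Some (Some None) : lstate).
Notation Run q := (Some (Some (Some q)) : lstate).

Definition ltrans (s : lstate) (a : cell M) (home rd : bool) : lstate * cell M * move :=
  match s with
  | None => if home then (if rd then LUp else Run (start M), a, Stay) else (s, a, Stay)
  | Some None => if a == None then (LDown, Some (inl tt), Stay) else (LUp, a, MoveRight)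
  | Some (Some None) => if home then (LRead, a, Stay) else (LDown, a, MoveLeft)
  | Some (Some (Some q)) =>
    if verdict q is Some _ then (Run q, a, Stay)
    else let: (q', a', m) := transition q a in (Run q', a', m)
  end.

Definition accepting (s : lstate) : bool :=
  if s is Some (Some (Some q)) then verdict q == Some true else false.

Record lconfig := LConfig {
  lst : lstate; ltape : int -> cell M; lhead : int; lcount : nat }.

Definition linitial n := LConfig LRead (fun=> None) 0%R n.

Definition lstep (c : lconfig) : lconfig :=
  let: (s, a, m) := ltrans (lst c) (ltape c (lhead c)) (lhead c == 0%R) (0 < lcount c) in
  LConfig s (fun z => if z == lhead c then a else ltape c z)
    (lhead c + displacement m)%R
    (if (lst c == LRead) && (lhead c == 0%R) then (lcount c).-1 else lcount c).

Definition unary (i : nat) (z : int) : cell M :=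
  if z is Posz n then if n < i then Some (inl tt) else None else None.

Lemma iter_add (T : Type) (f : T -> T) m n x : iter (m + n) f x = iter n f (iter m f x).
Proof. by rewrite addnC iterD. Qed.

Lemma lload_round i c : exists T,
  iter T lstep (LConfig LRead (unary i) 0%R c.+1) = LConfig LRead (unary i.+1) 0%R c.
Proof.
have up j : j <= i -> iter j lstep (LConfig LUp (unary i) 0%R c) = LConfig LUp (unary i) (Posz j) c.
  elim: j => // j IH lj; rewrite iterS IH 1?ltnW // /lstep /= lj /=; congr LConfig.
    by apply: funext => z; case: eqP => // ->; rewrite /unary lj.
  by rewrite -PoszD addn1.
have down j : j <= i ->
    iter j lstep (LConfig LDown (unary i.+1) (Posz i) c) = LConfig LDown (unary i.+1) (Posz (i - j)) c.
  elim: j => [|j IH] lj; first by rewrite subn0.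
  rewrite iterS IH 1?ltnW // /lstep /=.
  have -> : ((Posz (i - j)) == 0%R) = false by lia.
  congr LConfig; last by rewrite /displacement; lia.
  by apply: funext => z; case: eqP => // ->.
have A1 : lstep (LConfig LRead (unary i) 0%R c.+1) = LConfig LUp (unary i) 0%R c.
  rewrite /lstep /=; congr LConfig.
  by apply: funext => z; case: eqP => // ->.
have A2 : lstep (LConfig LUp (unary i) (Posz i) c) = LConfig LDown (unary i.+1) (Posz i) c.
  rewrite /lstep /= ltnn /=; congr LConfig; last by rewrite addr0.
  apply: funext => z; case: eqP => [->|ne]; first by rewrite /unary ltnSn.
  rewrite /unary; case: z ne => // k ne; rewrite ltnS [k <= i]leq_eqVlt.
  by case: eqP => // e; case: ne; rewrite e.
have A3 : lstep (LConfig LDown (unary i.+1) 0%R c) = LConfig LRead (unary i.+1) 0%R c.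
  rewrite /lstep /=; congr LConfig.
  by apply: funext => z; case: eqP => // ->.
exists (1 + (i + (1 + (i + 1)))).
by rewrite !iter_add [iter 1 _ (LConfig _ _ _ _)]A1 up // [iter 1 _ (LConfig _ _ _ _)]A2
  down // subnn [iter 1 _ (LConfig _ _ _ _)]A3.
Qed.

Definition embed (c : config M) : lconfig :=
  LConfig (Run (cstate c)) (ctape c) (chead c) 0.

Lemma lload n : exists T, iter T lstep (linitial n) = embed (initial M (nseq n tt)).
Proof.
have rounds i c : exists T,
    iter T lstep (LConfig LRead (unary 0) 0%R (i + c)) = LConfig LRead (unary i) 0%R c.
  elim: i c => [|i IH] c; first by exists 0.
  have [T1 E1] := IH c.+1; have [T2 E2] := lload_round i c.
  by exists (T1 + T2); rewrite iter_add addSnnS E1.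
have [T E] := rounds n 0; exists (T + 1); rewrite iter_add.
have -> : linitial n = LConfig LRead (unary 0) 0%R (n + 0).
  by rewrite addn0 /linitial; congr LConfig; apply: funext => -[].
rewrite E /lstep /= /embed /=; congr LConfig.
apply: funext => -[j|//]; rewrite /unary map_nseq nth_nseq.
by case: eqP => // -[->].
Qed.

Lemma lstep_embed c : lstep (embed c) = embed (step c).
Proof.
rewrite /lstep /step /=; case V: (verdict (cstate c)) => [b|] /=.
  rewrite /embed; congr LConfig; last by rewrite addr0.
  by apply: funext => z; case: eqP => // ->.
by case: transition => [[q a] m].
Qed.

Lemma lrun_embed k c : iter k lstep (embed c) = embed (iter k (@step _ M) c).
Proof. by elim: k => //= k ->; rewrite lstep_embed. Qed.

Lemma accepting_stable c k : accepting (lst c) -> lst (iter k lstep c) = lst c.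
Proof.
move=> ac; elim: k => //= k; rewrite /lstep.
case: (iter k lstep c) => s t h n /= ->.
by move: ac; case: (lst c) => [[[q|]|]|] //= /eqP ->.
Qed.

Lemma accepting_run n : (exists k, accepting (lst (iter k lstep (linitial n)))) <->
  halts_with M (nseq n tt) true.
Proof.
have [T E] := lload n; split=> [[k ac]|[k V]].
  have [lkT|lTk] := leqP k T.
    have := accepting_stable (T - k) ac; rewrite -iter_add subnKC // E /= => e.
    by exists 0; apply/eqP; rewrite -e in ac.
  move: ac; rewrite -(subnKC (ltnW lTk)) iter_add E lrun_embed /= => /eqP V.
  by exists (k - T).
by exists (T + k); rewrite iter_add E lrun_embed /= V.
Qed.

Notation hcomp := (option (cell M * option lstate)).
Notation vcomp := (option (option lstate * option lstate)).
(* [None]: nothing to do; [Some (false, false)]: initialise the counter;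
   [Some (false, true)]: keep it; [Some (true, b)]: read it, [b] telling whether
   it is positive, and decrement it. *)
Notation cmode := (option (bool * bool)).

Definition moved (m : move) (s : lstate) : option lstate * option lstate * option lstate :=
  match m with
  | MoveRight => (Some s, None, None)
  | MoveLeft => (None, Some s, None)
  | Stay => (None, None, Some s)
  end.

(* A vertical edge carries the heads crossing it upwards and downwards; the
   result lists the heads leaving up, leaving down and staying. *)
Definition lout (x : cell M * option lstate) (home rd : bool) :
    cell M * (option lstate * option lstate * option lstate) :=
  if x.2 is Some s then
    let: (s', a', m) := ltrans s x.1 home rd in (a', moved m s')
  else (x.1, (None, None, None)).

Definition omerge (T : Type) (a b : option T) : option T := if a is Some _ then a else b.

(** Time runs to the east and the tape to the north. [None] stands for the border of the zone: on
    the west side the initial configuration is created, on the others signals are lost. The bit [rd]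
    guesses the result of the counter test; the mode reports the guess, to be checked by the
    counter. *)
Definition cell_rule (home : bool) (W E : hcomp) (S N : vcomp) (m : cmode) : Prop :=
  exists rd : bool,
  let: (a', (up, down, stay)) :=
    if W is Some x then lout x home rd else (None, (None, None, None)) in
  [/\ if S is Some s then s.2 = down else True,
      if N is Some n then n.1 = up else True,
      if E is Some e then
        if W is Some x then
          e = (a', omerge stay (omerge (obind fst S) (obind snd N)))
        else e = (None, if home then Some LRead else None)
      else True,
      if W is Some (_, Some s) then ~~ accepting s else True
    & m = if home && (E != None) then
            match W with
            | None => Some (false, false)
            | Some (_, Some None) => Some (true, rd)
            | _ => Some (false, true)
            end
          else None].

Definition is_mid (h : hkind) : bool := if h is Some (Some _) then true else false.

Definition comp_rule (k : content) (W E : hcomp) (S N : vcomp) (m : cmode) : Prop :=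
  match k with
  | (None, false) => [/\ W = None, E = None, S = None, N = None & m = None]
  | (None, true) => [/\ W = None, E = None, S = N, S <> None & m = None]
  | (Some h, false) =>
    [/\ W = E, W <> None, S = None, N = None
      & m = if is_mid (Some h) then Some (false, true) else None]
  | (Some h, true) => cell_rule (is_mid (Some h)) W E S N m
  end.

Definition count_rule (n : nat) (m : cmode) (c c' : nat) : Prop :=
  match m with
  | None => True
  | Some (false, false) => c = n /\ c' = n
  | Some (false, true) => c' = c
  | Some (true, b) => b = (0 < c) /\ c' = c.-1
  end.

Section Forced.
Variables (n N : nat) (H : nat -> nat -> hcomp) (V : nat -> nat -> vcomp)
  (m : nat -> nat -> cmode) (c : nat -> nat).
Hypothesis rule : forall u w, u < 3 ^ n -> w < 3 ^ n ->
  comp_rule (supertile n zone u w) (H u w) (H u.+1 w) (V u w) (V u w.+1) (m u w).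
Hypothesis leftN : forall w, w < 3 ^ n -> cantor n w -> H 0 w = None.
Hypothesis botN : forall u, u < 3 ^ n -> cantor n u -> V u 0 = None.
Hypothesis topN : forall u, u < 3 ^ n -> cantor n u -> V u (3 ^ n) = None.
Hypothesis count : forall u w, u < 3 ^ n -> w < 3 ^ n -> is_mid (rowkind n w) ->
  count_rule N (m u w) (c u) (c u.+1).

(** The origin of the tape is on the middle row, so that the head stays in the zone for any number
    of steps below (2^n)./2. *)
Definition tpos w : int := ((Posz (crank n w)) - Posz (2 ^ n)./2)%R.

Definition shown (L : lconfig) w : cell M * option lstate :=
  (ltape L (tpos w), if lhead L == tpos w then Some (lst L) else None).

Lemma mid_tpos w : w < 3 ^ n -> cantor n w -> is_mid (rowkind n w) = (tpos w == 0%R).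
Proof.
rewrite /rowkind /tpos => lw cw; rewrite cw /=; case: eqP => [n0|nn].
  by move: lw; rewrite n0 expn0 ltnS leqn0 => /eqP ->.
have -> : (2 ^ n)./2 = 2 ^ n.-1.
  by case: n nn => // k _; rewrite expnS mul2n doubleK.
by case: eqP => [->|ne] /=; [rewrite subrr eqxx | rewrite subr_eq0; apply/esym/eqP => -[]].
Qed.

Lemma rowkind_cantor w : cantor n w -> exists h, rowkind n w = Some h.
Proof. by rewrite /rowkind => -> /=; do 2?case: ifP => _; eexists. Qed.

Lemma tposS w w' : crank n w' = (crank n w).+1 -> tpos w' = (tpos w + 1)%R.
Proof. by rewrite /tpos => ->; lia. Qed.

Section Column.
(* The vertical signals along a column whose cells show the configuration [L],
   not moving out of the zone. *)
Variables (u : nat) (L : lconfig).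
Hypothesis cu : cantor n u.
Hypothesis lu : u < 3 ^ n.
Hypothesis row : forall w, w < 3 ^ n -> cantor n w -> H u w = Some (shown L w).

Definition outs w := lout (shown L w) (tpos w == 0%R) (0 < lcount L).

Hypothesis cE : c u = lcount L.

Lemma lout_rd x (home rd rd' : bool) : (lout x home rd).1 = (lout x home rd').1 /\
  (lout x home rd).2.1 = (lout x home rd').2.1.
Proof. by case: x => a [[[[q|]|]|]|]; case: home rd rd' => [] [] []. Qed.

Lemma lout_rdE x (home rd rd' : bool) : (home -> x.2 = Some LRead -> rd = rd') ->
  lout x home rd = lout x home rd'.
Proof.
case: x => a [[[[q|]|]|]|] //=; rewrite /lout /=.
by case: home => //= /(_ isT erefl) ->.
Qed.

Lemma column_cell w : w < 3 ^ n -> cantor n w ->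
  [/\ if V u w is Some s then s.2 = (outs w).2.1.2 else True,
      if V u w.+1 is Some s then s.1 = (outs w).2.1.1 else True,
      if H u.+1 w is Some e then
        e = ((outs w).1, omerge (outs w).2.2 (omerge (obind fst (V u w)) (obind snd (V u w.+1))))
      else True,
      if lhead L == tpos w then ~~ accepting (lst L) else true
    & tpos w == 0%R -> H u.+1 w <> None ->
      c u.+1 = if (lst L == LRead) && (lhead L == 0%R) then (lcount L).-1 else lcount L].
Proof.
move=> lw cw.
have := rule lu lw; rewrite zone_content ?cw ?orbT // cu.
have [h hE] := rowkind_cantor cw; rewrite hE /comp_rule -hE mid_tpos // row //.
case=> rd.
have cr : tpos w == 0%R -> count_rule N (m u w) (c u) (c u.+1).
  by move=> t0; apply: count => //; rewrite mid_tpos.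
have [o1 o2] := lout_rd (shown L w) (tpos w == 0%R) rd (0 < lcount L).
case O: lout => [a' [[up down] stay]] [r1 r2 r3 r4 r5].
move: o1 o2; rewrite O /= -/(outs w) => o1 o2; rewrite -o2 /=.
have sE t : (shown L w).2 = t ->
  (if lhead L == tpos w then Some (lst L) else None) = t by [].
split=> //.
- case E: (H u.+1 w) r3 r5 => [e|//] -> r5; congr pair => //.
  have -> : stay = (outs w).2.2; last by [].
  rewrite -[stay]/(a', (up, down, stay)).2.2 -O; congr (_.2.2).
  apply: lout_rdE => t0 /sE sR; have := cr t0; rewrite r5 t0 /= sR /=.
  by case=> ->; rewrite cE.
- by move: r4; rewrite /shown; case: eqP.
- move=> t0 /eqP Hn; have := cr t0; rewrite r5 t0 Hn /= cE (eqP t0).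
  case: eqP => [_|//]; rewrite ?andbF ?andbT //.
  by case: (lst L) => [[[q|]|]|] //= [].
Qed.

Lemma column_wire w : w < 3 ^ n -> ~~ cantor n w -> V u w = V u w.+1 /\ V u w <> None.
Proof.
move=> lw /negPf cw; have := rule lu lw.
by rewrite zone_content ?cu // /rowkind cw /= => -[].
Qed.

(** Vertical signals run unchanged along the wires between rows of cells: the edge is the upper edge
    of the preceding cell, one position lower on the tape. *)
Lemma edge_below w : w <= 3 ^ n -> w = 0 \/
  exists w1, [/\ w1 < w, cantor n w1, crank n w = (crank n w1).+1 & V u w = V u w1.+1].
Proof.
elim: w => [|w IH] lw; [by left | right].
have [cw|ncw] := boolP (cantor n w); first by exists w; rewrite crankS cw addn1.
have [e _] := column_wire lw ncw.
case: (IH (ltnW lw)) => [w0|[w1 [l1 c1 r1 v1]]].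
  by move: ncw; rewrite w0 cantor0.
by exists w1; rewrite crankS (negPf ncw) addn0 -e; split=> //; apply: ltnW.
Qed.

Lemma edge_above w : w <= 3 ^ n -> V u w = None \/
  exists w2, [/\ w <= w2, w2 < 3 ^ n, cantor n w2, crank n w2 = crank n w & V u w = V u w2].
Proof.
move=> lw; move: {2}(3 ^ n - w) (leqnn (3 ^ n - w)) => k.
elim: k w lw => [|k IH] w lw.
  rewrite leqn0 subn_eq0 => le.
  by left; rewrite (_ : w = 3 ^ n) ?topN //; apply/eqP; rewrite eqn_leq lw.
have [->|ne] := eqVneq w (3 ^ n); first by left; rewrite topN.
have {}lw : w < 3 ^ n by rewrite ltn_neqAle ne.
have [cw|ncw] := boolP (cantor n w); first by right; exists w.
have [e _] := column_wire lw ncw; move=> lk.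
have [|v|[w2 [l1 l2 c2 r2 v2]]] := IH _ lw; first by rewrite subnS; lia.
  by left; rewrite e.
right; exists w2; split=> //; [exact: ltnW | | by rewrite e].
by rewrite r2 crankS (negPf ncw) addn0.
Qed.

Hypothesis inzone : exists2 w, w < 3 ^ n & cantor n w /\ lhead L = tpos w.

(** A head that leaves a cell reaches the next one by the wires. At the lower and upper ends of the
    column there is no signal to receive, which is right because [inzone] keeps the head from
    arriving from outside. *)
Lemma column_next w : w < 3 ^ n -> cantor n w -> H u.+1 w <> None ->
  H u.+1 w = Some (shown (lstep L) w) /\
  (tpos w == 0%R -> c u.+1 = lcount (lstep L)).
Proof.
move=> lw cw Hn; have [_ _ hE _ ct] := column_cell lw cw.
split; last first.
  by move=> /ct ->; rewrite // /lstep; case: ltrans => [[]].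
have [wh lwh [cwh headE]] := inzone.
case: (H u.+1 w) Hn hE => // e _ ->; congr Some.
set s' := (ltrans (lst L) (ltape L (lhead L)) (lhead L == 0%R) (0 < lcount L)).1.1.
set a' := (ltrans (lst L) (ltape L (lhead L)) (lhead L == 0%R) (0 < lcount L)).1.2.
set mo := (ltrans (lst L) (ltape L (lhead L)) (lhead L == 0%R) (0 < lcount L)).2.
have outE x : outs x = if lhead L == tpos x then (a', moved mo s')
    else (ltape L (tpos x), (None, None, None)).
  rewrite /outs /lout /shown /=; case: eqP => [<-|//] /=.
  by rewrite /a' /mo /s'; case: ltrans => [[]].
have below : obind fst (V u w) =
    if lhead L == (tpos w - 1)%R then (moved mo s').1.1 else None.
  have [w0|[w1 [l1 c1 r1 v1]]] := edge_below (ltnW lw).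
    rewrite w0 botN //=; case: eqP => // q; exfalso.
    have : lhead L = (tpos wh) by []. rewrite q /tpos crank0; lia.
  have lw1 : w1.+1 < 3 ^ n by apply: leq_ltn_trans lw.
  have [_ vn] := column_wire lw1 (cantorS c1 lw1).
  have [_ + _ _ _] := column_cell (ltnW lw1) c1.
  rewrite v1; case: (V u w1.+1) vn => // s _ /= ->; rewrite outE.
  have -> : (tpos w - 1 = tpos w1)%R by rewrite (tposS r1); lia.
  by case: eqP.
have above : obind snd (V u w.+1) =
    if lhead L == (tpos w + 1)%R then (moved mo s').1.2 else None.
  have [v0|[w2 [l1 l2 c2 r2 v2]]] := edge_above lw.
    rewrite v0 /=; case: eqP => // q; exfalso.
    have [lw3|] := ltnP w.+1 (3 ^ n).
      by have [_ []] := column_wire lw3 (cantorS cw lw3).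
    move=> le; have we : w.+1 = 3 ^ n by apply/eqP; rewrite eqn_leq lw.
    have := crank_full n; rewrite -we crankS cw => rw.
    have := crank_le n lwh; rewrite crankS cwh crank_full => rwh.
    by move: q; rewrite headE /tpos; lia.
  have lw1 : w.+1 < 3 ^ n by apply: leq_ltn_trans l2.
  have [_ vn] := column_wire lw1 (cantorS cw lw1).
  have [+ _ _ _ _] := column_cell l2 c2.
  rewrite -v2; case: (V u w.+1) vn => // s _ /= ->; rewrite outE.
  have -> : (tpos w + 1 = tpos w2)%R.
    by rewrite [tpos w2](@tposS w) // r2 crankS cw addn1.
  by case: eqP.
rewrite below above outE /shown /lstep.
have -> : ltrans (lst L) (ltape L (lhead L)) (lhead L == 0%R) (0 < lcount L) = (s', a', mo).
  by rewrite /s' /a' /mo; case: ltrans => [[]].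
clear outE below above; clearbody mo.
rewrite /= [tpos w == _]eq_sym; case: eqP => [e0|ne]; last first.
  congr pair; case: mo => /=.
  - rewrite !if_same /=.
    have -> : (lhead L == (tpos w + 1)%R) = ((lhead L + -1)%R == tpos w) by lia.
    by [].
  - by rewrite !if_same /= addr0; case: eqP.
  - have -> : (lhead L == (tpos w - 1)%R) = ((lhead L + 1)%R == tpos w) by lia.
    by rewrite !if_same /=; case: eqP.
rewrite e0; congr pair; case: mo => /=.
- rewrite !if_same /= (_ : _ == _ = false); last by lia.
  by rewrite (_ : _ == _ = false) //; lia.
- by rewrite addr0 eqxx.
- rewrite !if_same (_ : _ == _ = false) /=; last by lia.
  by rewrite (_ : _ == _ = false) //; lia.
Qed.
End Column.
Lemma lhead_bound k : (`|lhead (iter k lstep (linitial N))| <= k%:R)%R.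
Proof.
elim: k => [|k IH]; first by rewrite /= normr0.
rewrite iterS /lstep; case: ltrans => [[s a] mo] /=.
rewrite (le_trans (ler_normD _ _)) // -natr1 lerD //.
by case: mo.
Qed.

Lemma conf_inzone k : k < (2 ^ n)./2 ->
  exists2 w, w < 3 ^ n & cantor n w /\ lhead (iter k lstep (linitial N)) = tpos w.
Proof.
move=> lk; have := lhead_bound k; move: (lhead _) => z zk.
have n1 : (2 ^ n)./2 + (2 ^ n)./2 = 2 ^ n.
  by case: n lk => // n' _; rewrite addnn expnS mul2n doubleK.
have [|w lw [cw rw]] := @crank_onto n (absz (z + Posz (2 ^ n)./2)%R); first by lia.
by exists w => //; split=> //; rewrite /tpos rw; lia.
Qed.

Lemma row_next u w : u.+1 < 3 ^ n -> ~~ cantor n u.+1 -> w < 3 ^ n -> cantor n w ->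
  H u.+1 w = H u.+2 w /\ H u.+1 w <> None /\
  m u.+1 w = if is_mid (rowkind n w) then Some (false, true) else None.
Proof.
move=> lu /negPf cu lw cw; have := rule lu lw.
rewrite zone_content ?cw ?orbT // cu.
by have [h ->] := rowkind_cantor cw => -[].
Qed.

(** The column of rank 0 has nothing on its west and creates configuration 0 on its east; each later
    column of cells performs one step, and the tiles in between only transmit. Hence rank k + 1 for
    configuration k. *)
Lemma zone_shows u k : u < 3 ^ n -> crank n u = k.+1 -> k < (2 ^ n)./2 ->
  forall w, w < 3 ^ n -> cantor n w ->
  H u w = Some (shown (iter k lstep (linitial N)) w) /\
  (tpos w == 0%R -> c u = lcount (iter k lstep (linitial N))).
Proof.
elim: u k => [|u IH] k lu; first by rewrite crank0.
have [cu|ncu] := boolP (cantor n u); rewrite crankS ?cu ?(negPf ncu).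
  have nc1 := cantorS cu lu.
  rewrite addn1 => -[ru] lk w lw cw.
  have Hn : H u.+1 w <> None by have [_ []] := row_next lu nc1 lw cw.
  case: k ru lk => [|k] ru lk.
    have u0 : u = 0.
      case: u cu ru {IH lu nc1 Hn} => // u _ ru.
      by have := @crank_le n 1 u.+1 isT; rewrite crankS cantor0 crank0 ru.
    have := rule (ltnW lu) lw; rewrite zone_content ?cw ?orbT // cu.
    have [h hE] := rowkind_cantor cw; rewrite hE /comp_rule -hE mid_tpos //.
    rewrite [H u w](_ : _ = None); last (by rewrite u0 leftN); move=> -[rd [_ _ + _ mE]].
    case: (H u.+1 w) Hn mE => // e _ mE ->.
    rewrite /shown /= [_ == tpos w]eq_sym; split=> // t0.
    have := count (ltnW lu) lw; rewrite mid_tpos // t0 mE t0 => /(_ isT) /=.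
    by case.
  have lk' := ltnW lk.
  have [w0 lw0 [cw0 hw0]] := conf_inzone lk'.
  have rows := IH k (ltnW lu) ru lk'.
  have cE : c u = lcount (iter k lstep (linitial N)).
    have [w1 lw1 [cw1 rw1]] : exists2 w, w < 3 ^ n & cantor n w /\ crank n w = (2 ^ n)./2.
      by apply: crank_onto; lia.
    by have [_] := rows w1 lw1 cw1; apply; rewrite /tpos rw1 subrr.
  apply: column_next => //; first exact: ltnW.
    by move=> w' lw' cw'; case: (rows w' lw' cw').
  by exists w0.
rewrite addn0 => ru lk w lw cw.
have [E c1] := IH k (ltnW lu) ru lk w lw cw.
case: u lu ncu {IH} ru E c1 => [|u] lu ncu ru E c1; first by rewrite cantor0 in ncu.
have [e [_ mE]] := row_next (ltnW lu) ncu lw cw.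
rewrite -e; split=> // t0; rewrite -c1 //.
have := count (ltnW lu) lw; rewrite mid_tpos // t0 mE mid_tpos // t0.
by move=> /(_ isT).
Qed.

Lemma zone_run k : k < (2 ^ n)./2 -> ~~ accepting (lst (iter k lstep (linitial N))).
Proof.
move=> lk; have [u lu [cu ru]] : exists2 u, u < 3 ^ n & cantor n u /\ crank n u = k.+1.
  by apply: crank_onto; lia.
have [w lw [cw hw]] := conf_inzone lk.
have rows := zone_shows lu ru lk.
have cE : c u = lcount (iter k lstep (linitial N)).
  have [w1 lw1 [cw1 rw1]] : exists2 w, w < 3 ^ n & cantor n w /\ crank n w = (2 ^ n)./2.
    by apply: crank_onto; lia.
  by have [_] := rows w1 lw1 cw1; apply; rewrite /tpos rw1 subrr.
have [|_ _ _ + _] := @column_cell u (iter k lstep (linitial N)) cu lu _ cE w lw cw.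
  by move=> w' lw' cw'; case: (rows w' lw' cw').
by rewrite hw eqxx.
Qed.
End Forced.
End Loader.

(** * The tile set of the machine runs with counters in stacks *)

Record wang := Wang {
  hcol : finType;
  vcol : finType;
  wtile : hcol -> hcol -> vcol -> vcol -> Prop }.

Definition factor_at (T : Type) (w : seq T) (f : nat -> T) : Prop :=
  w = mkseq f (size w).

Definition quarter_tiling (W : wang) (h : nat -> nat -> hcol W) (v : nat -> nat -> vcol W) :=
  forall x y, wtile (h x y) (h x.+1 y) (v x y) (v x y.+1).

Definition quarter_avoids (W : wang) (h : nat -> nat -> hcol W) (F : seq (seq (hcol W))) :=
  forall w x y, w \in F -> ~ factor_at w (fun k => h x (y + k)).

Section StackSystem.
Variable M : turing_machine unit.

Notation lstate := (option (option (option (state M)))).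
Notation hcomp := (option (option (unit + work_symbol M) * option lstate)).
Notation vcomp := (option (option lstate * option lstate)).
Notation cmode := (option (bool * bool)).
Notation hedge := (skedge * hcomp)%type.
Notation vedge := (skedge * vcomp)%type.

Definition plane_rule (W E : hedge) (S N : vedge) (m : cmode) : Prop :=
  exists K r, skrule W.1 E.1 S.1 N.1 K r /\
    comp_rule (csub K (mv W.1, mv S.1)) W.2 E.2 S.2 N.2 m.

(* Above every row of the computing plane stands a stack of rows holding a
   counter in unary: a bottom row, letters ([true] counts), a top row. *)
Notation scol := (hedge + (bool + (bool + unit)))%type.
Notation svcol := (vedge + (vedge * cmode + vedge * cmode * bool))%type.
Notation plane w := (inl w).
Notation bottom p := (inr (inl p)).
Notation letter a := (inr (inr (inl a))).
Notation top := (inr (inr (inr tt))).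
Notation under s := (inl s).
Notation over s m := (inr (inl (s, m))).
Notation inside s m a := (inr (inr (s, m, a))).

Definition bottom_rule (m : cmode) (p p' a : bool) : Prop :=
  match m with
  | None => True
  | Some (false, false) => p = false /\ p' = true
  | Some (false, true) => p' = true
  | Some (true, b) => p' = true /\ a = b
  end.

(** Reading shifts the letters down by one, which decrements a unary number written from the bottom
    of the stack. *)
Definition letter_rule (m : cmode) (a a' above : bool) : Prop :=
  match m with
  | None => True
  | Some (false, false) => a = true /\ a' = true
  | Some (false, true) => a' = a
  | Some (true, b) => a' = above
  end.

Inductive stack_tile : scol -> scol -> svcol -> svcol -> Prop :=
| Plane W E S N m : plane_rule W E S N m ->
    stack_tile (plane W) (plane E) (under S) (over N m)
| Bottom p p' s m a : bottom_rule m p p' a ->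
    stack_tile (bottom p) (bottom p') (over s m) (inside s m a)
| Letter a a' s m above : (a = false -> above = false) -> letter_rule m a a' above ->
    stack_tile (letter a) (letter a') (inside s m a) (inside s m above)
| Top s m : stack_tile top top (inside s m false) (under s).

Lemma bottom_inv W E s m N : stack_tile W E (over s m) N -> exists p p' a,
  [/\ W = bottom p, E = bottom p', N = inside s m a & bottom_rule m p p' a].
Proof. by move=> T; inversion T; exists p, p', a. Qed.

Lemma letter_inv a E s m b N : stack_tile (letter a) E (inside s m b) N ->
  exists a' c, [/\ b = a, E = letter a', N = inside s m c, a = false -> c = false
    & letter_rule m a a' c].
Proof. by move=> T; inversion T; subst; exists a', above. Qed.

Lemma top_inv E s m b N : stack_tile top E (inside s m b) N ->
  b = false /\ N = under s.
Proof. by move=> T; inversion T. Qed.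

Definition stack_wang : wang := Wang stack_tile.

(** Initialisation needs [bottom false] under letters that are all [true]: the words of the first
    list exclude heights below N, and N + 1 letters [true] are excluded, so the height is N.
    Excluding also N + 1 letters [false] bounds every stack, since [true] never stands above
    [false]. *)
Definition stack_words (N : nat) : seq (seq scol) :=
  [seq bottom false :: rcons (nseq m (letter true)) top | m <- iota 0 N] ++
  [:: nseq N.+1 (letter true); nseq N.+1 (letter false)].

Section Forced.
Variables (N : nat) (h : nat -> nat -> scol) (v : nat -> nat -> svcol).
Hypothesis tiling : quarter_tiling (W := stack_wang) h v.
Hypothesis avoids : quarter_avoids (W := stack_wang) h (stack_words N).

Definition is_plane (c : scol) := if c is plane _ then true else false.
Definition is_bottom (c : scol) := if c is bottom _ then true else false.
Definition is_letter (c : scol) := if c is letter _ then true else false.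
Definition is_top (c : scol) := if c is top then true else false.

Lemma row_kindE x y : (is_plane (h x y) = is_plane (h 0 y)) /\
  (is_bottom (h x y) = is_bottom (h 0 y)) /\
  (is_letter (h x y) = is_letter (h 0 y)) /\ (is_top (h x y) = is_top (h 0 y)).
Proof.
by elim: x => // x [<- [<- [<- <-]]]; case: (tiling x y).
Qed.

Lemma nokinds y : is_letter (h 0 y) || is_top (h 0 y) || is_bottom (h 0 y) || is_plane (h 0 y).
Proof. by case: (tiling 0 y). Qed.

Definition stack_at (y s : nat) : Prop :=
  forall x, [/\ is_plane (h x y), is_bottom (h x y.+1),
    forall i, i < s -> is_letter (h x (y + 2 + i)),
    is_top (h x (y + 2 + s)) & is_plane (h x (y + 3 + s))].

(** Letters only decrease upwards, so among 2N + 2 consecutive ones the first N + 1 would all be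
    [true], or the last N + 1 all [false]. *)
Lemma letters_end y : exists s, [/\ s < 2 * N + 2,
  forall i, i < s -> is_letter (h 0 (y + i)) & ~~ is_letter (h 0 (y + s))].
Proof.
have [/existsP[/= s0 ns0]|] := boolP [exists s : 'I_(2 * N + 2), ~~ is_letter (h 0 (y + s))].
  have ex : exists s, ~~ is_letter (h 0 (y + s)) by exists s0.
  case: (ex_minnP ex) => s ns smin; exists s; split=> //.
    exact: leq_ltn_trans (smin _ ns0) (ltn_ord s0).
  by move=> i; apply: contraTT => /smin; rewrite leqNgt.
rewrite negb_exists => /forallP al; exfalso.
have {}al i : i < 2 * N + 2 -> exists a, h 0 (y + i) = letter a.
  move=> li; have := al (Ordinal li); rewrite negbK /=.
  by case: (h 0 _) => [?|[?|[a|?]]] // _; exists a.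
pose f i := if h 0 (y + i) is letter a then a else false.
have fE i : i < 2 * N + 2 -> h 0 (y + i) = letter (f i).
  by move=> /al[a aE]; rewrite /f aE.
have mono i : i.+1 < 2 * N + 2 -> f i = false -> f i.+1 = false.
  move=> li; have := fE _ (ltnW li); have := fE _ li; rewrite addnS.
  have := tiling 0 (y + i); have := tiling 0 (y + i).+1.
  move=> t2 t1 e2 e1; rewrite e1 in t1; rewrite e2 in t2.
  inversion t1 as [| |a1 a2 s1 m1 b1 ab lr q1 q2 q3 q4|].
  inversion t2 as [| |a1' a2' s1' m1' b1' ab' lr' q1' q2' q3' q4'|].
  by move: q4; rewrite -q3' => -[_ _ <-].
have mono' i j : i <= j -> j < 2 * N + 2 -> f i = false -> f j = false.
  move=> /subnK <-; elim: (j - i) => // k IH lk /IH.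
  by rewrite addSn in lk *; move=> /(_ (ltnW lk)); apply: mono.
have [fN|fN] := boolP (f N).
  have := @avoids (nseq N.+1 (letter true)) 0 y; apply.
    by rewrite mem_cat !inE eqxx orbT.
  rewrite /factor_at size_nseq; apply: (@eq_from_nth _ top).
    by rewrite size_nseq size_mkseq.
  move=> i; rewrite size_nseq => li; rewrite nth_nseq li nth_mkseq // fE; last lia.
  congr (inr (inr (inl _))); apply/esym; apply: contraTT fN => /negPf fi.
  by rewrite (@mono' i N) //; lia.
have := @avoids (nseq N.+1 (letter false)) 0 (y + N); apply.
  by rewrite mem_cat !inE eqxx !orbT.
rewrite /factor_at size_nseq; apply: (@eq_from_nth _ top).
  by rewrite size_nseq size_mkseq.
move=> i; rewrite size_nseq => li; rewrite nth_nseq li nth_mkseq // -addnA fE; last lia.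
by congr (inr (inr (inl _))); apply/esym/(@mono' N); rewrite ?leq_addr ?(negPf fN) //; lia.
Qed.

Lemma next_kind y :
  [/\ is_plane (h 0 y) -> is_bottom (h 0 y.+1),
      is_bottom (h 0 y) -> is_letter (h 0 y.+1) || is_top (h 0 y.+1),
      is_letter (h 0 y) -> is_letter (h 0 y.+1) || is_top (h 0 y.+1)
    & is_top (h 0 y) -> is_plane (h 0 y.+1)].
Proof.
have := tiling 0 y; have := tiling 0 y.+1.
case=> [W E S N' m _|p p' s m a _|a a' s m b _ _|s m];
  move: (h 0 y) (h 1 y) (v 0 y) (v 0 y.+1) => a1 a2 a3 a4 T; split; by inversion T.
Qed.

Lemma top_after y : is_letter (h 0 y) || is_top (h 0 y) ->
  exists s, (forall i, i < s -> is_letter (h 0 (y + i))) /\ is_top (h 0 (y + s)).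
Proof.
have [s [_ ls ns]] := letters_end y => st.
exists s; split=> //; case: s ls ns => [|s] ls ns.
  by move: ns st; rewrite addn0 => /negPf ->.
have [_ _ + _] := next_kind (y + s); rewrite ls // -addnS (negPf ns); exact.
Qed.

Lemma stack_exists y : is_plane (h 0 y) -> exists s, stack_at y s.
Proof.
move=> py; have [/(_ py) by_ _ _ _] := next_kind y.
have [_ /(_ by_) ly _ _] := next_kind y.+1.
have [s [ls ts]] := top_after ly; exists s => x.
have [_ _ _ /(_ ts) pt] := next_kind (y.+2 + s).
have pE z : is_plane (h x z) = is_plane (h 0 z) by have [] := row_kindE x z.
have bE z : is_bottom (h x z) = is_bottom (h 0 z) by have [_ []] := row_kindE x z.
have lE z : is_letter (h x z) = is_letter (h 0 z) by have [_ [_ []]] := row_kindE x z.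
have tE z : is_top (h x z) = is_top (h 0 z) by have [_ [_ [_]]] := row_kindE x z.
have -> : y + 3 + s = (y.+2 + s).+1 by lia.
by split=> [||i li||]; rewrite ?pE ?bE ?lE ?tE // addn2 ?ls.
Qed.

Lemma plane_row : exists y, is_plane (h 0 y).
Proof.
have toplane y : is_letter (h 0 y) || is_top (h 0 y) -> exists z, is_plane (h 0 z).
  move=> /top_after[s [_ ts]]; exists (y + s).+1.
  by have [_ _ _] := next_kind (y + s); apply.
have := nokinds 0; case/orP => [/orP[/toplane //|b0]|p0]; last by exists 0.
by apply: (toplane 1); have [_ + _ _] := next_kind 0; apply.
Qed.


Lemma stack_rows : exists yy ss : nat -> nat,
  forall t, stack_at (yy t) (ss t) /\ yy t.+1 = yy t + 3 + ss t.
Proof.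
have [y0 py0] := plane_row.
have [f fP] : {f : nat -> nat & forall y, is_plane (h 0 y) -> stack_at y (f y)}.
  apply: (@choice _ _ (fun y s => is_plane (h 0 y) -> stack_at y s)) => y.
  have [/stack_exists[s sP]|_] := boolP (is_plane (h 0 y)).
    by exists s.
  by exists 0.
pose yy t := iter t (fun y => y + 3 + f y) y0.
exists yy, (fun t => f (yy t)) => t; split=> //; apply: (fP).
elim: t => // t IH; rewrite /yy iterS -/(yy t).
by have [] := fP _ IH 0.
Qed.

Section Rows.
Variables (yy ss : nat -> nat).
Hypothesis rows : forall t, stack_at (yy t) (ss t) /\ yy t.+1 = yy t + 3 + ss t.
Variables (he : hedge) (ve : vedge).

Definition ph x t : hedge := if h x (yy t) is plane w then w else he.
Definition pv x t : vedge := if v x (yy t) is under w then w else ve.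
Definition pm x t : cmode := if v x (yy t).+1 is over _ m then m else None.
Definition lt x t i : bool := if v x (yy t + 2 + i) is inside _ _ a then a else false.

Lemma plane_rowP x t : exists N', plane_rule (ph x t) (ph x.+1 t) (pv x t) N' (pm x t) /\
  v x (yy t).+1 = over N' (pm x t).
Proof.
have [/(_ x) [p _ _ _ _] _] := rows t; rewrite /ph /pv /pm.
by case: (tiling x (yy t)) p => // W E S N' m r _; exists N'.
Qed.

Lemma stack_rowP x t N' : v x (yy t).+1 = over N' (pm x t) ->
  [/\ exists p p', [/\ h x (yy t).+1 = bottom p, h x.+1 (yy t).+1 = bottom p' &
        bottom_rule (pm x t) p p' (lt x t 0)],
      forall i, i < ss t -> h x (yy t + 2 + i) = letter (lt x t i) /\
        h x.+1 (yy t + 2 + i) = letter (lt x.+1 t i) /\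
        letter_rule (pm x t) (lt x t i) (lt x.+1 t i) (lt x t i.+1) /\
        (lt x t i = false -> lt x t i.+1 = false),
      lt x t (ss t) = false & pv x t.+1 = N'].
Proof.
move=> vE.
have [/(_ x) [_ b l tp _] yE] := rows t.
have [/(_ x.+1) [_ b' l' _ _] _] := rows t.
have start : exists p p', [/\ h x (yy t).+1 = bottom p, h x.+1 (yy t).+1 = bottom p',
    bottom_rule (pm x t) p p' (lt x t 0) & v x (yy t + 2) = inside N' (pm x t) (lt x t 0)].
  rewrite /lt addn0 addn2.
  have := tiling x (yy t).+1; rewrite vE => /bottom_inv[p [p' [a [-> -> -> r]]]].
  by exists p, p'.
have lE x' i : i < ss t -> h x' (yy t + 2 + i) = letter (lt x' t i).
  move=> li; have [/(_ x') [_ _ /(_ _ li) lx _ _] _] := rows t.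
  by rewrite /lt; case: (tiling x' (yy t + 2 + i)) lx.
have vin i : i <= ss t -> v x (yy t + 2 + i) = inside N' (pm x t) (lt x t i).
  elim: i => [|i IH] li; first by have [p [p' [_ _ _]]] := start; rewrite addn0.
  have := tiling x (yy t + 2 + i); rewrite lE // IH 1?ltnW // -addnS.
  by case/letter_inv=> a' [c [_ _ vE' _ _]]; rewrite /lt vE'.
have vtop : lt x t (ss t) = false /\ v x (yy t + 2 + ss t).+1 = under N'.
  have := tiling x (yy t + 2 + ss t); rewrite vin //.
  by case: (h x (yy t + 2 + ss t)) tp => [?|[?|[?|[]]]] // _ /top_inv.
split; [by have [p [p' [? ? ? _]]] := start; exists p, p' | | by case: vtop |].
  move=> i li; have := tiling x (yy t + 2 + i); rewrite !lE // vin 1?ltnW // -addnS vin //.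
  by case/letter_inv=> a' [c [_ [<-] [<-] ab lr]]; split.
by rewrite /pv yE (_ : yy t + 3 + ss t = (yy t + 2 + ss t).+1) ?(proj2 vtop) //; lia.
Qed.

Lemma plane_tiling x t :
  plane_rule (ph x t) (ph x.+1 t) (pv x t) (pv x t.+1) (pm x t).
Proof.
by have [N' [r vE]] := plane_rowP x t; have [_ _ _ ->] := stack_rowP vE.
Qed.

Definition letters x t := \sum_(i < ss t) lt x t i.

Lemma lt_mono x t i j : i <= j -> j <= ss t -> lt x t i = false -> lt x t j = false.
Proof.
have [N' [_ vE]] := plane_rowP x t.
have [_ ls _ _] := stack_rowP vE.
move=> /subnK <-; elim: (j - i) => // k IH lk /(IH (ltnW lk)).
by have [_ [_ [_ ]]] := ls _ lk.
Qed.

Lemma letters_all x t : h x (yy t).+1 = bottom false ->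
  (forall i, i < ss t -> lt x t i = true) -> ss t = N.
Proof.
move=> bE al.
have [N' [_ vE]] := plane_rowP x t.
have [_ ls _ _] := stack_rowP vE.
have tp : h x (yy t + 2 + ss t) = top.
  have [/(_ x) [_ _ _ + _] _] := rows t.
  by case: (h x _) => [?|[?|[?|[]]]].
have [lN|lN|//] := ltngtP (ss t) N; exfalso.
  apply: (@avoids (bottom false :: rcons (nseq (ss t) (letter true)) top) x (yy t).+1).
    rewrite mem_cat; apply/orP; left; apply/mapP; exists (ss t) => //.
    by rewrite mem_iota.
  rewrite /factor_at /= size_rcons size_nseq; apply: (@eq_from_nth _ top).
    by rewrite size_mkseq /= size_rcons size_nseq.
  rewrite /= size_rcons size_nseq => -[|i] li; first by rewrite /= addn0 bE.
  rewrite nth_mkseq //= nth_rcons size_nseq nth_nseq addSnnS -addn2 addnA addnAC.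
  have [li'|] := ltnP i (ss t); first by rewrite (proj1 (ls _ li')) al.
  by move=> gi; have -> : i = ss t by [lia]; rewrite eqxx tp.
apply: (@avoids (nseq N.+1 (letter true)) x (yy t + 2)).
  by rewrite mem_cat !inE eqxx orbT.
rewrite /factor_at size_nseq; apply: (@eq_from_nth _ top).
  by rewrite size_nseq size_mkseq.
move=> i; rewrite size_nseq => li; rewrite nth_nseq li nth_mkseq //.
have li' : i < ss t by apply: leq_trans lN.
by rewrite (proj1 (ls _ li')) al.
Qed.

(** Only initialisation refers to N, through the height given by [letters_all]. Reading removes the
    lowest letter, which is [true] exactly when the count is positive. *)
Lemma letters_count x t : count_rule N (pm x t) (letters x t) (letters x.+1 t).
Proof.
have [N' [_ vE]] := plane_rowP x t.
have [[p [p' [bE bE' br]]] ls last_ _] := stack_rowP vE.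
rewrite /count_rule; case E: (pm x t) br => [[[] b]|] //.
- move=> [_ <-].
  have shift : letters x.+1 t + lt x t 0 = letters x t.
    have -> : letters x.+1 t = \sum_(i < ss t) lt x t i.+1.
      apply: eq_bigr => i _; have [_ [_ [+ _]]] := ls i (ltn_ord i).
      by rewrite E /= => ->.
    have := big_ord_recl (ss t) (fun i => nat_of_bool (lt x t i)) (op := addn) (idx := 0).
    rewrite big_ord_recr /= last_ addn0 => e.
    by rewrite addnC /letters [RHS]e.
  have [l0|l0] := boolP (lt x t 0).
    by rewrite l0 addn1 in shift; rewrite -shift.
  have z : letters x t = 0.
    rewrite /letters big1 // => i _.
    by rewrite (@lt_mono x t 0) //; [apply: ltnW | apply/negbTE].
  by rewrite z /=; move: shift; rewrite z; case: (letters _ _).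
- case: b E => E.
    by move=> _; apply: eq_bigr => i _; have [_ [_ [+ _]]] := ls i (ltn_ord i); rewrite E /= => ->.
  move=> [p0 _]; have al i : i < ss t -> lt x t i = true /\ lt x.+1 t i = true.
    by move=> li; have [_ [_ [+ _]]] := ls i li; rewrite E.
  have sN : ss t = N.
    by apply: (@letters_all x) => [|i /al[]]; rewrite ?bE ?p0.
  have sumE (F : nat -> bool) : (forall i, i < ss t -> F i = true) ->
      \sum_(i < ss t) F i = N.
    move=> F1; rewrite (eq_bigr (fun=> 1)) ?sum1_card ?card_ord // => i _.
    by rewrite F1.
  by split; apply: sumE => i /al[].
Qed.
End Rows.

Lemma crank_inj n w w' : w < 3 ^ n -> w' < 3 ^ n -> cantor n w -> cantor n w' ->
  crank n w = crank n w' -> w = w'.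
Proof.
move=> _ _ cw cw' e; have [l|l|//] := ltngtP w w'.
  by have := crank_le n l; rewrite crankS cw e addn1 ltnn.
by have := crank_le n l; rewrite crankS cw' e addn1 ltnn.
Qed.

Lemma edges_witness : hedge * vedge.
Proof. exact: ((((d0, d0, zone, d0), (d0, zone)), None, None), (((d0, d0, zone, d0), (d0, zone)), None, None)). Qed.

(** If the loader followed by M accepts after k steps, a zone of level k + 1 has room for these
    steps, and [zone_run] forbids the accepting state there. The counter seen by this zone is that
    of the stacks along its middle row. *)
Lemma stack_forced : ~ halts_with M (nseq N tt) true.
Proof.
have [yy [ss rows]] := stack_rows.
have [he ve] := edges_witness.
pose H x t := ph yy he x t; pose V x t := pv yy ve x t; pose m x t := pm yy x t.
have pt x t : plane_rule (H x t) (H x.+1 t) (V x t) (V x t.+1) (m x t).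
  exact: plane_tiling rows _ _ _ _.
have [K KP] := choice (fun p : nat * nat => pt p.1 p.2).
have [r rP] := choice KP.
have sk : skeleton (fun x t => (H x t).1) (fun x t => (V x t).1)
    (fun x t => K (x, t)) (fun x t => r (x, t)).
  by move=> x t; have [] := rP (x, t).
have cr x t : comp_rule (tile_content (fun x t => (H x t).1) (fun x t => (V x t).1)
    (fun x t => K (x, t)) x t) (H x t).2 (H x.+1 t).2 (V x t).2 (V x t.+1).2 (m x t).
  by have [_] := rP (x, t).
move=> /accepting_run[k ak].
have lk : k < (2 ^ k.+1)./2 by rewrite expnS mul2n doubleK ltn_expl.
have [X [Y [zin zl zb zt]]] := zone_exists k.+1 sk.
have [w0 lw0 [cw0 rw0]] : exists2 w, w < 3 ^ k.+1 & cantor k.+1 w /\ crank k.+1 w = (2 ^ k.+1)./2.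
  by apply: crank_onto; rewrite expnS mul2n doubleK -addnn; have := expn_gt0 2 k; lia.
have := @zone_run M k.+1 N (fun u w => (H (X.+1 + u) (Y.+1 + w)).2)
  (fun u w => (V (X.+1 + u) (Y.+1 + w)).2) (fun u w => m (X.+1 + u) (Y.+1 + w))
  (fun u => letters yy ss (X.+1 + u) (Y.+1 + w0)).
case/(_ _ _ _ _ _ k lk)/negP => //.
- by move=> u w lu lw; rewrite !addnS -zin //; apply: cr.
- move=> w lw cw; rewrite addn0; have := cr X (Y.+1 + w).
  by have := zl w lw cw; case: tile_content => -[h'|] [] //= _ [].
- move=> u lu cu; rewrite addn0; have := cr (X.+1 + u) Y.
  by have := zb u lu cu; case: tile_content => -[h'|] [] //= _ [].
- move=> u lu cu; have := cr (X.+1 + u) (Y.+1 + 3 ^ k.+1).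
  by have := zt u lu cu; case: tile_content => -[h'|] [] //= _ [].
move=> u w lu lw mw; have cw : cantor k.+1 w.
  by move: mw; rewrite /rowkind; case: cantor.
have -> : w = w0.
  apply: (crank_inj lw lw0 cw cw0); rewrite rw0.
  by move: mw; rewrite mid_tpos // /tpos => /eqP; move: ((2 ^ _)./2) (crank _ _) => a b; lia.
by rewrite addnS; exact: (letters_count rows he ve).
Qed.
End Forced.
End StackSystem.

(** * Tilings of the whole plane *)

(* Balanced ternary expansions: [x = 3 * par x + a - 1], where [a] is the value of
   [dgt x]. *)
Definition par (x : int) : int := divz (x + 1)%R 3.
Definition dgt (x : int) : digit :=
  let m := modz (x + 1)%R 3 in if m == 0%R then d0 else if m == 1%R then d1 else d2.

Lemma dgtP x : exists i, [\/ [/\ x = (3 * i - 1)%R, par x = i & dgt x = d0],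
  [/\ x = (3 * i)%R, par x = i & dgt x = d1] | [/\ x = (3 * i + 1)%R, par x = i & dgt x = d2]].
Proof.
exists (par x); rewrite /dgt /par.
case: eqP => [e|ne]; first by constructor 1; split=> //; lia.
by case: eqP => [e|ne1]; [constructor 2 | constructor 3]; split=> //; lia.
Qed.

Lemma par0 i : par (3 * i - 1)%R = i. Proof. by rewrite /par; lia. Qed.
Lemma par1 i : par (3 * i)%R = i. Proof. by rewrite /par; lia. Qed.
Lemma par2 i : par (3 * i + 1)%R = i. Proof. by rewrite /par; lia. Qed.
Lemma dgt0 i : dgt (3 * i - 1)%R = d0.
Proof. by rewrite /dgt; have -> : modz (3 * i - 1 + 1)%R 3 = 0%R by lia. Qed.
Lemma dgt1 i : dgt (3 * i)%R = d1.
Proof. by rewrite /dgt; have -> : modz (3 * i + 1)%R 3 = 1%R by lia. Qed.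
Lemma dgt2 i : dgt (3 * i + 1)%R = d2.
Proof. by rewrite /dgt; have -> : modz (3 * i + 1 + 1)%R 3 = 2%R by lia. Qed.

(** The reason for balanced digits: 0 is its own parent and every other integer moves closer to it.
    Hence the nested blocks around the origin exhaust the plane, and all decorations can be defined
    by recursion on the parent. *)
Lemma par_lt x : x <> 0%R -> absz (par x) < absz x.
Proof. by rewrite /par => ?; lia. Qed.

Lemma par_le x : absz (par x) <= absz x.
Proof. by rewrite /par; lia. Qed.

Lemma dgt0_neq0 x : dgt x = d0 -> x <> 0%R.
Proof. by move=> + e; rewrite e. Qed.

Lemma succ0 (i : int) : (3 * i - 1 + 1 = 3 * i)%R. Proof. by lia. Qed.
Lemma succ2 (i : int) : (3 * i + 1 + 1 = 3 * (i + 1) - 1)%R. Proof. by lia. Qed.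

Lemma dgtS x : dgt (x + 1)%R = dsucc (dgt x).
Proof.
by have [i [[-> _ ->]|[-> _ ->]|[-> _ ->]]] := dgtP x;
  rewrite ?succ0 ?succ2 ?dgt0 ?dgt1 ?dgt2.
Qed.

Lemma parS x : dgt x <> d2 -> par (x + 1)%R = par x.
Proof.
by have [i [[-> -> ->]|[-> -> ->]|[-> -> ->]]] := dgtP x;
  rewrite ?succ0 ?succ2 ?par0 ?par1 ?par2.
Qed.

Section Recursion.
Variables (D T : Type) (size : D -> nat) (parent : D -> D) (base : T)
  (F : D -> (D -> T) -> T).

Fixpoint rec_fuel (n : nat) (x : D) : T := if n is n'.+1 then F x (rec_fuel n') else base.

Definition parent_rec (x : D) : T := rec_fuel (size x).+1 x.

(** The recursive value may be consulted only at a smaller parent; the body must ignore it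
    otherwise, in particular at the fixed point 0. *)
Lemma parent_recE :
  (forall x f g, (size (parent x) < size x -> f (parent x) = g (parent x)) -> F x f = F x g) ->
  forall x, parent_rec x = F x parent_rec.
Proof.
move=> Fext; have fuel n m x : size x < n -> size x < m -> rec_fuel n x = rec_fuel m x.
  elim: n m x => // n IH [//|m] x ln lm /=; apply: Fext => lp.
  by apply: IH; [apply: leq_trans lp ln | apply: leq_trans lp lm].
by move=> x; apply: Fext => lp; apply: fuel.
Qed.
End Recursion.

Definition place (p : int * int) : digit * digit := (dgt p.1, dgt p.2).
Definition ppar (p : int * int) : int * int := (par p.1, par p.2).

Definition kind : int * int -> content :=
  parent_rec (fun p => absz p.1 + absz p.2) zone (fun p f => csub (f (ppar p)) (place p)).

Lemma kindE p : kind p = csub (kind (ppar p)) (place p).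
Proof.
rewrite {1}/kind (@parent_recE _ _ _ ppar) // => -[x y] f g; rewrite /ppar /=.
have [->|nx] := eqVneq x 0%R; last first.
  by move=> -> //; have := par_lt (elimN eqP nx); have := par_le y; lia.
have [->|ny] := eqVneq y 0%R; first by [].
by move=> -> //; have := par_lt (elimN eqP ny); have : par 0%R = 0%R by []; lia.
Qed.

Definition block (x y : int) : content := kind (par x, par y).

Definition lineF (y : int) (f : int -> digit) : digit :=
  match dgt y with None => f (par y) | Some false => dgt (par y) | _ => d0 end.
Definition line : int -> digit := parent_rec absz d0 lineF.

(** On a bottom line the value is that of the west edge of the parent up to the tile that performs
    the step of the parent, and that of its east edge, at [par x + 1], afterwards. Any change takes
    place at the corner, except for a block at place (d2, d1), where the middle column performs it.
    Top lines carry an arbitrary constant. The same function serves the vertical edges, with the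
    axes exchanged. *)
Definition counterF (B : int -> int -> content) (y : int) (f : int -> int -> digit * content)
    (x : int) : digit * content :=
  match dgt y, dgt x with
  | None, None => f (par y) (par x)
  | None, Some false =>
    if (dgt (par x), dgt (par y)) == (d2, d1) then f (par y) (par x)
    else f (par y) (par x + 1)%R
  | None, Some true => f (par y) (par x + 1)%R
  | Some false, _ => (dgt (par x), B (par x) (par y))
  | Some true, _ => (d0, zone)
  end.
Definition counter (B : int -> int -> content) : int -> int -> digit * content :=
  parent_rec absz (fun=> (d0, zone)) (counterF B).
Definition hcounter x y := counter block y x.
Definition vcounter x y := counter (fun y x => block x y) x y.

Definition hmsgF (y : int) (f : int -> int -> option (digit * digit)) (x : int) :=
  match dgt y, dgt x with
  | None, None => f (par y) (par x)
  | None, Some false =>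
    if (dgt (par x) == d0) && (dgt (par y) != d0) then Some (d0, dgt (par y))
    else f (par y) (par x + 1)%R
  | None, Some true => f (par y) (par x + 1)%R
  | _, _ => None
  end.
Definition hmsg x y := parent_rec absz (fun=> None) hmsgF y x.

Definition vmsgF (x : int) (f : int -> int -> option (digit * digit)) (y : int) :=
  match dgt x, dgt y with
  | None, None => f (par x) (par y)
  | None, Some false =>
    if dgt (par x) != d0 then Some (dgt (par x), dgt (par y))
    else f (par x) (par y + 1)%R
  | None, Some true => f (par x) (par y + 1)%R
  | _, _ => None
  end.
Definition vmsg x y := parent_rec absz (fun=> None) vmsgF x y.

Definition roleF (x : int) (f : int -> int -> digit * digit) (y : int) : digit * digit :=
  match dgt x, dgt y with
  | None, None => f (par x) (par y)
  | _, _ => (dgt x, dgt y)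
  end.
Definition role x y := parent_rec absz (fun=> (d0, d0)) roleF x y.

Lemma lineE y : line y = lineF y line.
Proof.
rewrite {1}/line (@parent_recE _ _ _ par) // => x f g E; rewrite /lineF.
by case e: (dgt x) => [[]|] //; rewrite E //; apply: par_lt (dgt0_neq0 e).
Qed.

Lemma counterE B y : counter B y = counterF B y (counter B).
Proof.
rewrite {1}/counter (@parent_recE _ _ _ par) // => x f g E; apply: funext => z; rewrite /counterF.
by case e: (dgt x) => [[]|] //; rewrite E //; apply: par_lt (dgt0_neq0 e).
Qed.

Lemma hcounterE x y : hcounter x y =
  match dgt y, dgt x with
  | None, None => hcounter (par x) (par y)
  | None, Some false =>
    if (dgt (par x), dgt (par y)) == (d2, d1) then hcounter (par x) (par y)
    else hcounter (par x + 1)%R (par y)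
  | None, Some true => hcounter (par x + 1)%R (par y)
  | Some false, _ => (dgt (par x), block (par x) (par y))
  | Some true, _ => (d0, zone)
  end.
Proof. by rewrite /hcounter {1}counterE. Qed.

Lemma vcounterE x y : vcounter x y =
  match dgt x, dgt y with
  | None, None => vcounter (par x) (par y)
  | None, Some false =>
    if (dgt (par y), dgt (par x)) == (d2, d1) then vcounter (par x) (par y)
    else vcounter (par x) (par y + 1)%R
  | None, Some true => vcounter (par x) (par y + 1)%R
  | Some false, _ => (dgt (par y), block (par x) (par y))
  | Some true, _ => (d0, zone)
  end.
Proof. by rewrite /vcounter {1}counterE. Qed.

Lemma hmsgE x y : hmsg x y =
  match dgt y, dgt x with
  | None, None => hmsg (par x) (par y)
  | None, Some false =>
    if (dgt (par x) == d0) && (dgt (par y) != d0) then Some (d0, dgt (par y))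
    else hmsg (par x + 1)%R (par y)
  | None, Some true => hmsg (par x + 1)%R (par y)
  | _, _ => None
  end.
Proof.
rewrite /hmsg {1}(@parent_recE _ _ _ par) // => z f g E; apply: funext => w; rewrite /hmsgF.
by case e: (dgt z) => [[]|] //; rewrite E //; apply: par_lt (dgt0_neq0 e).
Qed.

Lemma vmsgE x y : vmsg x y =
  match dgt x, dgt y with
  | None, None => vmsg (par x) (par y)
  | None, Some false =>
    if dgt (par x) != d0 then Some (dgt (par x), dgt (par y))
    else vmsg (par x) (par y + 1)%R
  | None, Some true => vmsg (par x) (par y + 1)%R
  | _, _ => None
  end.
Proof.
rewrite /vmsg {1}(@parent_recE _ _ _ par) // => z f g E; apply: funext => w; rewrite /vmsgF.
by case e: (dgt z) => [[]|] //; rewrite E //; apply: par_lt (dgt0_neq0 e).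
Qed.

Lemma roleE x y : role x y =
  match dgt x, dgt y with
  | None, None => role (par x) (par y)
  | _, _ => (dgt x, dgt y)
  end.
Proof.
rewrite {1}/role (@parent_recE _ _ _ par) // => z f g E; apply: funext => w; rewrite /roleF.
by case e: (dgt z) => [[]|] //; rewrite E //; apply: par_lt (dgt0_neq0 e).
Qed.

Definition hedge_at x y :=
  mkedge (dgt y) (dgt x) (block x y) (line y) (hcounter x y) (hmsg x y).
Definition vedge_at x y :=
  mkedge (dgt x) (dgt y) (block x y) (line x) (vcounter x y) (vmsg x y).

Lemma hcounter_child i j : ((hcounter (3 * i - 1)%R (3 * j - 1)%R = hcounter i j) *
  (hcounter (3 * i - 1)%R (3 * j)%R = (dgt i, block i j)) *
  (hcounter (3 * i - 1)%R (3 * j + 1)%R = (d0, zone)) *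
  (hcounter (3 * i)%R (3 * j - 1)%R = (if (dgt i, dgt j) == (d2, d1) then hcounter i j else hcounter (i + 1)%R j)) *
  (hcounter (3 * i)%R (3 * j)%R = (dgt i, block i j)) *
  (hcounter (3 * i)%R (3 * j + 1)%R = (d0, zone)) *
  (hcounter (3 * i + 1)%R (3 * j - 1)%R = hcounter (i + 1)%R j) *
  (hcounter (3 * i + 1)%R (3 * j)%R = (dgt i, block i j)) *
  (hcounter (3 * i + 1)%R (3 * j + 1)%R = (d0, zone)))%type.
Proof.
by do !split; rewrite hcounterE ?par0 ?par1 ?par2 ?dgt0 ?dgt1 ?dgt2.
Qed.

Lemma vcounter_child i j : ((vcounter (3 * i - 1)%R (3 * j - 1)%R = vcounter i j) *
  (vcounter (3 * i - 1)%R (3 * j)%R = (if (dgt j, dgt i) == (d2, d1) then vcounter i j else vcounter i (j + 1)%R)) *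
  (vcounter (3 * i - 1)%R (3 * j + 1)%R = vcounter i (j + 1)%R) *
  (vcounter (3 * i)%R (3 * j - 1)%R = (dgt j, block i j)) *
  (vcounter (3 * i)%R (3 * j)%R = (dgt j, block i j)) *
  (vcounter (3 * i)%R (3 * j + 1)%R = (dgt j, block i j)) *
  (vcounter (3 * i + 1)%R (3 * j - 1)%R = (d0, zone)) *
  (vcounter (3 * i + 1)%R (3 * j)%R = (d0, zone)) *
  (vcounter (3 * i + 1)%R (3 * j + 1)%R = (d0, zone)))%type.
Proof.
by do !split; rewrite vcounterE ?par0 ?par1 ?par2 ?dgt0 ?dgt1 ?dgt2.
Qed.

Lemma hmsg_child i j : ((hmsg (3 * i - 1)%R (3 * j - 1)%R = hmsg i j) *
  (hmsg (3 * i - 1)%R (3 * j)%R = None) *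
  (hmsg (3 * i - 1)%R (3 * j + 1)%R = None) *
  (hmsg (3 * i)%R (3 * j - 1)%R = (if (dgt i == d0) && (dgt j != d0) then Some (d0, dgt j) else hmsg (i + 1)%R j)) *
  (hmsg (3 * i)%R (3 * j)%R = None) *
  (hmsg (3 * i)%R (3 * j + 1)%R = None) *
  (hmsg (3 * i + 1)%R (3 * j - 1)%R = hmsg (i + 1)%R j) *
  (hmsg (3 * i + 1)%R (3 * j)%R = None) *
  (hmsg (3 * i + 1)%R (3 * j + 1)%R = None))%type.
Proof.
by do !split; rewrite hmsgE ?par0 ?par1 ?par2 ?dgt0 ?dgt1 ?dgt2.
Qed.

Lemma vmsg_child i j : ((vmsg (3 * i - 1)%R (3 * j - 1)%R = vmsg i j) *
  (vmsg (3 * i - 1)%R (3 * j)%R = (if dgt i != d0 then Some (dgt i, dgt j) else vmsg i (j + 1)%R)) *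
  (vmsg (3 * i - 1)%R (3 * j + 1)%R = vmsg i (j + 1)%R) *
  (vmsg (3 * i)%R (3 * j - 1)%R = None) *
  (vmsg (3 * i)%R (3 * j)%R = None) *
  (vmsg (3 * i)%R (3 * j + 1)%R = None) *
  (vmsg (3 * i + 1)%R (3 * j - 1)%R = None) *
  (vmsg (3 * i + 1)%R (3 * j)%R = None) *
  (vmsg (3 * i + 1)%R (3 * j + 1)%R = None))%type.
Proof.
by do !split; rewrite vmsgE ?par0 ?par1 ?par2 ?dgt0 ?dgt1 ?dgt2.
Qed.

Lemma line_child i : ((line (3 * i - 1)%R = line i) * (line (3 * i)%R = dgt i) *
  (line (3 * i + 1)%R = d0))%type.
Proof. by do !split; rewrite lineE /lineF ?par0 ?par1 ?par2 ?dgt0 ?dgt1 ?dgt2. Qed.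

Lemma dgt_child i : ((dgt (3 * i - 1)%R = d0) * (dgt (3 * i)%R = d1) *
  (dgt (3 * i + 1)%R = d2))%type.
Proof. by rewrite dgt0 dgt1 dgt2. Qed.

Lemma par_child i : ((par (3 * i - 1)%R = i) * (par (3 * i)%R = i) *
  (par (3 * i + 1)%R = i))%type.
Proof. by rewrite par0 par1 par2. Qed.

Lemma step_digits i j : cstep (dgt i, block i j) (dgt (i + 1)%R, block (i + 1)%R j).
Proof. by split=> /=; rewrite ?dgtS // => i2; rewrite /block parS. Qed.

Lemma step_digitsv i j : cstep (dgt j, block i j) (dgt (j + 1)%R, block i (j + 1)%R).
Proof. by split=> /=; rewrite ?dgtS // => i2; rewrite /block parS. Qed.

Lemma hcounter_line x y : dgt y = d1 -> hcounter x y = (dgt (par x), block (par x) (par y)).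
Proof. by rewrite hcounterE => ->. Qed.

Lemma vcounter_line x y : dgt x = d1 -> vcounter x y = (dgt (par y), block (par x) (par y)).
Proof. by rewrite vcounterE => ->. Qed.

Lemma par_succ x : dgt x = d2 -> par (x + 1)%R = (par x + 1)%R.
Proof.
by have [i [[-> -> ->]|[-> -> ->]|[-> -> ->]]] := dgtP x; rewrite ?succ2 ?par0.
Qed.

Lemma hstep x y : dgt y = d1 -> dgt x = d2 -> cstep (hcounter x y) (hcounter (x + 1)%R y).
Proof.
by move=> y1 x2; rewrite (hcounter_line x) // (hcounter_line (x + 1)%R) // par_succ //; apply: step_digits.
Qed.

Lemma vstep x y : dgt x = d1 -> dgt y = d2 -> cstep (vcounter x y) (vcounter x (y + 1)%R).
Proof.
by move=> x1 y2; rewrite (vcounter_line y) // (vcounter_line (y + 1)%R) // par_succ //; apply: step_digitsv.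
Qed.

Lemma hcounter_junk x y : dgt y = d2 -> hcounter x y = (d0, zone).
Proof. by rewrite hcounterE => ->. Qed.

Lemma vcounter_junk x y : dgt x = d2 -> vcounter x y = (d0, zone).
Proof. by rewrite vcounterE => ->. Qed.

Lemma hmsg_silent x y : dgt y <> d0 -> hmsg x y = None.
Proof. by rewrite hmsgE; case: (dgt y) => [[]|]. Qed.

Lemma vmsg_silent x y : dgt x <> d0 -> vmsg x y = None.
Proof. by rewrite vmsgE; case: (dgt x) => [[]|]. Qed.

Lemma block_csub i j : block (3 * i)%R (3 * j)%R = csub (block i j) (dgt i, dgt j).
Proof. by rewrite /block !par_child kindE. Qed.

Lemma block_check i j : dgt i = d1 -> dgt j = d1 ->
  block i j = csub (hcounter (i + 1)%R j).2 ((hcounter (i + 1)%R j).1, line j).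
Proof.
move=> i1 j1; rewrite hcounter_line // parS ?i1 //= lineE /lineF j1.
by rewrite {1}/block kindE.
Qed.

Definition rule_at x y := base_rule (hedge_at x y) (hedge_at (x + 1)%R y)
  (vedge_at x y) (vedge_at x (y + 1)%R) (block x y) (role x y).

Lemma mvh x y : mv (hedge_at x y) = dgt x. Proof. by []. Qed.
Lemma mvv x y : mv (vedge_at x y) = dgt y. Proof. by []. Qed.

Lemma role_child i j : role (3 * i - 1)%R (3 * j - 1)%R = role i j.
Proof. by rewrite (roleE (_ - 1)%R) !dgt_child !par_child. Qed.

Lemma origin_holds i j : rule_at i j ->
  origin_rule (hedge_at (3 * i - 1)%R (3 * j - 1)%R) (hedge_at (3 * i)%R (3 * j - 1)%R)
    (vedge_at (3 * i - 1)%R (3 * j - 1)%R) (vedge_at (3 * i - 1)%R (3 * j)%R) (role i j).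
Proof.
rewrite /rule_at /base_rule mvh mvv.
case di: (dgt i) => [a|]; case dj: (dgt j) => [b|].
- have -> : role i j = (Some a, Some b) by rewrite roleE di dj.
  rewrite /origin_rule /rowsilent /crossing /hedge_at /vedge_at !edgeE.
  rewrite !(hcounter_child, vcounter_child, hmsg_child, vmsg_child, line_child) di dj /=.
  rewrite !(hmsg_silent _ (y := j)) ?dj // !(vmsg_silent _ (x := i)) ?di //.
  case: a b di dj => [] [] di dj /= [_ _].
  + by rewrite !(hcounter_junk _ dj) !(vcounter_junk _ di).
  + by rewrite !(vcounter_junk _ di).
  + by rewrite !(hcounter_junk _ dj).
  + by case=> cr -> -> _.
- have -> : role i j = (Some a, None) by rewrite roleE di dj.
  rewrite /origin_rule /rowsilent /rowpass /rowmsg /hedge_at /vedge_at !edgeE.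
  rewrite !(hcounter_child, vcounter_child, hmsg_child, vmsg_child, line_child) di dj /=.
  rewrite !(vmsg_silent _ (x := i)) ?di //.
  case: a di => di /= [_].
    by move=> -> ->; rewrite !(vcounter_junk _ di).
  by move=> -> H.
- have -> : role i j = (None, Some b) by rewrite roleE di dj.
  rewrite /origin_rule /rowsilent /colpass /colmsg /hedge_at /vedge_at !edgeE.
  rewrite !(hcounter_child, vcounter_child, hmsg_child, vmsg_child, line_child) di dj /=.
  rewrite !(hmsg_silent _ (y := j)) ?dj //.
  case: b dj => dj /= [_].
    by move=> -> ->; rewrite !(hcounter_junk _ dj).
  by move=> -> H.
- rewrite /origin_rule /rowsilent /colpass /colmsg /rowpass /rowmsg /crossing /hedge_at /vedge_at !edgeE.
  by rewrite !(hcounter_child, vcounter_child, hmsg_child, vmsg_child, line_child) di dj.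
Qed.

(** Only the corner of a block refers to its parent, by [origin_holds]; a corner has [x] different
    from 0, so the induction on the absolute value of [x] applies to the parent. The other eight
    places are direct computations. *)
Lemma rule_holds x y : rule_at x y.
Proof.
move: {2}(absz x).+1 (ltnSn (absz x)) => n; elim: n x y => // n IH x y lx.
rewrite /rule_at /base_rule mvh mvv.
have [i [[xE pi ex]|[xE pi ex]|[xE pi ex]]] := dgtP x;
  have [j [[yE pj ey]|[yE pj ey]|[yE pj ey]]] := dgtP y; rewrite ex ey /=.
- have lp : absz i < n.
    by rewrite -pi; apply: leq_trans (par_lt (dgt0_neq0 ex)) _.
  have := origin_holds (IH i j lp); rewrite xE yE !succ0 role_child; exact.
all: rewrite /rowsilent /colpass /colmsg /rowpass /rowmsg /crossing /hedge_at /vedge_at !edgeE.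
all: rewrite /= xE yE ?succ0 ?succ2
  ?(hcounter_child, vcounter_child, hmsg_child, vmsg_child, line_child, dgt_child, par_child) /=.
all: try by split.
- split=> //; split.
    case di: (dgt i) => [a|] //=; split=> //.
    by rewrite vmsg_silent ?di.
  case di: (dgt i) => [[]|]; case dj: (dgt j) => [[]|] //=.
  exact: vstep.
- split=> //; split.
  + case di: (dgt i) => [a|] //=; case dj: (dgt j) => [b|] //=; split=> //.
    by rewrite hmsg_silent ?dj.
  + case di: (dgt i) => [[]|]; case dj: (dgt j) => [[]|] //=.
    exact: hstep.
  + by case=> di dj; rewrite di dj; apply: block_check.
- by split=> //; rewrite block_csub.
- by split=> //; apply: step_digitsv.
- by split=> //; apply: step_digits.
Qed.

Lemma skeleton_exists x y : skrule (hedge_at x y) (hedge_at (x + 1)%R y)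
  (vedge_at x y) (vedge_at x (y + 1)%R) (block x y) (role x y).
Proof.
split; last exact: rule_holds; rewrite /hedge_at /vedge_at !edgeE //.
- by rewrite !dgtS.
- by split=> // dx; rewrite /block parS.
Qed.

(* Coordinates inside the zone containing a wire or a cell: the level of the zone,
   the rank of the last column of cells at or before the tile and that of the
   last row of cells at or below it. *)
Notation coords := (nat * nat * nat)%type.

Definition child_rank (on : bool) (d : digit) (n : nat) : nat :=
  match d with
  | Some true => n.*2.+1
  | _ => if on then n.*2 else n.*2.+1
  end.

Definition csubc (k : content * coords) (p : digit * digit) : content * coords :=
  if p == (d1, d1) then (zone, (0, 0, 0))
  else (csub k.1 p, (k.2.1.1.+1, child_rank k.1.2 p.1 k.2.1.2,
                     child_rank (k.1.1 != hoff) p.2 k.2.2)).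

Definition loc : int * int -> content * coords :=
  parent_rec (fun p => absz p.1 + absz p.2) (zone, (0, 0, 0))
    (fun p f => csubc (f (ppar p)) (place p)).

Lemma locE p : loc p = csubc (loc (ppar p)) (place p).
Proof.
rewrite {1}/loc (@parent_recE _ _ _ ppar) // => -[x y] f g; rewrite /ppar /=.
have [->|nx] := eqVneq x 0%R; last first.
  by move=> -> //; have := par_lt (elimN eqP nx); have := par_le y; lia.
have [->|ny] := eqVneq y 0%R; first by [].
by move=> -> //; have := par_lt (elimN eqP ny); have : par 0%R = 0%R by []; lia.
Qed.

Lemma loc_kind p : (loc p).1 = kind p.
Proof.
case: p => x y; move: {2}(absz x + absz y) (leqnn (absz x + absz y)) => n.
elim: n x y => [|n IH] x y l.
  have -> : x = 0%R by lia.
  have -> : y = 0%R by lia.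
  by rewrite locE kindE.
rewrite locE kindE /csubc; case: eqP => [->|_] /=; first by [].
have [->|nx] := eqVneq x 0%R; last first.
  by rewrite IH //=; have := par_lt (elimN eqP nx); have := par_le y; lia.
have [->|ny] := eqVneq y 0%R; first by [].
by rewrite IH //=; have := par_lt (elimN eqP ny); have : par 0%R = 0%R by []; lia.
Qed.


Definition hlink (t t' : content * coords) : Prop :=
  [/\ t.1.1 <> hoff, t'.1.1 = t.1.1, t'.2.1.1 = t.2.1.1, t'.2.2 = t.2.2
    & t'.2.1.2 = t.2.1.2 + t'.1.2].

Definition hcut (t t' : content * coords) : Prop :=
  (t.1.1 = hoff \/ t.1.2 /\ t.2.1.2.+1 = 2 ^ t.2.1.1) /\
  (t'.1.1 = hoff \/ t'.1.2 /\ t'.2.1.2 = 0).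

Definition vlink (t t' : content * coords) : Prop :=
  [/\ t.1.2, t'.1.2, t'.2.1.1 = t.2.1.1, t'.2.1.2 = t.2.1.2
    & t'.2.2 = t.2.2 + (t'.1.1 != hoff)].

Definition vcut (t t' : content * coords) : Prop :=
  (t.1.2 = false \/ t.1.1 <> hoff /\ t.2.2.+1 = 2 ^ t.2.1.1) /\
  (t'.1.2 = false \/ t'.1.1 <> hoff /\ t'.2.2 = 0).

Ltac link_or_cut :=
  try (by left; split=> //=; lia);
  right; split; first [by left | by right; split=> //=; lia].

(** Inside a block this is a finite check from the coordinates of the block. Across the border of
    two blocks it is inherited from the two parents, the ranks being doubled. *)
Lemma adjacent_east x y : hlink (loc (x, y)) (loc (x + 1, y)%R) \/ hcut (loc (x, y)) (loc (x + 1, y)%R).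
Proof.
move: {2}(absz x).+1 (ltnSn (absz x)) => n; elim: n x y => // n IH x y lx.
rewrite (locE (x, y)) (locE (x + 1, y)%R) /ppar /place /=.
have [i [[xE -> ->]|[xE -> ->]|[xE pi ->]]] := dgtP x.
- rewrite xE succ0 par1 dgt1.
  case: (loc (i, par y)) => [[h v] [[l X] Y]]; case: (dgt y) => [[]|];
  by case: h => [[[]|]|]; case: v; rewrite /hlink /hcut /csubc /csub /=; link_or_cut.
- rewrite xE par2 dgt2.
  case: (loc (i, par y)) => [[h v] [[l X] Y]]; case: (dgt y) => [[]|];
  by case: h => [[[]|]|]; case: v; rewrite /hlink /hcut /csubc /csub /=; link_or_cut.
- have li : absz i < n.
    by rewrite -pi; have : x <> 0%R by [lia]; move=> /par_lt; lia.
  rewrite xE succ2 par0 dgt0 par2.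
  have := IH i (par y) li.
  case: (loc (i, par y)) => [[h v] [[l X] Y]].
  case: (loc (i + 1, par y)%R) => [[h' v'] [[l' X'] Y']].
  rewrite /hlink /hcut /= => -[[hn -> -> -> ->]|[c c']].
    by move: hn; case: (dgt y) => [[]|]; case: h => [[[]|]|] // _; case: v; case: v';
      rewrite /csubc /csub /=; link_or_cut.
  have {}c : h = hoff \/ v /\ X.*2.+1.+1 = 2 ^ l.+1.
    by case: c => [->|[-> c]]; [left | right; split=> //; rewrite expnS -c; lia].
  right; split.
    by case: c => [->|[-> c]]; case: (dgt y) => [[]|]; rewrite /csubc /csub /=; by [left | right].
  by case: c' => [->|[-> ->]]; case: (dgt y) => [[]|]; rewrite /csubc /csub /=; by [left | right].
Qed.

Lemma adjacent_north x y : vlink (loc (x, y)) (loc (x, y + 1)%R) \/ vcut (loc (x, y)) (loc (x, y + 1)%R).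
Proof.
move: {2}(absz y).+1 (ltnSn (absz y)) => n; elim: n x y => // n IH x y ly.
rewrite (locE (x, y)) (locE (x, y + 1)%R) /ppar /place /=.
have [i [[yE -> ->]|[yE -> ->]|[yE pi ->]]] := dgtP y.
- rewrite yE succ0 par1 dgt1.
  case: (loc (par x, i)) => [[h v] [[l X] Y]]; case: (dgt x) => [[]|];
  by case: h => [[[]|]|]; case: v; rewrite /vlink /vcut /csubc /csub /=; link_or_cut.
- rewrite yE par2 dgt2.
  case: (loc (par x, i)) => [[h v] [[l X] Y]]; case: (dgt x) => [[]|];
  by case: h => [[[]|]|]; case: v; rewrite /vlink /vcut /csubc /csub /=; link_or_cut.
- have li : absz i < n.
    by rewrite -pi; have : y <> 0%R by [lia]; move=> /par_lt; lia.
  rewrite yE succ2 par0 dgt0 par2.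
  have := IH (par x) i li.
  case: (loc (par x, i)) => [[h v] [[l X] Y]].
  case: (loc (par x, i + 1)%R) => [[h' v'] [[l' X'] Y']].
  rewrite /vlink /vcut /= => -[[-> -> -> -> ->]|[c c']].
    by case: (dgt x) => [[]|]; case: h => [[[]|]|]; case: h' => [[[]|]|];
      rewrite /csubc /csub /=; link_or_cut.
  have {}c : v = false \/ h <> hoff /\ Y.*2.+1.+1 = 2 ^ l.+1.
    by case: c => [->|[hn c]]; [left | right; split=> //; rewrite expnS -c; lia].
  right; split.
    case: c => [->|[hn c]].
      by case: (dgt x) => [[]|]; rewrite /csubc /csub /=; left.
    by move: hn; case: (dgt x) => [[]|]; case: h => [[[]|]|] // _; rewrite /csubc /csub /=;
      rewrite ?andbF; by [left | right].
  case: c' => [->|[hn ->]].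
    by case: (dgt x) => [[]|]; rewrite /csubc /csub /=; left.
  by move: hn; case: (dgt x) => [[]|]; case: h' => [[[]|]|] // _; rewrite /csubc /csub /=;
    rewrite ?andbF; by [left | right].
Qed.

Definition loc_kindok (t : content * coords) : Prop :=
  t.1.1 <> hoff -> t.2.2 < 2 ^ t.2.1.1 /\
  t.1.1 = if t.2.1.1 == 0 then htop else if t.2.2 == 2 ^ t.2.1.1.-1 then hmid else hnorm.

Lemma loc_kindokP p : loc_kindok (loc p) /\ ((loc p).1.2 -> (loc p).2.1.2 < 2 ^ (loc p).2.1.1).
Proof.
case: p => x y; move: {2}(absz x + absz y) (leqnn (absz x + absz y)) => n.
elim: n x y => [|n IH] x y l.
  have -> : x = 0%R by lia.
  have -> : y = 0%R by lia.
  by rewrite locE.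
have IH' : place (x, y) <> (d1, d1) ->
    loc_kindok (loc (ppar (x, y))) /\
    ((loc (ppar (x, y))).1.2 -> (loc (ppar (x, y))).2.1.2 < 2 ^ (loc (ppar (x, y))).2.1.1).
  rewrite /place /ppar /=; have [->|nx] := eqVneq x 0%R; last first.
    by move=> _; apply: IH; have := par_lt (elimN eqP nx); have := par_le y; lia.
  have [->|ny] := eqVneq y 0%R; first by [].
  by move=> _; apply: IH; have := par_lt (elimN eqP ny); have : par 0%R = 0%R by []; lia.
rewrite locE /csubc; case: eqP => [//|nc].
move: (IH' nc); case: (loc _) => [[h v] [[k X] Y]]; rewrite /loc_kindok /= => -[hE vE].
have {nc} -> : csub (h, v) (place (x, y)) =
    (hsub h (dgt y), v && (dgt x != d1)).
  by rewrite /csub; case: eqP nc.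
rewrite /= expnS; split.
  move=> hn; have hn' : h <> hoff by move=> q; move: hn; rewrite q; case: (dgt y) => [[]|].
  have [lY hE'] := hE hn'; rewrite hE' in hn *.
  case: k {hE vE} lY hE' hn => [|k] lY hE' hn.
    have -> : Y = 0 by move: lY; rewrite expn0; lia.
    by move: hn; rewrite -hE'; case: h hE' {hn'} => // [[[]|]] // _; case: (dgt y) => [[]|].
  rewrite expnS in lY; move: hn; rewrite /= expnS; case: eqP => [->|ne] /=.
    case: (dgt y) => [[]|] //= _; (split; first by lia).
      by have -> : ((2 ^ k).*2.+1 == 2 * 2 ^ k) = false by lia.
    by have -> : ((2 ^ k).*2 == 2 * 2 ^ k) = true by lia.
  case: (dgt y) => [[]|] //= _; (split; first by lia).
    by have -> : (Y.*2.+1 == 2 * 2 ^ k) = false by lia.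
  by have -> : (Y.*2 == 2 * 2 ^ k) = false by lia.
case: v vE => //= /(_ isT) lX; case: (dgt x) => [[]|] //= _; lia.
Qed.

Lemma mid_rank p : (loc p).1.1 <> hoff ->
  (loc p).2.2 < 2 ^ (loc p).2.1.1 /\
  is_mid (loc p).1.1 = ((loc p).2.2 == (2 ^ (loc p).2.1.1)./2).
Proof.
move=> hn; have [/(_ hn)[lY hE] _] := loc_kindokP p; split=> //; rewrite hE.
case: (loc p).2.1.1 lY => [|n] lY.
  by move: lY; rewrite expn0 ltnS leqn0 => /eqP ->.
by rewrite /= expnS mul2n doubleK; case: eqP.
Qed.

Arguments is_mid : simpl never.

(** * The tiling of the plane when the machine never accepts *)

Section Plane.
Variables (M : turing_machine unit) (N : nat).
Hypothesis noaccept : forall k, ~~ accepting (lst (iter k (@lstep M) (linitial M N))).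

Notation lstate := (option (option (option (state M)))).
Notation hcomp := (option (option (unit + work_symbol M) * option lstate)).
Notation vcomp := (option (option lstate * option lstate)).
Notation cmode := (option (bool * bool)).

Definition cpos n Y : int := (Posz Y - Posz (2 ^ n)./2)%R.

(* The run is frozen when the head leaves the zone. *)
Definition zstep n (L : lconfig M) : lconfig M :=
  if (0 <= lhead L + Posz (2 ^ n)./2 < Posz (2 ^ n))%R then lstep L else L.

Definition zrun n k := iter k (zstep n) (linitial M N).

Lemma zrun_prefix n k : exists k', zrun n k = iter k' (@lstep M) (linitial M N).
Proof.
elim: k => [|k [k' IH]]; first by exists 0.
rewrite /zrun iterS -/(zrun n k) /zstep.
by case: ifP => _; [exists k'.+1; rewrite IH | exists k'].
Qed.

Lemma zrun_count n k : lcount (zrun n k) <= N.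
Proof.
have [k' ->] := zrun_prefix n k; elim: k' => [|k' IH] //.
rewrite iterS /lstep; case: ltrans => [[s a] m] /=.
by case: ifP => _ //; apply: leq_trans (leq_pred _) IH.
Qed.

Definition cell_show n Y (L : lconfig M) : option (unit + work_symbol M) * option lstate :=
  (ltape L (cpos n Y), if lhead L == cpos n Y then Some (lst L) else None).

Definition louts n Y L := lout (cell_show n Y L) (cpos n Y == 0%R) (0 < lcount L).

Lemma cell_next n Y L : Y < 2 ^ n ->
  cell_show n Y (zstep n L) =
  ((louts n Y L).1, omerge (louts n Y L).2.2
    (omerge (if Y is Y'.+1 then (louts n Y' L).2.1.1 else None)
            (if Y.+1 == 2 ^ n then None else (louts n Y.+1 L).2.1.2))).
Proof.
move=> lY; rewrite /zstep; case: ifP => inz; last first.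
  have off Y' : Y' < 2 ^ n -> (lhead L == cpos n Y') = false.
    by move=> lY'; apply/negP=> /eqP q; move: inz; rewrite q /cpos; lia.
  have u Y' : Y' < 2 ^ n -> louts n Y' L = (ltape L (cpos n Y'), (None, None, None)).
    by move=> lY'; rewrite /louts /lout /cell_show /= off.
  rewrite u // /cell_show off // (_ : (if Y is Y'.+1 then _ else _) = None).
    by have [//|ne] := eqVneq Y.+1 (2 ^ n); rewrite u //; lia.
  by case: Y lY => // Y lY; rewrite u // ltnW.
set s' := (ltrans (lst L) (ltape L (lhead L)) (lhead L == 0%R) (0 < lcount L)).1.1.
set a' := (ltrans (lst L) (ltape L (lhead L)) (lhead L == 0%R) (0 < lcount L)).1.2.
set mo := (ltrans (lst L) (ltape L (lhead L)) (lhead L == 0%R) (0 < lcount L)).2.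
have outE Y' : louts n Y' L = if lhead L == cpos n Y' then (a', moved mo s')
    else (ltape L (cpos n Y'), (None, None, None)).
  rewrite /louts /lout /cell_show /=; case: eqP => [<-|//] /=.
  by rewrite /a' /mo /s'; case: ltrans => [[]].
have below : (if Y is Y'.+1 then (louts n Y' L).2.1.1 else None) =
    if lhead L == (cpos n Y - 1)%R then (moved mo s').1.1 else None.
  case: Y {lY} => [|Y]; last first.
    rewrite outE; have -> : (cpos n Y.+1 - 1 = cpos n Y)%R by rewrite /cpos; lia.
    by case: eqP.
  by case: eqP => // q; move: inz; rewrite q /cpos; lia.
have above : (if Y.+1 == 2 ^ n then None else (louts n Y.+1 L).2.1.2) =
    if lhead L == (cpos n Y + 1)%R then (moved mo s').1.2 else None.
  have E : (cpos n Y + 1 = cpos n Y.+1)%R by rewrite /cpos; lia.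
  rewrite outE E; case: eqP => [q|_]; last by case: eqP.
  by case: eqP => // q'; move: inz; rewrite q' /cpos q; lia.
rewrite below above outE /cell_show /lstep.
have -> : ltrans (lst L) (ltape L (lhead L)) (lhead L == 0%R) (0 < lcount L) = (s', a', mo).
  by rewrite /s' /a' /mo; case: ltrans => [[]].
clear outE below above inz; clearbody mo.
rewrite /= [cpos n Y == _]eq_sym; case: eqP => [e0|ne]; last first.
  congr pair; case: mo => /=.
  - rewrite !if_same /=.
    have -> : (lhead L == (cpos n Y + 1)%R) = ((lhead L + -1)%R == cpos n Y) by lia.
    by [].
  - by rewrite !if_same /= addr0; case: eqP.
  - have -> : (lhead L == (cpos n Y - 1)%R) = ((lhead L + 1)%R == cpos n Y) by lia.
    by rewrite !if_same /=; case: eqP.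
rewrite e0; congr pair; case: mo => /=.
- rewrite !if_same /= (_ : _ == _ = false); last by lia.
  by rewrite (_ : _ == _ = false) //; lia.
- by rewrite addr0 eqxx.
- rewrite !if_same (_ : _ == _ = false) /=; last by lia.
  by rewrite (_ : _ == _ = false) //; lia.
Qed.

Definition vsig n X Y : option lstate * option lstate :=
  if X is X'.+1 then
    ((louts n Y (zrun n X')).2.1.1,
     if Y.+1 == 2 ^ n then None else (louts n Y.+1 (zrun n X')).2.1.2)
  else (None, None).

(** The edge considered is the west one. On a column of cells of rank X it precedes the step of that
    column and shows configuration X - 1, nothing if X = 0; off the columns X is the rank of the
    last column passed, and configuration X is shown. *)
Definition hcomp_of (t : content * coords) : hcomp :=
  let: (h, v, (n, X, Y)) := t in
  if h is Some _ then
    if v then if X is X'.+1 then Some (cell_show n Y (zrun n X')) else None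
    else Some (cell_show n Y (zrun n X))
  else None.

Definition vcomp_of (t : content * coords) : vcomp :=
  let: (h, v, (n, X, Y)) := t in
  if v then
    if h is Some _ then if Y is Y'.+1 then Some (vsig n X Y') else None
    else Some (vsig n X Y)
  else None.

Definition hcomp_at x y := hcomp_of (loc (x, y)).
Definition vcomp_at x y := vcomp_of (loc (x, y)).

Definition mode_at x y : cmode :=
  let: (h, v, (n, X, Y)) := loc (x, y) in
  if is_mid h then
    if v then
      if hcomp_at (x + 1)%R y == None then None
      else if X is X'.+1 then
        if (cell_show n Y (zrun n X')).2 is Some None then Some (true, 0 < lcount (zrun n X'))
        else Some (false, true)
      else Some (false, false)
    else Some (false, true)
  else None.

Lemma hcomp_east x y : (loc (x, y)).1.1 <> hoff ->
  hcomp_at (x + 1)%R y = Some (cell_show (loc (x, y)).2.1.1 (loc (x, y)).2.2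
    (zrun (loc (x, y)).2.1.1 (loc (x, y)).2.1.2)) \/
  hcomp_at (x + 1)%R y = None /\ (loc (x, y)).1.2.
Proof.
rewrite /hcomp_at => hn; case: (adjacent_east x y) => [[_]|].
  move: hn; case: (loc (x, y)) => [[h v] [[n X] Y]].
  case: (loc (x + 1, y)%R) => [[h' v'] [[n' X'] Y']] /= hn -> -> -> ->; left.
  by case: h hn => // h _; case: v'; rewrite ?addn1 ?addn0.
move=> [[//|[v _]] c]; right; split=> //.
by move: c; case: (loc (x + 1, y)%R) => [[h' v'] [[n' X'] Y']] /= [->|[-> ->]] //; case: h'.
Qed.

Lemma hcomp_east_off x y : (loc (x, y)).1.1 = hoff -> hcomp_at (x + 1)%R y = None.
Proof.
rewrite /hcomp_at => h0; case: (adjacent_east x y) => [[]|[_]]; first by rewrite h0.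
by case: (loc (x + 1, y)%R) => [[h' v'] [[n' X'] Y']] /= [->|[-> ->]] //; case: h'.
Qed.

Lemma vcomp_north x y : (loc (x, y)).1.2 ->
  vcomp_at x (y + 1)%R = Some (vsig (loc (x, y)).2.1.1 (loc (x, y)).2.1.2 (loc (x, y)).2.2) \/
  [/\ vcomp_at x (y + 1)%R = None, (loc (x, y)).1.1 <> hoff &
    (loc (x, y)).2.2.+1 = 2 ^ (loc (x, y)).2.1.1].
Proof.
rewrite /vcomp_at => vt; case: (adjacent_north x y) => [[_]|].
  case: (loc (x, y)) vt => [[h v] [[n X] Y]] /= _.
  case: (loc (x, y + 1)%R) => [[h' v'] [[n' X'] Y']] /= -> -> -> ->; left.
  by case: h' => [h'|] /=; rewrite ?addn1 ?addn0.
move=> [[v0|[hn e]] c]; first by rewrite v0 in vt.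
right; split=> //.
by move: c; case: (loc (x, y + 1)%R) => [[h' v'] [[n' X'] Y']] /= [->|[+ ->]] //;
  case: v' => //; case: h'.
Qed.

Lemma vcomp_north_off x y : (loc (x, y)).1.2 = false -> vcomp_at x (y + 1)%R = None.
Proof.
rewrite /vcomp_at => v0; case: (adjacent_north x y) => [[]|[_]]; first by rewrite v0.
by case: (loc (x, y + 1)%R) => [[h' v'] [[n' X'] Y']] /= [->|[+ ->]] //;
  case: v' => //; case: h'.
Qed.

Lemma comp_holds x y : comp_rule (loc (x, y)).1 (hcomp_at x y) (hcomp_at (x + 1)%R y)
  (vcomp_at x y) (vcomp_at x (y + 1)%R) (mode_at x y).
Proof.
have := @hcomp_east x y; have := @hcomp_east_off x y.
have := @vcomp_north x y; have := @vcomp_north_off x y.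
have mr := @mid_rank (x, y).
rewrite [hcomp_at x y]/hcomp_at [vcomp_at x y]/vcomp_at /mode_at.
move: mr; case: (loc (x, y)) => [[[h|] []] [[n X] Y]] /= mr.
- move=> _ /(_ isT) nE _ /(_ (fun q => ltac:(discriminate q))) eE.
  have [lY midE] := mr (fun q => ltac:(discriminate q)).
  have homeE : is_mid (Some h) = (cpos n Y == 0%R) by rewrite [LHS]midE /cpos; lia.
  have {}nE : vcomp_at x (y + 1)%R = Some (vsig n X Y) \/
      vcomp_at x (y + 1)%R = None /\ Y.+1 = 2 ^ n.
    by case: nE => [|[]]; [left | right].
  have {}eE : hcomp_at (x + 1)%R y = Some (cell_show n Y (zrun n X)) \/ hcomp_at (x + 1)%R y = None.
    by case: eE => [|[]]; [left | right].
  case: X nE eE => [|X] nE eE; rewrite /cell_rule.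
    exists false; split=> //.
    + by case: Y {lY midE homeE nE eE mr}.
    + by case: nE => [->|[-> _]].
    + case: eE => [->|->] //.
      by rewrite /cell_show /= homeE [0%R == _]eq_sym.
    + by case: is_mid => //=; case: eqP.
  exists (0 < lcount (zrun n X)); rewrite homeE -/(louts n Y (zrun n X)).
  case O: (louts n Y (zrun n X)) => [a' [[up down] stay]]; split.
  + by case: Y lY {nE eE homeE midE mr} O => [|Y] lY O //; rewrite /vsig O ltn_eqF.
  + by case: nE => [->|[-> _]] //; rewrite /vsig O.
  + case: eE => [->|->] //.
    rewrite /zrun iterS -/(zrun n X) cell_next // O /=; congr (_, omerge _ (omerge _ _)).
      by case: Y {nE homeE midE mr lY} O.
    by case: nE => [->|[-> ->]]; rewrite ?eqxx.
  + rewrite /cell_show; case: eqP => // _.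
    by have [k ->] := zrun_prefix n X; apply: noaccept.
  + by rewrite -homeE; case: is_mid => //=; case: eqP.
- move=> vN _ _ hE; rewrite vN //.
  by case: hE => [//|->|[]].
- move=> _ /(_ isT) [-> hE _|[_ []]] //; rewrite hE //.
- by move=> vN _ hE _; rewrite vN // hE.
Qed.

Lemma plane_holds x y : plane_rule (M := M) (hedge_at x y, hcomp_at x y)
  (hedge_at (x + 1)%R y, hcomp_at (x + 1)%R y) (vedge_at x y, vcomp_at x y)
  (vedge_at x (y + 1)%R, vcomp_at x (y + 1)%R) (mode_at x y).
Proof.
exists (block x y), (role x y); split; first exact: skeleton_exists.
have -> : csub (block x y) (mv (hedge_at x y), mv (vedge_at x y)) = (loc (x, y)).1.
  by rewrite loc_kind kindE.
exact: comp_holds.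
Qed.

(** Where no run uses the counter, N is a default value: no mode constrains it, but it has to fit in
    a stack of N letters. *)
Definition count_of (t : content * coords) : nat :=
  let: (h, v, (n, X, Y)) := t in
  if is_mid h then
    if v then if X is X'.+1 then lcount (zrun n X') else N else lcount (zrun n X)
  else N.

Definition primed_of (t : content * coords) : bool :=
  let: (h, v, (n, X, Y)) := t in is_mid h && ~~ (v && (X == 0)).

Definition count_at x y := count_of (loc (x, y)).
Definition primed_at x y := primed_of (loc (x, y)).

Lemma count_le x y : count_at x y <= N.
Proof.
rewrite /count_at /count_of; case: (loc (x, y)) => [[h v] [[n X] Y]].
by case: is_mid => //; case: v; [case: X => // X | ]; apply: zrun_count.
Qed.

Lemma cut_hcomp x y : hcut (loc (x, y)) (loc (x + 1, y)%R) -> hcomp_at (x + 1)%R y = None.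
Proof.
rewrite /hcomp_at => -[_].
by case: (loc (x + 1, y)%R) => [[h' v'] [[n' X'] Y']] /= [->|[-> ->]] //; case: h'.
Qed.

Lemma zrun_countS n X Y : Y < 2 ^ n -> cpos n Y = 0%R ->
  lcount (zrun n X.+1) = if (cell_show n Y (zrun n X)).2 is Some None
    then (lcount (zrun n X)).-1 else lcount (zrun n X).
Proof.
move=> lY c0; rewrite /zrun iterS -/(zrun n X) /zstep /cell_show /= c0.
have lE L : lcount (lstep L) =
    if (lst L == None) && (lhead L == 0%R) then (lcount L).-1 else lcount L.
  by rewrite /lstep; case: ltrans => [[]].
case: eqP => h0.
  rewrite h0 add0r ifT; last by move: c0; rewrite /cpos; lia.
  by rewrite lE h0 eqxx andbT; case: (lst _) => [[[?|]|]|].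
case: ifP => // _; rewrite lE.
by case: (lhead _ =P 0%R) h0; rewrite ?andbF.
Qed.

Lemma mode_holds x y :
  match mode_at x y with
  | None => True
  | Some (false, false) => [/\ primed_at x y = false, primed_at (x + 1)%R y = true,
      count_at x y = N & count_at (x + 1)%R y = N]
  | Some (false, true) => primed_at (x + 1)%R y = true /\
      count_at (x + 1)%R y = count_at x y
  | Some (true, b) => [/\ primed_at (x + 1)%R y = true, b = (0 < count_at x y)
      & count_at (x + 1)%R y = (count_at x y).-1]
  end.
Proof.
have cutE := @cut_hcomp x y.
have next n' X' Y' h' v' : is_mid h' -> loc (x + 1, y)%R = (h', v', (n', X', Y')) ->
    v' = false \/ 0 < X' ->
    primed_at (x + 1)%R y = true /\
    count_at (x + 1)%R y = lcount (zrun n' (if v' then X'.-1 else X')).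
  rewrite /primed_at /count_at => mh -> /=; rewrite mh.
  by case: v' => [] [] //; case: X'.
rewrite /mode_at [primed_at x y]/primed_at [count_at x y]/count_at.
move: cutE; have := adjacent_east x y; have mr := @mid_rank (x, y).
case: (loc (x, y)) mr => [[h v] [[n X] Y]] mr /= adj cutE.
case mh: (is_mid h) => //=.
have hn : h <> hoff by move=> q; move: mh; rewrite q.
have {mr} [lY midE] := mr hn; rewrite /= mh in lY midE.
have c0 : cpos n Y = 0%R by rewrite /cpos; lia.
have {adj}link : hcomp_at (x + 1)%R y <> None \/ v = false ->
    primed_at (x + 1)%R y = true /\ count_at (x + 1)%R y = lcount (zrun n X).
  case: adj => [[_]|c].
    case E: (loc (x + 1, y)%R) => [[h' v'] [[n' X'] Y']] /= hh nn _ XE _.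
    have [||-> ->] := next _ _ _ _ _ _ E; first by rewrite hh.
      by rewrite XE; case: v' {E XE}; [right; rewrite addn1 | left].
    by rewrite nn XE; case: v' {E XE}; rewrite ?addn1 ?addn0.
  by case=> [/(_ (cutE c))|v0] //; case: c => -[//|[]]; rewrite v0.
case: v link {cutE} => link; last by apply: link; right.
case: eqP => // /(fun p => link (or_introl p)) [pE cE].
case: X cE {link} => [|X] cE; first by split.
rewrite (zrun_countS _ lY c0) in cE.
move: cE; rewrite /cell_show /=; case: ifP => _; first case: (lst _) => [?|] cE //.
by [].
Qed.

Notation scol := (hcol (stack_wang M)).

(** Here all stacks have height N, whence the vertical period N + 3: a row of the computing plane, a
    bottom, N letters and a top. *)
Definition hplane (x y : int) : scol :=
  let t := divz y (Posz (N + 3)) in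
  match absz (modz y (Posz (N + 3))) with
  | 0 => inl (hedge_at x t, hcomp_at x t)
  | 1 => inr (inl (primed_at x t))
  | r.+2 => if r < N then inr (inr (inl (r < count_at x t))) else inr (inr (inr tt))
  end.

Definition vplane (x y : int) : vcol (stack_wang M) :=
  let t := divz y (Posz (N + 3)) in
  match absz (modz y (Posz (N + 3))) with
  | 0 => inl (vedge_at x t, vcomp_at x t)
  | 1 => inr (inl ((vedge_at x (t + 1)%R, vcomp_at x (t + 1)%R), mode_at x t))
  | r.+2 => inr (inr ((vedge_at x (t + 1)%R, vcomp_at x (t + 1)%R), mode_at x t, r < count_at x t))
  end.

Lemma row_cases (y : int) : exists t r, [/\ r < N + 3, y = (t * Posz (N + 3) + Posz r)%R,
  divz y (Posz (N + 3)) = t & absz (modz y (Posz (N + 3))) = r].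
Proof.
exists (divz y (Posz (N + 3))), (absz (modz y (Posz (N + 3)))).
have nz : (0 < Posz (N + 3))%R by lia.
have := divz_eq y (Posz (N + 3)); have := ltz_pmod y nz.
have m0 : (0 <= modz y (Posz (N + 3)))%R by apply: modz_ge0; lia.
move: (divz _ _) (modz _ _) m0 => q m m0 lm yE.
by split=> //; [lia | rewrite yE; congr (_ + _)%R; rewrite gez0_abs].
Qed.

Lemma row_of (t : int) r : r < N + 3 ->
  divz (t * Posz (N + 3) + Posz r)%R (Posz (N + 3)) = t /\
  absz (modz (t * Posz (N + 3) + Posz r)%R (Posz (N + 3))) = r.
Proof.
move=> lr; rewrite divzMDl ?modzMDl; last by lia.
by rewrite divz_small ?modz_small ?addr0 //; lia.
Qed.

Lemma row_last t : (t * Posz (N + 3) + Posz (N + 2) + 1 = (t + 1) * Posz (N + 3) + 0)%R.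
Proof. by rewrite mulrDl mul1r addr0; lia. Qed.

Lemma stack_tiling x y :
  wtile (hplane x y) (hplane (x + 1)%R y) (vplane x y) (vplane x (y + 1)%R).
Proof.
have [t [r [lr yE dE mE]]] := row_cases y.
have hE x' : hplane x' y = match r with
    | 0 => inl (hedge_at x' t, hcomp_at x' t) | 1 => inr (inl (primed_at x' t))
    | r.+2 => if r < N then inr (inr (inl (r < count_at x' t))) else inr (inr (inr tt)) end.
  by rewrite /hplane dE mE.
have vE : vplane x y = match r with
    | 0 => inl (vedge_at x t, vcomp_at x t)
    | 1 => inr (inl ((vedge_at x (t + 1)%R, vcomp_at x (t + 1)%R), mode_at x t))
    | r.+2 => inr (inr ((vedge_at x (t + 1)%R, vcomp_at x (t + 1)%R), mode_at x t, r < count_at x t)) end.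
  by rewrite /vplane dE mE.
have vN : vplane x (y + 1)%R = match r with
    | 0 => inr (inl ((vedge_at x (t + 1)%R, vcomp_at x (t + 1)%R), mode_at x t))
    | r'.+1 => if r'.+1 < N + 2 then
        inr (inr ((vedge_at x (t + 1)%R, vcomp_at x (t + 1)%R), mode_at x t, r' < count_at x t))
      else inl (vedge_at x (t + 1)%R, vcomp_at x (t + 1)%R) end.
  rewrite /vplane yE; case: (ltnP r (N + 2)) => lr2.
    have -> : (t * Posz (N + 3) + Posz r + 1 = t * Posz (N + 3) + Posz r.+1)%R by lia.
    have [-> ->] := @row_of t r.+1 (ltac:(lia)).
    by case: r {lr yE mE hE vE} lr2 => // r -> .
  have -> : r = N + 2 by lia.
  rewrite row_last; have [-> ->] := @row_of (t + 1)%R 0 (ltac:(lia)).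
  by rewrite addn2 ltnn.
have mh := mode_holds x t; have cl := count_le x t.
rewrite !hE vE vN; case: r lr {yE mE hE vE vN} => [|[|r]] lr.
- by apply: Plane; apply: plane_holds.
- rewrite (_ : (1 < N + 2) = true); last by lia.
  apply: Bottom; move: mh; rewrite /bottom_rule.
  by case: (mode_at x t) => [[[] b]|] //; [case | case: b => [[]|[]]].
have [rN|rN] := ltnP r N; last first.
  have -> : r = N by lia.
  by rewrite addn2 ltnn ltnNge cl; apply: Top.
rewrite (_ : (r.+2 < N + 2) = true); last by lia.
apply: Letter.
  by move=> /negbT; rewrite -leqNgt => l; apply/negbTE; rewrite -leqNgt; apply: leq_trans l _.
move: mh; rewrite /letter_rule; case: (mode_at x t) => [[[] b]|] //.
  by case=> _ _ ->; case: (count_at x t) => [|c] /=; rewrite ?ltn0 // ltnS.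
by case: b => [[_ ->]|[_ _ -> ->]] //; rewrite rN.
Qed.

Lemma stack_avoids w x y : w \in stack_words M N ->
  ~ factor_at w (fun k => hplane x (y + Posz k)%R).
Proof.
have [t [r [lr yE dE mE]]] := row_cases y.
have at_ k : r + k < N + 3 -> hplane x (y + Posz k)%R = match r + k with
    | 0 => inl (hedge_at x t, hcomp_at x t) | 1 => inr (inl (primed_at x t))
    | r.+2 => if r < N then inr (inr (inl (r < count_at x t))) else inr (inr (inr tt)) end.
  move=> lk; rewrite /hplane yE -addrA -PoszD.
  by have [-> ->] := row_of t lk.
have get (w' : seq scol) k d : factor_at w' (fun k => hplane x (y + Posz k)%R) -> k < size w' ->
    nth d w' k = hplane x (y + Posz k)%R.
  by move=> f lk; rewrite [in LHS]f nth_mkseq.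
have unary a : ~ factor_at (nseq N.+1 (inr (inr (inl a)) : scol))
    (fun k => hplane x (y + Posz k)%R).
  move=> f; have g k : k < N.+1 -> hplane x (y + Posz k)%R = inr (inr (inl a)).
    by move=> lk; rewrite -(get _ k (inr (inr (inr tt))) f) ?size_nseq // nth_nseq lk.
  have := g 0 isT; rewrite at_ addn0 //; case: r lr yE mE at_ g => [|[|r]] // lr yE mE at_ g.
  case: ifP => // rN _; have := g (N - r) (ltac:(lia)); rewrite at_; last lia.
  by rewrite (_ : r.+2 + (N - r) = N.+2) ?ltnn //; lia.
rewrite mem_cat !inE => /orP[|/orP[]/eqP -> //].
case/mapP=> m; rewrite mem_iota /= add0n => lm -> f.
have b0 := get _ 0 (inr (inr (inr tt))) f isT.
have [] : r + 0 < N + 3 /\ r = 1.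
  by rewrite addn0; split=> //; move: b0; rewrite at_ addn0 //; case: r lr {yE mE at_} => [|[|r]] //= _; case: ifP.
move=> _ r1; have tp := get _ m.+1 (inr (inr (inr tt))) f.
move: tp; rewrite /= size_rcons size_nseq ltnSn => /(_ isT).
rewrite nth_rcons size_nseq ltnn eqxx at_; last by rewrite r1; lia.
by rewrite r1 add1n lm.
Qed.
End Plane.

(** * Wang tilings coded by columns *)

Lemma divz_absz (i : int) (n : nat) : 0 < n ->
  [/\ i = (divz i (Posz n) * Posz n + Posz (absz (modz i (Posz n))))%R
    & absz (modz i (Posz n)) < n].
Proof.
move=> n0; have nz : (0 < Posz n)%R by lia.
have m0 : (0 <= modz i (Posz n))%R by apply: modz_ge0; lia.
have := divz_eq i (Posz n); have := ltz_pmod i nz.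
move: (divz _ _) (modz _ _) m0 => q m m0 lm iE.
by split; [rewrite {1}iE gez0_abs | lia].
Qed.

Lemma divmod_unique (q : int) (r n : nat) : r < n ->
  divz (q * Posz n + Posz r)%R (Posz n) = q /\ absz (modz (q * Posz n + Posz r)%R (Posz n)) = r.
Proof.
move=> lr; rewrite divzMDl ?modzMDl; last by lia.
by rewrite divz_small ?modz_small ?addr0 //; lia.
Qed.

Section Blocks.
Variables (A : finType) (e : rel A) (p : nat).
Hypothesis p1 : 1 < p.
Variables (Col VCol Tile : finType) (west east : Tile -> Col) (south north : Tile -> VCol).

Notation l := (3 * p).-1.
Notation node := (node p Col Tile).
Notation node_at := (node_at p west east).
Notation tedge := (tedge (p := p) west east).

Lemma tedge_l c v : tedge (inl c) v -> exists2 t, west t = c & v = node_at t 1.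
Proof.
case/existsP=> t /existsP[k /andP[/eqP uE /eqP vE]].
have lk := ltn_ord k; have := phase_at west east t (ltnW lk).
rewrite -uE modn_small //= => k0; exists t; last by rewrite vE -k0.
by move: uE; rewrite -k0 => -[].
Qed.

Lemma tedge_r t k v : k < l -> tedge (node_at t k.+1) v -> v = node_at t k.+2.
Proof.
move=> kl /existsP[t' /existsP[k' /andP[/eqP uE /eqP vE]]].
have lk := ltn_ord k'; have := phase_at west east t' (ltnW lk).
rewrite -uE (phase_at west east t (k := k.+1)) ?(modn_small lk) ?modn_small ?ltnS ?(ltnW kl) //.
move=> kE; rewrite vE -kE; congr (node_at _ _.+1).
by move: uE; rewrite -kE (node_atE west east t (Ordinal kl)) (node_atE west east t' (Ordinal kl)) => -[].
Qed.

(** Vertical colours are compared only at the first inner node of a tile, the one that [block_phase]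
    shows to be determined by its letters. *)
Definition vadj (u u' : node) : bool :=
  (phase u == phase u') &&
  match u, u' with
  | inr (t, k), inr (t', _) => (k != 0 :> nat) || (north t == south t')
  | _, _ => true
  end.

Variable rows : seq {ffun node -> A}.
Variable row0 : {ffun node -> A}.
Notation h := (size rows).
Notation row := (nth row0 rows).
Hypothesis h0 : 0 < h.
Hypothesis rowE : forall r u v, r < h -> tedge u v -> e (row r u) (row r v).
Hypothesis row_sep : forall u v, (forall r, r < h -> e (row r u) (row r v)) -> tedge u v.
Hypothesis row_align : forall s u v v', 0 < s < h -> phase v = phase v' ->
  exists2 r, r < h & ~~ e (row r u) (row ((r + s) %% h) (if r + s < h then v else v')).

(** The length 3h guarantees two complete consecutive blocks in the window, whatever its offset. *)
Definition readable (w : seq A) : Prop :=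
  exists (us : nat -> node) (o : nat), [/\ o < h, forall j, vadj (us j) (us j.+1) &
    w = mkseq (fun i => row ((o + i) %% h) (us ((o + i) %/ h))) (3 * h)].

Definition unreadable : seq (seq A) :=
  [seq val t | t <- enum {: (3 * h).-tuple A} & ~~ `[< readable (val t) >]].

Definition code (c : Col) : seq A := [seq f (inl c) | f : {ffun node -> A} <- rows].

Definition block_at (x : int -> A) (t : int) (u : node) : Prop :=
  forall r, r < h -> x (t + Posz r)%R = row r u.

Lemma unreadableP x : (forall w, w \in unreadable -> ~ appears w x) <->
  forall y, readable (mkseq (fun k : nat => x (y + Posz k)%R) (3 * h)).
Proof.
split=> [av y|rd w /mapP[t]].
  apply: contrapT => nr; set w := mkseq _ _ in nr.
  have sw : size w == 3 * h by rewrite size_mkseq.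
  apply: (av w); last by exists y; rewrite (eqP sw).
  apply/mapP; exists (Tuple sw) => //.
  by rewrite mem_filter mem_enum andbT; apply/asboolPn.
rewrite mem_filter => /andP[/asboolPn nr _] -> [y E]; apply: nr.
by rewrite E size_tuple; apply: rd.
Qed.

Definition readable_column (x : int -> A) : Prop :=
  forall y, readable (mkseq (fun k : nat => x (y + Posz k)%R) (3 * h)).

Lemma readable_block x y : readable_column x ->
  exists (d : nat) u u', [/\ d < h, block_at x (y + Posz d)%R u,
    block_at x (y + Posz d + Posz h)%R u' & vadj u u'].
Proof.
move=> /(_ y)[us [o [oh adj E]]].
have xE i : i < 3 * h -> x (y + Posz i)%R = row ((o + i) %% h) (us ((o + i) %/ h)).
  move=> li; have := congr1 (fun s => nth (x 0%R) s i) E.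
  by rewrite !nth_mkseq.
have blk k d : o + d = k * h -> d + h <= 3 * h -> block_at x (y + Posz d)%R (us k).
  move=> od dh r rh; rewrite -addrA -PoszD xE; last by lia.
  by rewrite addnA od modnMDl divnMDl // modn_small // divn_small // addn0.
have [o0|o0] := posnP o.
  exists 0, (us 0), (us 1); split=> //; first by apply: blk; lia.
  by rewrite -addrA -PoszD; apply: blk; lia.
exists (h - o), (us 1), (us 2); split=> //; first lia.
  by apply: blk; lia.
by rewrite -addrA -PoszD; apply: blk; lia.
Qed.

Section Neighbours.
Variables x x' : int -> A.
Hypothesis xx' : forall j, e (x j) (x' j).

Lemma block_tedge t u v : block_at x t u -> block_at x' t v -> tedge u v.
Proof. by move=> bu bv; apply: row_sep => r rh; rewrite -(bu r rh) -(bv r rh). Qed.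

(** A displaced block would overlap two consecutive blocks of the neighbouring column, which have
    the same phase; [row_align] then provides a row without an edge. *)
Lemma block_align (t t' : int) u v v' : block_at x t u -> block_at x' t' v ->
  block_at x' (t' + Posz h)%R v' -> vadj v v' ->
  (t' <= t)%R -> (t < t' + Posz h)%R -> t = t'.
Proof.
move=> bu bv bv' /andP[/eqP ph _] le lt.
have [s sE] : exists s, t = (t' + Posz s)%R by exists (absz (t - t')); lia.
have [s0|s0] := posnP s; first by rewrite sE s0 addr0.
have sh : 0 < s < h by lia.
have [r rh] := row_align u sh ph; rewrite -(bu r rh).
suff -> : row ((r + s) %% h) (if r + s < h then v else v') = x' (t + Posz r)%R by rewrite xx'.
have [l1|l1] := ltnP (r + s) h.
  by rewrite modn_small // -bv // sE -addrA -PoszD addnC.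
have -> : r + s = (r + s - h) + h by rewrite subnK.
rewrite modnDr modn_small; last by lia.
rewrite -bv'; last by lia.
by rewrite sE; congr x'; lia.
Qed.

Lemma block_next t u : readable_column x' -> block_at x t u ->
  exists v v', [/\ block_at x' t v, block_at x' (t + Posz h)%R v', vadj v v' & tedge u v].
Proof.
(* The window starts h - 1 rows below [t], so that the block found covers the row [t]. *)
move=> rd bu; have [d [v [v' [dh bv bv' vv]]]] := readable_block (t - Posz h + 1)%R rd.
have tE := block_align bu bv bv' vv (ltac:(lia)) (ltac:(lia)).
rewrite -tE in bv bv'; exists v, v'; split=> //.
exact: block_tedge bu bv.
Qed.

(** The window starting just above [t] contains a block at an offset below h, and every offset other
    than h - 1 contradicts the alignment with the next column. *)
Lemma block_up t u : readable_column x -> readable_column x' -> block_at x t u ->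
  exists u', block_at x (t + Posz h)%R u'.
Proof.
move=> rd rd' bu; have [v [v' [bv bv' vv _]]] := block_next rd' bu.
have [d [w [w' [dh bw _ _]]]] := readable_block (t + 1)%R rd.
have [dE|dN] := eqVneq d.+1 h.
  by exists w; rewrite (_ : (t + Posz h = t + 1 + Posz d)%R) //; lia.
by have := block_align bw bv bv' vv (ltac:(lia)) (ltac:(lia)); lia.
Qed.

(** Letters need not determine a node. But two nodes with the same letters have a common successor
    in the template; it determines the phase, and also the tile when the node is the first inner
    one, since the successor is then still inside the tile. *)
Lemma block_phase t u u' : readable_column x' -> block_at x t u -> block_at x t u' ->
  phase u = phase u' /\ (phase u = 1 -> u = u').
Proof.
move=> rd bu bu'; have [v [_ [bv _ _ uv]]] := block_next rd bu.
have uv' := block_tedge bu' bv.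
have pE : phase u = phase u'.
  have lu := phase_lt u; have lu' := phase_lt u'.
  have := tedge_phase uv; rewrite (tedge_phase uv').
  move: (phase u) (phase u') lu lu' => m m' lm lm'.
  have red k : k < l.+1 -> k.+1 %% l.+1 = if k.+1 == l.+1 then 0 else k.+1.
    by move=> lk; case: eqP => [->|ne]; rewrite ?modnn // modn_small //; lia.
  by rewrite !red //; do 2 case: eqP; lia.
split=> // u1; move: pE u1 uv uv'.
case: u {bu} => [//|[s k]]; case: u' {bu'} => [//|[s' k']] /= kk [k0].
have l1 : 1 < l by lia.
rewrite -!(node_atE west east) -kk k0 => /(tedge_r (ltnW l1)) -> /(tedge_r (ltnW l1)).
by rewrite !(node_atE west east _ (Ordinal l1)) => -[->].
Qed.
End Neighbours.

Lemma code_flatten (c0 : Col) (w : seq Col) (f : nat -> A) :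
  flatten (map code w) = mkseq f (size (flatten (map code w))) <->
  forall k, k < size w -> forall r, r < h -> f (k * h + r) = row r (inl (nth c0 w k)).
Proof.
have sC c : size (code c) = h by rewrite size_map.
elim: w f => [|c w IH] f; first by [].
rewrite map_cons /= size_cat sC /mkseq iotaD map_cat add0n.
have -> : [seq f i | i <- iota h (size (flatten [seq code i | i <- w]))] =
    mkseq (fun i => f (h + i)) (size (flatten [seq code i | i <- w])).
  by rewrite -[h in iota h]addn0 iotaDl -map_comp.
have code_eq : code c = [seq f i | i <- iota 0 h] <-> forall r, r < h -> f r = row r (inl c).
  split=> [E r rh|E].
    have := congr1 (fun s => nth (f 0) s r) E.
    by rewrite (nth_map row0) // (nth_map 0) ?size_iota // nth_iota.
  apply: (@eq_from_nth _ (f 0)) => [|r]; rewrite ?sC ?size_map ?size_iota // => rh.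
  by rewrite (nth_map row0) // (nth_map 0) ?size_iota // nth_iota // E.
split=> [/eqP|E].
  rewrite eqseq_cat ?sC ?size_map ?size_iota // => /andP[/eqP/code_eq E1 /eqP/IH E2].
  by case=> [|k] lk r rh; [rewrite mul0n E1 | rewrite mulSn -addnA E2].
congr cat; first by apply/code_eq => r /(E 0 isT); rewrite mul0n.
by apply/IH => k lk r rh; rewrite addnA -mulSn (E k.+1).
Qed.

Section Extract.
Variable x : int * int -> A.
Hypothesis xE : forall i j, e (x (i, j)) (x (i + 1, j)%R).
Hypothesis xR : forall i, readable_column (fun j => x (i, j)).

Notation col i := (fun j => x (i, j)).

(** One block propagates to the right by [block_next] and upwards by [block_up], which gives a
    quarter of the plane. Tiles are read at their first inner node, where vertical neighbours are
    comparable. *)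
Lemma extract : exists (i0 : int) (t0 : int) (T : nat -> nat -> Tile),
  [/\ forall X Y, east (T X Y) = west (T X.+1 Y),
      forall X Y, north (T X Y) = south (T X Y.+1)
    & forall X Y, block_at (col (i0 + Posz (X * l.+1))%R) (t0 + Posz (Y * h))%R
        (inl (west (T X Y)))].
Proof.
have [d [u0 [_ [_ bu0 _ _]]]] := readable_block 0%R (xR 0%R).
set t0 := (0 + Posz d)%R in bu0.
have /choice[U UP] : forall iY : nat * nat, exists u,
    block_at (col (Posz iY.1)) (t0 + Posz (iY.2 * h))%R u.
  case=> i Y /=; elim: Y => [|Y [u bu]].
    rewrite addr0; elim: i => [|i [u bu]]; first by exists u0.
    have [v [_ [bv _ _ _]]] := block_next (xE (Posz i)) (xR _) bu.
    by exists v; rewrite -addn1 PoszD.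
  have [u' bu'] := block_up (xE (Posz i)) (xR _) (xR _) bu.
  by exists u'; rewrite mulSnr PoszD addrA.
have col_step i : col (Posz i.+1) = col (Posz i + 1)%R by rewrite -addn1 PoszD.
have UE i Y : tedge (U (i, Y)) (U (i.+1, Y)).
  apply: (block_tedge (xE (Posz i))) (UP (i, Y)) _.
  by have := UP (i.+1, Y); rewrite /= col_step.
have UV i Y : exists v v', [/\ phase (U (i.+1, Y)) = phase v, phase (U (i.+1, Y)) = 1 -> U (i.+1, Y) = v,
    phase (U (i.+1, Y.+1)) = phase v', phase (U (i.+1, Y.+1)) = 1 -> U (i.+1, Y.+1) = v'
    & vadj v v'].
  have [v [v' [bv bv' vv _]]] := block_next (xE (Posz i)) (xR _) (UP (i, Y)).
  have b1 := UP (i.+1, Y); have b2 := UP (i.+1, Y.+1).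
  rewrite /= col_step in b1 b2; rewrite mulSnr PoszD addrA in b2.
  have [e1 f1] := block_phase (xE _) (xR _) b1 bv.
  have [e2 f2] := block_phase (xE _) (xR _) b2 bv'.
  by exists v, v'; split.
have Uph i Y : phase (U (i.+1, Y)) = phase (U (i.+1, 0)).
  elim: Y => // Y <-; have [v [v' [-> _ -> _]]] := UV i Y.
  by case/andP=> /eqP ->.
(* A positive column of phase 0; positivity matters because [UV] compares blocks only from column 1
   on. *)
pose i0 := l.+1 - phase (U (0, 0)).
have lp := phase_lt (U (0, 0)).
have i00 : 0 < i0 by lia.
have ph0 i : phase (U (i, 0)) = (phase (U (0, 0)) + i) %% l.+1.
  elim: i => [|i IH]; first by rewrite addn0 modn_small.
  by rewrite (tedge_phase (UE i 0)) IH -addn1 modnDml addn1 addnS.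
have ph X Y : phase (U (i0 + X * l.+1, Y)) = 0.
  rewrite -(prednK i00) addSn Uph -addSn prednK // ph0.
  by rewrite addnA subnKC ?(ltnW lp) // -mulSn modnMl.
have /choice[T TP] : forall XY : nat * nat, exists t,
    forall k, k <= l.+1 -> U (i0 + XY.1 * l.+1 + k, XY.2) = node_at t k.
  case=> X Y /=; case E: (U (i0 + X * l.+1, Y)) (ph X Y) => [c|[]//] _.
  have := UE (i0 + X * l.+1) Y; rewrite E => /tedge_l[t tc t1].
  exists t; case=> [|k]; first by rewrite addn0 E /= tc.
  elim: k => [|k IH] lk; first by rewrite addn1.
  have := UE (i0 + X * l.+1 + k.+1) Y; rewrite IH; last by lia.
  by move/tedge_r => <- //; rewrite addnS.
exists (Posz i0), t0, (fun X Y => T (X, Y)); split=> X Y.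
- have := TP (X, Y) l.+1 (leqnn _); rewrite node_at_last.
  have := TP (X.+1, Y) 0 isT; rewrite [_.1]/= [_.2]/= addn0 mulSnr addnA => ->.
  by case.
- have [v [v' [_ v1 _ v1' /andP[_]]]] := UV (i0 + X * l.+1) Y.
  have l0 : 0 < l by lia.
  have U1 Y' : U ((i0 + X * l.+1).+1, Y') = inr (T (X, Y'), Ordinal l0).
    by rewrite -addn1 (TP (X, Y') 1) // (node_atE west east _ (Ordinal l0)).
  rewrite -v1 ?U1 // -v1' ?U1 //.
  by move/eqP.
have := UP (i0 + X * l.+1, Y); rewrite /= PoszD.
by have := TP (X, Y) 0 isT; rewrite /= addn0 => ->.
Qed.
End Extract.

Section Build.
Variable T : int -> int -> Tile.
Hypothesis Th : forall X Y, east (T X Y) = west (T (X + 1)%R Y).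
Hypothesis Tv : forall X Y, north (T X Y) = south (T X (Y + 1)%R).

Notation dx i := (divz i (Posz l.+1)).
Notation mx i := (absz (modz i (Posz l.+1))).
Notation dy i := (divz i (Posz h)).
Notation my i := (absz (modz i (Posz h))).

Definition node_of (i Y : int) : node := node_at (T (dx i) Y) (mx i).

Definition spread (ij : int * int) : A := row (my ij.2) (node_of ij.1 (dy ij.2)).

Lemma node_of_tedge i Y : tedge (node_of i Y) (node_of (i + 1)%R Y).
Proof.
have [iE im] := divz_absz i (ltn0Sn l); rewrite /node_of.
have [lt|ge] := ltnP (mx i).+1 l.+1.
  have [-> ->] : dx (i + 1)%R = dx i /\ mx (i + 1)%R = (mx i).+1.
    have iE1 : (i + 1 = dx i * Posz l.+1 + Posz (mx i).+1)%R.
      by rewrite {1}iE -addrA -PoszD addn1.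
    by rewrite iE1; apply: divmod_unique.
  exact: tedge_at.
have [-> ->] : dx (i + 1)%R = (dx i + 1)%R /\ mx (i + 1)%R = 0.
  have iE1 : (i + 1 = (dx i + 1) * Posz l.+1 + Posz 0)%R.
    by rewrite {1}iE mulrDl mul1r addr0 -addrA -PoszD addn1; congr (_ + Posz _)%R; lia.
  by rewrite iE1; apply: divmod_unique.
have := tedge_at west east (T (dx i) Y) im.
by rewrite (_ : (mx i).+1 = l.+1) ?node_at_last //= ?Th //; lia.
Qed.

Lemma phase_node_of i Y : phase (node_of i Y) = mx i.
Proof.
have [_ im] := divz_absz i (ltn0Sn l).
by rewrite /node_of phase_at ?modn_small // ltnW.
Qed.

Lemma node_of_vadj i Y : vadj (node_of i Y) (node_of i (Y + 1)%R).
Proof.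
rewrite /vadj !phase_node_of eqxx /= /node_of; have [_ im] := divz_absz i (ltn0Sn l).
case: (mx i) im => [|k] // lk; rewrite !(node_atE west east _ (Ordinal (lk : k < l))) /=.
by rewrite Tv eqxx orbT.
Qed.

Lemma spread_edge i j : e (spread (i, j)) (spread (i + 1, j)%R).
Proof.
have [_ jm] := divz_absz j h0.
by apply: rowE => //; apply: node_of_tedge.
Qed.

Lemma spread_block i Y : block_at (fun j => spread (i, j)) (Y * Posz h)%R (node_of i Y).
Proof. by move=> r rh; rewrite /spread /=; have [-> ->] := divmod_unique Y rh. Qed.

Lemma spread_readable i : readable_column (fun j => spread (i, j)).
Proof.
move=> y; have [yE ym] := divz_absz y h0.
exists (fun k => node_of i (dy y + Posz k)%R), (my y); split=> //.
  by move=> j; rewrite -addn1 PoszD addrA; apply: node_of_vadj.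
apply: eq_mkseq => k; rewrite /spread /=.
have lt : (my y + k) %% h < h by rewrite ltn_pmod.
have := divmod_unique (dy y + Posz ((my y + k) %/ h))%R lt.
rewrite (_ : (_ * Posz h + _ = y + Posz k)%R) => [[-> ->]//|].
by rewrite mulrDl -PoszM -addrA -PoszD -divn_eq PoszD addrA -yE.
Qed.

(** The colours are recovered from the next column: every template edge into the first inner node of
    a tile starts at the west colour of that tile, even if the letters of the colour are
    ambiguous. *)
Lemma spread_avoids (c0 : Col) (w : seq Col) i : w != [::] ->
  appears (flatten (map code w)) (fun j => spread (i, j)) ->
  exists X Y, factor_at w (fun k => west (T X (Y + Posz k)%R)).
Proof.
move=> w0 [t] /(code_flatten c0) bw.
have bk k : k < size w -> block_at (fun j => spread (i, j)) (t + Posz (k * h))%R (inl (nth c0 w k)).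
  by move=> lk r rh; rewrite -bw // PoszD addrA.
have sw : 0 < size w by rewrite lt0n size_eq0.
have [tE tm] := divz_absz t h0.
have b0 := bk 0 sw; rewrite mul0n addr0 in b0.
have bn := spread_block (i + 1)%R.
have al : t = (dy t * Posz h)%R.
  apply: (block_align (spread_edge i)) b0 (bn (dy t)) _ (node_of_vadj _ _) _ _.
  - by have := bn (dy t + 1)%R; rewrite mulrDl mul1r.
  - lia.
  - lia.
have te k : k < size w -> tedge (inl (nth c0 w k)) (node_of (i + 1)%R (dy t + Posz k)%R).
  move=> /bk b; have b' := bn (dy t + Posz k)%R.
  rewrite mulrDl -PoszM -al in b'.
  exact (block_tedge (x := fun j => spread (i, j)) (x' := fun j => spread (i + 1, j)%R)
    (spread_edge i) b b').
have m1 : mx (i + 1)%R = 1.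
  rewrite -(phase_node_of _ (dy t + Posz 0)%R) (tedge_phase (te 0 sw)) /= modn_small //.
  by rewrite ltnS; lia.
exists (dx (i + 1)%R), (dy t).
apply: (@eq_from_nth _ c0) => [|k lk]; first by rewrite size_mkseq.
rewrite nth_mkseq //; have := te k lk; rewrite /node_of m1 => /tedge_l[s <-].
have l0 : 0 < l by lia.
by rewrite !(node_atE west east _ (Ordinal l0)) => -[->].
Qed.
End Build.
End Blocks.

(** * The Rauzy graph, and the coding of tile sets when condition D fails *)

Section Rauzy.
Variables (A : finType) (H : set (int -> A)).

Notation G := (rauzy H).

Definition redge : rel A := fun a b => `[< edge G a b >].

Lemma redgeE a b : edge G a b <-> redge a b.
Proof. by split=> /asboolP. Qed.

Lemma clos_rt_connect v w : clos_refl_trans A (edge G) v w <-> connect redge v w.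
Proof.
split=> [|vw].
  elim=> [a b /redgeE|a|a b c _ ab _]; [exact: connect1 | exact: connect0 | exact: connect_trans ab].
case/connectP: vw => q; elim: q v => [|c q IH] v /=; first by move=> _ ->; apply: rt_refl.
by case/andP=> /redgeE vc /IH cw /cw; apply: rt_trans; apply: rt_step.
Qed.

Lemma clos_t_connect v w : clos_trans A (edge G) v w <->
  exists2 u, redge v u & connect redge u w.
Proof.
split=> [|[u /redgeE vu]].
  elim=> [a b /redgeE ab|a b c _ [u au ub] _ [u' bu uc]]; first by exists b.
  by exists u => //; apply: connect_trans ub _; apply: connect_trans (connect1 bu) uc.
move=> /connectP[q]; elim: q v u vu => [|c q IH] v u vu /=; first by move=> _ ->; apply: t_step.
by case/andP=> /redgeE uc /(IH _ _ uc) cw /cw; apply: t_trans; apply: t_step.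
Qed.

Lemma redge_vertex a b : redge a b -> vertex G a /\ vertex G b.
Proof.
case/asboolP=> x Hx [i]; rewrite /= /mkseq /= => -[aE bE].
by split; exists x => //; [exists i; rewrite aE | exists (i + 1)%R; rewrite bE /= /mkseq /= addr0].
Qed.

Lemma connect_vertex a b : vertex G a -> connect redge a b -> vertex G b.
Proof.
move=> va /connectP[q]; elim: q a va => [|c q IH] a va /=; first by move=> _ ->.
by case/andP=> /redge_vertex[_ /IH cw] /cw; apply.
Qed.

Lemma class_scc v : vertex G v -> (exists2 u, redge v u & connect redge u v) ->
  scc G [set w | connect redge v w /\ connect redge w v].
Proof.
move=> Vv [u vu uv]; split.
- by exists v; split; apply: connect0.
- split=> [w [vw _]|w w' [vw wv] [vw' wv']]; first exact: connect_vertex vw.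
  by apply/clos_rt_connect; apply: connect_trans wv vw'.
- move=> S' [_ mr] sub w Sw; have Sv : S' v by apply: sub; split; apply: connect0.
  by split; apply/clos_rt_connect; apply: mr.
move=> w [vw wv]; apply; apply/clos_t_connect.
case/connectP: wv => [] [|c q] /= wq; last first.
  move=> vE; case/andP: wq => wc cq; exists c => //.
  by apply: connect_trans vw; apply/connectP; exists q.
by move=> vE; rewrite -vE; exists u.
Qed.

Lemma scc_component S : scc G S -> component redge S.
Proof.
case=> [[v Sv] [SV mr] smax nt].
have succ x : S x -> exists2 u, redge x u & connect redge u x.
  by move=> /nt /contrapT /clos_t_connect.
have cls x y : S x -> connect redge x y -> connect redge y x -> S y.
  move=> Sx xy yx; have [_ mr' _ _] := class_scc (SV _ Sx) (succ x Sx).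
  by apply: (smax _ mr') => // z Sz; split; apply/clos_rt_connect; apply: mr.
split=> [|x y Sx Sy||x Sx]; first by exists v.
- by apply/clos_rt_connect; apply: mr.
- exact: cls.
have [u xu ux] := succ x Sx; exists u => //.
by apply: cls ux => //; apply: connect1.
Qed.

Hypothesis hH : nearest_neighbor H.

(** A forbidden word of length 2 met along a walk would be an edge, hence would occur in some
    configuration of H. *)
Lemma rauzyP x : H x <-> forall i, redge (x i) (x (i + 1)%R).
Proof.
have [F F2 HE] := hH; split=> [Hx i|ex].
  by apply/asboolP; exists x => //; exists i; rewrite /mkseq /= addr0.
rewrite HE => w wF [i]; rewrite (F2 w wF) /mkseq /= addr0 => wE.
have /asboolP[y] := ex i; rewrite {1}HE => /(_ w wF) ny yx; apply: ny.
by rewrite wE.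
Qed.
End Rauzy.

Local Open Scope classical_set_scope.

Lemma not_condition_D (A : finType) (H : set (int -> A)) : ~ condition_D (rauzy H) ->
  [/\ exists S v, [/\ component (redge H) S, S v & ~~ redge H v v],
      exists S v w, [/\ component (redge H) S, S v, S w, redge H v w & ~~ redge H w v]
    & exists2 S, component (redge H) S & ~ state_split_cycle_type (rauzy H) S].
Proof.
move=> nD; split; apply: contrapT => no; apply: nD.
- apply: Or31 => S sS v Sv; apply/redgeE; apply: contrapT => /negP n; apply: no.
  by exists S, v; split=> //; apply: scc_component.
- apply: Or32 => S sS v w Sv Sw _ /redgeE vw; apply/redgeE; apply: contrapT => /negP n; apply: no.
  by exists S, v, w; split=> //; apply: scc_component.
- apply: Or33 => S sS; apply: contrapT => n; apply: no.
  by exists S => //; apply: scc_component.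
Qed.

(** [F0] and [code] are chosen before [Phi]. The instance can therefore be changed by its extra
    words alone, with a code already known to the machine. A quarter tiling is enough in one
    direction because it contains all the zones needed. *)
Theorem wang_coding (A : finType) (H : set (int -> A)) (hH : nearest_neighbor H)
  (nD : ~ condition_D (rauzy H)) (W : wang) :
  exists (F0 : seq (seq A)) (code : hcol W -> seq A), forall Phi : seq (seq (hcol W)),
    [::] \notin Phi ->
    (combined H (sft (F0 ++ [seq flatten (map code w) | w <- Phi])) !=set0 ->
     exists h v, quarter_tiling h v /\ quarter_avoids (W := W) h Phi) /\
    (forall (hh : int -> int -> hcol W) (vv : int -> int -> vcol W),
     (forall x y, wtile (hh x y) (hh (x + 1)%R y) (vv x y) (vv x (y + 1)%R)) ->
     (forall w x y, w \in Phi -> ~ factor_at w (fun k => hh x (y + Posz k)%R)) ->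
     combined H (sft (F0 ++ [seq flatten (map code w) | w <- Phi])) !=set0).
Proof.
have [[Sr [vr [cr Svr nvr]]] [Ss [vs [ws [cs Svs Sws vws nvws]]]] [Sc cc nsc]] := not_condition_D nD.
pose e := redge H; have eE := redgeE H.
have [p p1 walk_pp] := walk_idem e.
have irr : exists2 v, Sr v & ~~ e v v by exists vr.
have asym : exists v w, [/\ Ss v, Ss w, e v w & ~~ e w v] by exists vs, ws.
pose Tile := {t : hcol W * hcol W * vcol W * vcol W | `[< wtile t.1.1.1 t.1.1.2 t.1.2 t.2 >]}.
pose west (t : Tile) := (val t).1.1.1; pose east (t : Tile) := (val t).1.1.2.
pose south (t : Tile) := (val t).1.2; pose north (t : Tile) := (val t).2.
pose node := node p (hcol W) Tile.
pose tedge := tedge (p := p) west east.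
pose homs := [seq f : {ffun node -> A} <- enum {: {ffun node -> A}} | `[< hom e west east f >]].
(* Displacement 0: there is no loop at [h 0]. A shift is excluded by a row where both nodes are sent
   to [h 0]. *)
have [h [hm he nh]] := closed_walk_avoiding eE p1 walk_pp cr cs cc irr asym nsc (d := 0) isT isT.
pose marker a : {ffun node -> A} := [ffun u => h (phase u + a)].
have [rows [homsR rowsR R0 align]] := aligning_rows homs marker (ltn0Sn (3 * p).-1).
have [row0 _] : exists f : {ffun node -> A}, f \in rows.
  by case: rows R0 {homsR rowsR align} => // f ? _; exists f; rewrite mem_head.
have hom_row r u v : r < size rows -> tedge u v -> e (nth row0 rows r u) (nth row0 rows r v).
  move=> /(mem_nth row0) /rowsR[+|[a ->]] => [|uv].
    by rewrite mem_filter => /andP[/asboolP fh _]; apply: fh.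
  by rewrite !ffunE; apply: (hom_closed a hm he uv).
have sep u v : (forall r, r < size rows -> e (nth row0 rows r u) (nth row0 rows r v)) -> tedge u v.
  move=> al; apply: contraT => /(hom_sep eE p1 walk_pp cr cs cc irr asym nsc)[f fh nf].
  have : finfun f \in rows.
    apply: homsR; rewrite mem_filter mem_enum andbT; apply/asboolP => w w' ww'.
    by rewrite !ffunE; apply: fh.
  case/(nthP row0)=> r rh rE; have := al r rh.
  by rewrite rE !ffunE => ef; case/negP: nf.
have mis s u v v' : 0 < s < size rows -> phase v = phase v' -> exists2 r, r < size rows &
    ~~ e (nth row0 rows r u) (nth row0 rows ((r + s) %% size rows) (if r + s < size rows then v else v')).
  move=> sh pvv; have lu := phase_lt u; have lv := phase_lt v.
  have md k : k %% (3 * p).-1.+1 < (3 * p).-1.+1 by rewrite ltn_pmod.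
  have [r rh [ra rb]] := align row0 s _ _ sh (md ((3 * p).-1.+1 - phase u)) (md ((3 * p).-1.+1 - phase v)).
  exists r => //; rewrite ra rb.
  have mk w : marker (((3 * p).-1.+1 - phase w) %% (3 * p).-1.+1) w = h 0.
    by rewrite ffunE -hm modnDmr subnKC ?modnn ?mod0n // ltnW // phase_lt.
  case: ifP => _; first by rewrite !mk.
  by rewrite pvv !mk.
exists (unreadable south north rows row0), (code rows) => Phi nPhi.
split.
  case=> x Hx.
  have xE i j : e (x (i, j)) (x (i + 1, j)%R).
    by have [/(rauzyP hH)/(_ i)] := Hx i j.
  have xR i : readable_column south north rows row0 (fun j => x (i, j)).
    apply/unreadableP => w wF; have [_ /(_ w)] := Hx i 0%R; apply.
    by rewrite mem_cat wF.
  have [i0 [t0 [T [Th Tv Tb]]]] := extract p1 R0 sep mis xE xR.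
  exists (fun X Y => west (T X Y)), (fun X Y => south (T X Y)); split=> [X Y|w X Y wP fw].
    by rewrite -Th -Tv; have /asboolP := valP (T X Y).
  have [_ /(_ (flatten (map (code rows) w)))] := Hx (i0 + Posz (X * (3 * p).-1.+1))%R 0%R.
  apply; first by rewrite mem_cat; apply/orP; right; apply/mapP; exists w.
  case: w fw wP => [_|c w fw wP]; first by rewrite (negbTE nPhi).
  exists (t0 + Posz (Y * size rows))%R; apply: (proj2 (code_flatten rows row0 c (c :: w) _)) => k lk r rh.
  have -> : nth c (c :: w) k = west (T X (Y + k)) by rewrite fw nth_mkseq.
  by rewrite -(Tb X (Y + k) r rh) mulnDl !PoszD !addrA.
move=> hh vv tile avoid.
pose T X Y : Tile := exist _ (hh X Y, hh (X + 1)%R Y, vv X Y, vv X (Y + 1)%R) (asboolT (tile X Y)).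
have Th X Y : east (T X Y) = west (T (X + 1)%R Y) by [].
have Tv X Y : north (T X Y) = south (T X (Y + 1)%R) by [].
exists (spread west east rows row0 T) => i j; split.
  apply/(rauzyP hH) => k; exact: (spread_edge p1 R0 hom_row Th).
move=> w; rewrite mem_cat => /orP[wF|/mapP[w' w'P ->] ap].
  have /unreadableP/(_ w wF) := spread_readable west east (rows := rows) row0 R0 Tv i; exact.
have w0 : w' != [::] by apply: contra nPhi => /eqP <-.
have [c0 _] : exists c, c \in w' by case: w' w0 {w'P ap} => // c ? _; exists c; rewrite mem_head.
have [X [Y fw]] := spread_avoids p1 R0 hom_row sep mis Th Tv c0 w0 ap.
exact: avoid w'P fw.
Qed.

(** * Loop programs on Turing machines *)

Section LoopPrograms.
Variable S : finType.

(** A loop runs over a word fixed when it starts, so every program terminates and [run] is a plain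
    recursive function; tests only see the first letter of a register. *)
Inductive prog :=
| Skip
| Push of nat & S
| Clear of nat
| Seq of prog & prog
| Case of nat & (option S -> prog)
| Foreach of nat & (S -> prog).

Definition regs := nat -> seq S.

Definition setr (T : Type) (f : nat -> T) (r : nat) (x : T) : nat -> T :=
  fun r' => if r' == r then x else f r'.

Fixpoint run (p : prog) (f : regs) : regs :=
  match p with
  | Skip => f
  | Push r a => setr f r (rcons (f r) a)
  | Clear r => setr f r [::]
  | Seq p q => run q (run p f)
  | Case r b => run (b (ohead (f r))) f
  | Foreach r b => foldl (fun g a => run (b a) g) f (f r)
  end.

Fixpoint keeps (r : nat) (p : prog) : Prop :=
  match p with
  | Skip => True
  | Push r' _ | Clear r' => r <> r'
  | Seq p q => keeps r p /\ keeps r q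
  | Case _ b => forall x, keeps r (b x)
  | Foreach r' b => r <> r' /\ forall a, keeps r (b a)
  end.

Lemma keeps_run r p f : keeps r p -> run p f r = f r.
Proof.
elim: p f => //= [r' a|r'|p IHp q IHq|r' b IH|r' b IH] f.
- by move=> ne; rewrite /setr; case: eqP.
- by move=> ne; rewrite /setr; case: eqP.
- by move=> [kp kq]; rewrite IHq // IHp.
- by move=> kb; rewrite IH.
- by move=> [_ kb]; elim: (f r') {1 3}f => //= a s IHs g; rewrite IHs IH.
Qed.

(* A loop may not change the register it runs over: on the tape the current
   letter is remembered by a pointer. *)
Fixpoint wf (k : nat) (p : prog) : Prop :=
  match p with
  | Skip => True
  | Push r _ | Clear r => r < k
  | Seq p q => wf k p /\ wf k q
  | Case r b => r < k /\ forall x, wf k (b x)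
  | Foreach r b => r < k /\ forall a, keeps r (b a) /\ wf k (b a)
  end.

Variable k : nat.

(* A cell carries one letter per register, one pointer per register, and a mark
   for the origin. *)
Definition wcell : finType :=
  ({ffun 'I_k -> option S} * {ffun 'I_k -> bool} * bool)%type.

Definition wblank : wcell := ([ffun=> None], [ffun=> false], false).

Definition get_letter (w : wcell) (r : nat) : option S :=
  if insub r is Some i then w.1.1 i else None.
Definition get_pointer (w : wcell) (r : nat) : bool :=
  if insub r is Some i then w.1.2 i else false.
Definition is_home (w : wcell) : bool := w.2.
Definition set_letter (w : wcell) (r : nat) (x : option S) : wcell :=
  ([ffun i => if val i == r then x else w.1.1 i], w.1.2, w.2).
Definition set_pointer (w : wcell) (r : nat) (b : bool) : wcell :=
  (w.1.1, [ffun i => if val i == r then b else w.1.2 i], w.2).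

Definition layout (f : regs) (m : nat -> option nat) : int -> wcell :=
  fun z => if z is Posz n then
    ([ffun i : 'I_k => onth (f i) n], [ffun i : 'I_k => m i == Some n], n == 0)
  else wblank.

Definition write (t : int -> wcell) (z : int) (w : wcell) : int -> wcell :=
  fun z' => if z' == z then w else t z'.

Lemma write_id t z : write t z (t z) = t.
Proof. by apply: funext => z'; rewrite /write; case: eqP => // ->. Qed.

Lemma layout_letter f m n r : r < k -> get_letter (layout f m (Posz n)) r = onth (f r) n.
Proof. by move=> rk; rewrite /get_letter insubT /= ffunE. Qed.

Lemma layout_pointer f m n r : r < k -> get_pointer (layout f m (Posz n)) r = (m r == Some n).
Proof. by move=> rk; rewrite /get_pointer insubT /= ffunE. Qed.

Lemma layout_push f m r a :
  write (layout f m) (Posz (size (f r))) (set_letter (layout f m (Posz (size (f r)))) r (Some a))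
    = layout (setr f r (rcons (f r) a)) m.
Proof.
apply: funext => z; rewrite /write; case: eqP => [->|ne] /=.
  congr (_, _, _); apply/ffunP => i; rewrite !ffunE /setr; case: eqP => // _.
  by rewrite !onthE map_rcons nth_rcons size_map ltnn eqxx.
case: z ne => //= n ne; congr (_, _, _); apply/ffunP => i; rewrite !ffunE /setr.
case: eqP => // ->; rewrite !onthE map_rcons nth_rcons size_map.
case: ltngtP => // [lt|eq]; first by rewrite nth_default // size_map ltnW.
by case: ne; rewrite eq.
Qed.

Lemma layout_take f m r n : size (f r) <= n.+1 ->
  write (layout f m) (Posz n) (set_letter (layout f m (Posz n)) r None)
    = layout (setr f r (take n (f r))) m.
Proof.
move=> sf; apply: funext => z; rewrite /write; case: eqP => [->|ne] /=.
  congr (_, _, _); apply/ffunP => i; rewrite !ffunE /setr; case: eqP => // _.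
  by rewrite onthE nth_default // size_map size_take; case: ltnP.
case: z ne => //= n' ne; congr (_, _, _); apply/ffunP => i; rewrite !ffunE /setr.
case: eqP => // ->; rewrite !onthE map_take.
case: (ltngtP n' n) => [lt|gt|eq]; first by rewrite nth_take.
  by rewrite !nth_default // ?size_take size_map; [case: ltnP; lia | lia].
by case: ne; rewrite eq.
Qed.

Lemma layout_point f m r n : m r = None ->
  write (layout f m) (Posz n) (set_pointer (layout f m (Posz n)) r true)
    = layout f (setr m r (Some n)).
Proof.
move=> mr; apply: funext => z; rewrite /write; case: eqP => [->|ne] /=.
  congr (_, _, _); apply/ffunP => i; rewrite !ffunE /setr; case: eqP => // _.
  by rewrite eqxx.
case: z ne => //= n' ne; congr (_, _, _); apply/ffunP => i; rewrite !ffunE /setr.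
case: (val i =P r) => // ->; rewrite mr; apply/esym/negbTE; apply/eqP => -[] eq.
by case: ne; rewrite eq.
Qed.

Lemma layout_unpoint f m r n : m r = Some n ->
  write (layout f m) (Posz n) (set_pointer (layout f m (Posz n)) r false)
    = layout f (setr m r None).
Proof.
move=> mr; apply: funext => z; rewrite /write; case: eqP => [->|ne] /=.
  by congr (_, _, _); apply/ffunP => i; rewrite !ffunE /setr; case: eqP.
case: z ne => //= n' ne; congr (_, _, _); apply/ffunP => i; rewrite !ffunE /setr.
case: (val i =P r) => // ->; rewrite mr; apply/negbTE; apply/eqP => -[] eq.
by case: ne; rewrite eq.
Qed.

Record machine := Machine {
  mstate : finType;
  mstart : mstate;
  mdelta : mstate -> wcell -> option mstate * wcell * move }.

(** Big steps up to an exit, an exit being a transition without next state; this is what lets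
    machines be chained. *)
Inductive reaches (M : machine) : mstate M -> (int -> wcell) -> int ->
    (int -> wcell) -> int -> Prop :=
| Exits q t z w m : mdelta q (t z) = (None, w, m) ->
    reaches q t z (write t z w) (z + displacement m)%R
| Goes q t z q' w m t' z' : mdelta q (t z) = (Some q', w, m) ->
    reaches q' (write t z w) (z + displacement m)%R t' z' -> reaches q t z t' z'.

Lemma goes_stay M (q q' : mstate M) t z t' z' :
  mdelta q (t z) = (Some q', t z, Stay) -> reaches q' t z t' z' -> reaches q t z t' z'.
Proof. by move=> d r; apply: Goes d _; rewrite write_id addr0. Qed.

Lemma goes_right M (q q' : mstate M) t n t' z' : mdelta q (t (Posz n)) = (Some q', t (Posz n), MoveRight) ->
  reaches q' t (Posz n.+1) t' z' -> reaches q t (Posz n) t' z'.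
Proof.
move=> d r; apply: Goes d _; rewrite write_id.
by rewrite (_ : (Posz n + displacement MoveRight)%R = Posz n.+1) //=; lia.
Qed.

Lemma exits_stay M (q : mstate M) t z :
  mdelta q (t z) = (None, t z, Stay) -> reaches q t z t z.
Proof. by move=> d; have := Exits d; rewrite write_id addr0. Qed.

Lemma goes_home M (q : mstate M) f m n t' z' :
  (forall w, ~~ is_home w -> mdelta q w = (Some q, w, MoveLeft)) ->
  reaches q (layout f m) 0%R t' z' -> reaches q (layout f m) (Posz n) t' z'.
Proof.
move=> d r; elim: n => // n IH; apply: (Goes (d (layout f m (Posz n.+1)) isT)).
by rewrite write_id; rewrite (_ : (Posz n.+1 + displacement MoveLeft)%R = Posz n) //=; lia.
Qed.

Definition stop_machine : machine := @Machine unit tt (fun _ w => (None, w, Stay)).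

(* Walk to the end of register [r], write there if [x] is given, and come back,
   erasing the register on the way if it is not. *)
Definition write_machine (r : nat) (x : option S) : machine :=
  @Machine bool true (fun q w =>
    if q then
      if get_letter w r is Some _ then (Some true, w, MoveRight)
      else (Some false, if x is Some _ then set_letter w r x else w, Stay)
    else
      let w' := if x is Some _ then w else set_letter w r None in
      if is_home w then (None, w', Stay) else (Some false, w', MoveLeft)).

Definition seq_machine (M N : machine) : machine :=
  @Machine (mstate M + mstate N)%type (inl (mstart M)) (fun q w =>
    match q with
    | inl q => let: (o, w', m) := mdelta q w in
        (Some (if o is Some q' then inl q' else inr (mstart N)), w', m)
    | inr q => let: (o, w', m) := mdelta q w in (omap inr o, w', m)
    end).

Definition case_machine (r : nat) (M : option S -> machine) : machine :=
  @Machine (option {x : option S & mstate (M x)}) None (fun q w =>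
    match q with
    | None => let x := get_letter w r in
        (Some (Some (Tagged (fun x => mstate (M x)) (mstart (M x)))), w, Stay)
    | Some (existT x q) => let: (o, w', m) := mdelta q w in
        (omap (fun q => Some (Tagged (fun x => mstate (M x)) q)) o, w', m)
    end).

(** [place] marks the current letter with the pointer, [back] goes home to run the body, [find]
    returns to the mark and moves it on, [leave] goes home at the end. *)
Definition loop_machine (r : nat) (M : S -> machine) : machine :=
  let place : option bool + S + {a : S & mstate (M a)} := inl (inl (Some true)) in
  let find := inl (inl (Some false)) in
  let leave := inl (inl None) in
  let back a := inl (inr a) in
  let body a q := inr (Tagged (fun a => mstate (M a)) q) in
  @Machine (option bool + S + {a : S & mstate (M a)})%type place (fun q w =>
    match q with
    | inl (inl (Some true)) =>
        if get_letter w r is Some a then (Some (back a), set_pointer w r true, Stay)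
        else (Some leave, w, Stay)
    | inl (inl (Some false)) =>
        if get_pointer w r then (Some place, set_pointer w r false, MoveRight)
        else (Some find, w, MoveRight)
    | inl (inl None) => if is_home w then (None, w, Stay) else (Some leave, w, MoveLeft)
    | inl (inr a) => if is_home w then (Some (body a (mstart (M a))), w, Stay)
        else (Some (back a), w, MoveLeft)
    | inr (existT a q) => let: (o, w', m) := mdelta q w in
        (Some (if o is Some q' then body a q' else find), w', m)
    end).

Fixpoint compile (p : prog) : machine :=
  match p with
  | Skip => stop_machine
  | Push r a => write_machine r (Some a)
  | Clear r => write_machine r None
  | Seq p q => seq_machine (compile p) (compile q)
  | Case r b => case_machine r (fun x => compile (b x))
  | Foreach r b => loop_machine r (fun a => compile (b a))
  end.

Definition computes (M : machine) (f : regs) (m : nat -> option nat) (g : regs) :=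
  reaches (mstart M) (layout f m) 0%R (layout g m) 0%R.


Lemma scan_end M (q : mstate M) r f m t' z' : r < k ->
  (forall w, get_letter w r -> mdelta q w = (Some q, w, MoveRight)) ->
  reaches q (layout f m) (Posz (size (f r))) t' z' -> reaches q (layout f m) 0%R t' z'.
Proof.
move=> rk dq R; suff : forall d, d <= size (f r) ->
    reaches q (layout f m) (Posz (size (f r) - d)) t' z'.
  by move/(_ (size (f r)) (leqnn _)); rewrite subnn.
elim=> [|d IH] ld; first by rewrite subn0.
have := IH (ltnW ld); rewrite -(subnSK ld); apply: goes_right; apply: dq.
by rewrite layout_letter // onthTE; lia.
Qed.

Lemma push_computes r a f m : r < k ->
  computes (write_machine r (Some a)) f m (run (Push r a) f).
Proof.
move=> rk; apply: (scan_end (q := true : mstate (write_machine _ _)) (r := r)) => //.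
  by move=> w /=; case: get_letter.
apply: Goes.
  by rewrite /= layout_letter // onth_default.
rewrite addr0 layout_push; apply: goes_home => [w|]; first by rewrite /=; case: is_home.
exact: exits_stay.
Qed.

Lemma clear_computes r f m : r < k -> computes (write_machine r None) f m (run (Clear r) f).
Proof.
move=> rk; apply: (scan_end (q := true : mstate (write_machine _ _)) (r := r)) => //.
  by move=> w /=; case: get_letter.
apply: goes_stay; first by rewrite /= layout_letter // onth_default.
have back : forall n g, size (g r) <= n.+1 -> setr g r [::] = setr f r [::] ->
    reaches (M := write_machine r None) false (layout g m) (Posz n) (layout (setr f r [::]) m) 0%R.
  elim=> [|n IH] g sg gf.
    have := @Exits (write_machine r None) false (layout g m) 0%R _ _ erefl.
    by rewrite addr0 (layout_take m (n := 0)) // take0 gf.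
  apply: Goes; first reflexivity.
  rewrite (layout_take m sg) (_ : (Posz n.+1 + displacement MoveLeft)%R = Posz n) //=; last lia.
  apply: IH; first by rewrite /setr eqxx size_take; case: ltnP.
  by rewrite -gf; apply: funext => i; rewrite /setr; case: eqP.
exact: back.
Qed.

Lemma reaches_inl M N (q : mstate M) t z t' z' t'' z'' : reaches q t z t' z' ->
  reaches (mstart N) t' z' t'' z'' ->
  reaches (inl q : mstate (seq_machine M N)) t z t'' z''.
Proof.
have inr_ (q' : mstate N) u y u' y' : reaches q' u y u' y' ->
    reaches (inr q' : mstate (seq_machine M N)) u y u' y'.
  elim=> [q1 u1 y1 w m d|q1 u1 y1 q2 w m u2 y2 d _]; first by apply: Exits; rewrite /= d.
  by apply: Goes; rewrite /= d.
move=> R /inr_ R'; elim: R R' => [q1 u1 y1 w m d|q1 u1 y1 q2 w m u2 y2 d _ IH] R'.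
  by apply: Goes R'; rewrite /= d.
by apply: Goes (IH R'); rewrite /= d.
Qed.

Lemma reaches_case r (M : option S -> machine) x (q : mstate (M x)) t z t' z' :
  reaches q t z t' z' ->
  reaches (Some (Tagged (fun x => mstate (M x)) q) : mstate (case_machine r M)) t z t' z'.
Proof.
elim=> [q1 u1 y1 w m d|q1 u1 y1 q2 w m u2 y2 d _]; first by apply: Exits; rewrite /= d.
by apply: Goes; rewrite /= d.
Qed.

Lemma reaches_body r (M : S -> machine) a (q : mstate (M a)) t z t' z' t'' z'' :
  reaches q t z t' z' ->
  reaches (inl (inl (Some false)) : mstate (loop_machine r M)) t' z' t'' z'' ->
  reaches (inr (Tagged (fun a => mstate (M a)) q) : mstate (loop_machine r M)) t z t'' z''.
Proof.
elim=> [q1 u1 y1 w m d|q1 u1 y1 q2 w m u2 y2 d _ IH] R.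
  by apply: Goes R; rewrite /= d.
by apply: Goes (IH R); rewrite /= d.
Qed.

Lemma loop_computes r (b : S -> prog) f m : r < k -> m r = None ->
  (forall a, keeps r (b a)) ->
  (forall a g n, computes (compile (b a)) g (setr m r (Some n)) (run (b a) g)) ->
  computes (compile (Foreach r b)) f m (run (Foreach r b) f).
Proof.
move=> rk mr kb bc; rewrite /computes /=.
pose M := loop_machine r (fun a => compile (b a)).
have : forall s g n, drop n (g r) = s -> reaches (inl (inl (Some true)) : mstate M)
    (layout g m) (Posz n) (layout (foldl (fun g a => run (b a) g) g s) m) 0%R.
  elim=> [|a s IH] g n sE.
    apply: goes_stay.
      by rewrite /= layout_letter // onth_default // -subn_eq0 -size_drop sE.
    apply: goes_home => [w|]; first by rewrite /=; case: is_home.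
    exact: exits_stay.
  have gn : onth (g r) n = Some a.
    by rewrite onthE -[n]addn0 -nth_drop -map_drop sE.
  apply: Goes; first by rewrite /= layout_letter // gn.
  rewrite addr0 layout_point //.
  apply: goes_home => [w|]; first by rewrite /=; case: is_home.
  apply: goes_stay; first by [].
  apply: reaches_body (bc a g n) _.
  have kr := keeps_run g (kb a).
  have find : forall d, d <= n -> reaches (inl (inl (Some false)) : mstate M)
      (layout (run (b a) g) (setr m r (Some n))) (Posz (n - d))
      (layout (foldl (fun g a => run (b a) g) (run (b a) g) s) m) 0%R.
    elim=> [|d IHd] ld.
      rewrite subn0; apply: Goes.
        by rewrite /= layout_pointer // /setr !eqxx.
      rewrite layout_unpoint; last by rewrite /setr eqxx.
      rewrite (_ : (Posz n + displacement MoveRight)%R = Posz n.+1); last by rewrite /=; lia.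
      have -> : setr (setr m r (Some n)) r None = m.
        by apply: funext => i; rewrite /setr; case: eqP => // ->.
      by apply: IH; rewrite kr -add1n -drop_drop sE /= drop0.
    apply: goes_right.
      rewrite /= layout_pointer // /setr eqxx; case: eqP => // -[]; lia.
    by rewrite subnSK //; apply: IHd; apply: ltnW.
  by have := find n (leqnn n); rewrite subnn.
by move/(_ (f r) f 0); rewrite drop0; apply.
Qed.

(** The pointers of the enclosing loops stay valid because the program does not change the registers
    they mark. *)
Lemma compile_computes p f m : wf k p -> (forall r, m r <> None -> keeps r p) ->
  computes (compile p) f m (run p f).
Proof.
elim: p f m => [|r a|r|p IHp q IHq|r b IH|r b IH] f m /=.
- by move=> _ _; apply: exits_stay.
- by move=> rk _; apply: push_computes.
- by move=> rk _; apply: clear_computes.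
- move=> [wp wq] kp; apply: reaches_inl; first by apply: IHp => // r /kp[].
  by apply: IHq => // r /kp[].
- move=> [rk wb] kp; apply: goes_stay; first reflexivity.
  have -> : get_letter (layout f m 0%R) r = ohead (f r) by rewrite layout_letter //; case: (f r).
  by apply: reaches_case; apply: IH => // r' /kp.
move=> [rk wb] kp; apply: loop_computes => //.
- by case E: (m r) => [n|//]; case: (kp r) => //; rewrite E.
- by move=> a; case: (wb a).
move=> a g n; apply: IH; first by case: (wb a).
move=> r'; rewrite /setr; case: eqP => [-> _|_ /kp[_]//]; by case: (wb a).
Qed.
End LoopPrograms.

(** * Composition of a loop program with a decider *)

Section LoopReduction.
Variables (Sigma Sigma' S : finType) (emb : Sigma -> S) (out : S -> Sigma').
Variables (k : nat) (p : prog S).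
Hypothesis wfp : wf k p.
Hypothesis k1 : 1 < k.
Variable D : turing_machine Sigma'.

Notation P := (compile k p).
Notation wcell := (wcell S k).
Notation dcell := (option (Sigma' + work_symbol D)).
Notation pcell := (option (Sigma + (wcell + dcell))).

(** No sweep translates the tape: an input letter is read as a cell holding it in register 0, and
    later, through [view], a program cell as the cell of the decider given by register 1. Each cell
    is rewritten when it is visited. *)
Definition decode (c : pcell) : wcell :=
  match c with
  | Some (inl a) => set_letter (wblank S k) 0 (Some (emb a))
  | Some (inr (inl w)) => w
  | _ => wblank S k
  end.

Definition view (c : pcell) : dcell :=
  if c is Some (inr (inr d)) then d
  else omap (fun x => inl (out x)) (get_letter (decode c) 1).

Definition reduction_machine : turing_machine Sigma :=
  @TuringMachine Sigma (option (mstate P) + state D)%type (wcell + dcell)%type (inl None)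
    (fun q => if q is inr q then verdict q else None)
    (fun q c =>
      match q with
      | inl None => (inl (Some (mstart P)),
          Some (inr (inl ((decode c).1.1, (decode c).1.2, true))), Stay)
      | inl (Some q) => let: (o, w, m) := mdelta q (decode c) in
          (if o is Some q' then inl (Some q') else inr (start D), Some (inr (inl w)), m)
      | inr q => let: (q', d, m) := transition q (view c) in
          (inr q', Some (inr (inr d)), m)
      end).

Notation M := reduction_machine.

Definition program_cell (c : pcell) : bool := if c is Some (inr (inr _)) then false else true.

Lemma reaches_step (q : mstate P) t z t' z' : reaches q t z t' z' ->
  forall c : config M, cstate c = inl (Some q) -> chead c = z ->
    (forall i, program_cell (ctape c i) /\ decode (ctape c i) = t i) ->
  exists n, let c' := iter n (@step _ M) c in
    [/\ cstate c' = inr (start D), chead c' = z' &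
      forall i, program_cell (ctape c' i) /\ decode (ctape c' i) = t' i].
Proof.
elim=> {q t z t' z'} [q t z w m d|q t z q' w m t' z' d _ IH] [cs ct ch] /= -> -> cE.
  exists 1; rewrite /= /step /= (cE z).2 d; split=> // i /=.
  by rewrite /write; case: eqP => // _; apply: cE.
case: (IH (Config (M := M) (inl (Some q')) (fun i => if i == z then Some (inr (inl w)) else ct i)
  (z + displacement m)%R)) => //= [i|n nE].
  by rewrite /write; case: eqP => // _; apply: cE.
by exists n.+1; rewrite iterSr /step /= (cE z).2 d.
Qed.

Lemma verdict_step (c : config M) (d : config D) : cstate c = inr (cstate d) ->
  chead c = chead d -> (forall i, view (ctape c i) = ctape d i) ->
  forall n b, verdict (cstate (iter n (@step _ D) d)) = Some b ->
    exists n', verdict (cstate (iter n' (@step _ M) c)) = Some b.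
Proof.
move=> cs ch ct n; elim: n c d cs ch ct => [|n IH] c d cs ch ct b.
  by exists 0; rewrite /= cs.
case vd: (verdict (cstate d)) => [b'|].
  have stop m : iter m (@step _ D) d = d by elim: m => //= m ->; rewrite /step vd.
  by rewrite stop vd => E; exists 0; rewrite /= cs vd.
rewrite iterSr => E.
have [||i|n' nE] := IH (step c) (step d) _ _ _ b E; last by exists n'.+1; rewrite iterSr.
- by rewrite /step cs /= vd ch ct; case: transition => -[].
- by rewrite /step cs /= vd ch ct; case: transition => -[].
rewrite /step cs /= vd ch ct; case: transition => -[q a m] /=.
by case: eqP.
Qed.

Definition input (s : seq Sigma) : regs S := fun r => if r == 0 then map emb s else [::].

Lemma reduction_halts s b : halts_with D (map out (run p (input s) 1)) b -> halts_with M s b.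
Proof.
move=> [n nE]; pose m0 : nat -> option nat := fun=> None.
have R : computes P (input s) m0 (run p (input s)) by apply: compile_computes.
pose c1 : config M := step (initial M s).
have initE n0 : let c := nth None [seq Some (inl a) | a <- s] n0 : pcell in
    program_cell c /\ decode c = ([ffun i : 'I_k => onth (input s i) n0], [ffun i : 'I_k => m0 i == Some n0], false).
  have other (i : 'I_k) : (val i == 0) = false -> onth (input s i) n0 = None.
    by rewrite /input => ->; rewrite onth0n.
  have [ge|lt] := leqP (size s) n0.
    rewrite nth_default ?size_map //; split=> //; congr (_, _, _); apply/ffunP => i; rewrite !ffunE //.
    case E: (val i == 0); last by rewrite other.
    by rewrite /input E onth_default ?size_map.
  have [a aE] : exists a, onth s n0 = Some a.
    by move: lt; rewrite -onthTE; case: onth => // a _; exists a.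
  have -> : nth None [seq Some (inl a) | a <- s] n0 = Some (inl a) :> pcell.
    by rewrite (map_comp Some inl) -onthE onth_map aE.
  split=> //; congr (_, _, _); apply/ffunP => i; rewrite !ffunE //.
  case E: (val i == 0); last by rewrite other.
  by rewrite /input E onth_map aE.
have [i|n1 [s1 h1 t1]] := reaches_step R (c := c1) erefl erefl.
  rewrite /c1 /step /=; case: eqP => [->|ne] /=.
    by have [_ ->] := initE 0.
  by case: i ne => //= n0 ne; have [-> ->] := initE n0; split=> //; congr (_, _, _); case: n0 ne.
have [||i|n' n'E] := @verdict_step (iter n1 (@step _ M) c1)
    (initial D (map out (run p (input s) 1))) _ _ _ n b nE; last first.
- by exists (n' + n1.+1); rewrite iterD iterSr.
- have vE : view (ctape (iter n1 (@step _ M) c1) i) =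
      omap (fun x => inl (out x)) (get_letter (decode (ctape (iter n1 (@step _ M) c1) i)) 1).
    by rewrite /view; case: (t1 i); case: ctape => [[a|[w|]]|].
  rewrite vE (t1 i).2 /=; case: i {vE} => [n0|n0]; last by rewrite /get_letter insubT /= ffunE.
  rewrite layout_letter // -(onth_map _ _ (fun x => inl (out x))) onthE -map_comp.
  by rewrite -map_comp.
- by rewrite h1.
- by rewrite s1.
Qed.
End LoopReduction.

Theorem loop_reduction (Sigma Sigma' S : finType) (emb : Sigma -> S) (out : S -> Sigma')
    (k : nat) (p : prog S) (L : set (seq Sigma')) :
  wf k p -> 1 < k -> turing_decidable L ->
  turing_decidable [set s | L (map out (run p (input emb s) 1))].
Proof.
move=> wfp k1 [D DL]; exists (reduction_machine emb out k p D) => s.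
have [pos neg] := DL (map out (run p (input emb s) 1)).
by split=> [/pos|/neg]; apply: reduction_halts.
Qed.

(** * Decidability forces condition D *)

Section Odometer.
Variables (S : finType) (s0 : S).

Definition next_letter (d : S) : option S := onth (enum S) (index d (enum S)).+1.

(** The successor in bijective numeration, with digits 1 to the number of letters, least digit
    first. For lack of a zero digit, every word occurs exactly once in the enumeration. *)
Fixpoint next_word (w : seq S) : seq S :=
  if w is d :: w' then
    if next_letter d is Some d' then d' :: w' else head s0 (enum S) :: next_word w'
  else [:: head s0 (enum S)].

Fixpoint word_value (w : seq S) : nat :=
  if w is d :: w' then (index d (enum S)).+1 + #|S| * word_value w' else 0.

Lemma word_value_next w : word_value (next_word w) = (word_value w).+1.
Proof.
have S0 : 0 < #|S| by apply/card_gt0P; exists s0.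
have i0 : index (head s0 (enum S)) (enum S) = 0.
  by case E: (enum S) => [|a s] /=; rewrite ?eqxx //; move: S0; rewrite cardT E.
elim: w => [|d w IH] /=; first by rewrite i0 muln0.
rewrite /next_letter; case: (ltnP (index d (enum S)).+1 (size (enum S))) => l.
  have -> : onth (enum S) (index d (enum S)).+1 = Some (nth s0 (enum S) (index d (enum S)).+1).
    by rewrite onthE (nth_map s0).
  by rewrite /= index_uniq ?enum_uniq.
rewrite onth_default //= i0 IH mulnS.
have : index d (enum S) < size (enum S) by rewrite index_mem mem_enum.
move: (index d _) (#|S| * _) l => i v; rewrite -cardT => l lt.
by have -> : #|S| = i.+1 by [apply/eqP; rewrite eqn_leq l]; lia.
Qed.

Lemma word_value_inj : injective word_value.
Proof.
have lt d : index d (enum S) < #|S| by rewrite cardT index_mem mem_enum.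
elim=> [|d w IH] [|d' w'] //= /eqP; rewrite !addSn eqSS => /eqP E.
have S0 : 0 < #|S| by apply: leq_ltn_trans (lt d).
have := congr1 (modn^~ #|S|) E; have := congr1 (divn^~ #|S|) E.
rewrite /= ![_ + #|S| * _]addnC ![#|S| * _]mulnC !divnMDl // !modnMDl.
rewrite !(modn_small (lt _)) !(divn_small (lt _)) !addn0 => /IH -> i.
by congr (_ :: _); rewrite -(nth_index s0 (mem_enum _ d)) i nth_index ?mem_enum.
Qed.

Lemma next_word_onto w : exists n, iter n next_word [::] = w.
Proof.
exists (word_value w); apply: word_value_inj.
by elim: (word_value w) => //= n IH; rewrite word_value_next IH.
Qed.
End Odometer.

Section Macros.
Variable S : finType.
Implicit Types f : regs S.

Definition append (d r : nat) : prog S := Foreach r (fun a => Push d a).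
Definition append_if (P : pred S) (d r : nat) : prog S :=
  Foreach r (fun a => if P a then Push d a else Skip S).
Definition copy (d r : nat) : prog S := Seq (Clear S d) (append d r).

Lemma setr_same f r x : setr f r x r = x.
Proof. by rewrite /setr eqxx. Qed.

Lemma setr_other f r x r' : r' != r -> setr f r x r' = f r'.
Proof. by rewrite /setr => /negbTE ->. Qed.

Lemma setr_setr f r x y : setr (setr f r x) r y = setr f r y.
Proof. by apply: funext => r'; rewrite /setr; case: eqP. Qed.

Lemma setr_id f r : setr f r (f r) = f.
Proof. by apply: funext => r'; rewrite /setr; case: eqP => // ->. Qed.

Lemma run_append_if P d r f : d != r ->
  run (append_if P d r) f = setr f d (f d ++ [seq a <- f r | P a]).
Proof.
move=> dr /=; move: (f r) => s0; elim: s0 f => [|a s IH] f /=; first by rewrite cats0 setr_id.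
by case: (P a) => /=; rewrite IH // setr_same setr_setr cat_rcons.
Qed.

Lemma run_append d r f : d != r -> run (append d r) f = setr f d (f d ++ f r).
Proof.
move=> dr /=; move: (f r) => s0; elim: s0 f => [|a s IH] f /=; first by rewrite cats0 setr_id.
by rewrite IH // setr_same setr_setr cat_rcons.
Qed.

Lemma run_copy d r f : d != r -> run (copy d r) f = setr f d (f r).
Proof.
move=> dr; rewrite -[LHS]/(run (append d r) (setr f d [::])) run_append //.
by rewrite setr_same setr_setr setr_other // eq_sym.
Qed.


(* Register [c] holds the carry. *)
Definition next_prog (s0 : S) (d t c : nat) : prog S :=
  Seq (Push c s0) (Seq
    (Foreach d (fun a => Case c (fun x => if x is Some _ then
       if next_letter a is Some a' then Seq (Push t a') (Clear S c)
       else Push t (head s0 (enum S)) else Push t a)))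
    (Seq (Case c (fun x => if x is Some _ then Push t (head s0 (enum S)) else Skip S))
    (Seq (copy d t) (Seq (Clear S t) (Clear S c))))).

Lemma run_next s0 d t c f : d != t -> d != c -> t != c -> f t = [::] -> f c = [::] ->
  run (next_prog s0 d t c) f = setr f d (next_word s0 (f d)).
Proof.
move=> dt dc tc ft fc.
pose flag b := if b then [:: s0] else [::] : seq S.
pose st acc b := setr (setr f t acc) c (flag b).
have st_t acc b : st acc b t = acc by rewrite /st setr_other // setr_same.
have st_c acc b : st acc b c = flag b by rewrite /st setr_same.
have set_t acc b x : setr (st acc b) t x = st x b.
  apply: funext => r; rewrite /st /setr; case: (r =P t) => [->|] //.
  by rewrite (negbTE tc).
have set_c acc b b' : setr (st acc b) c (flag b') = st acc b' by rewrite /st setr_setr.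
have start : run (Push c s0) f = st [::] true.
  by rewrite /= fc /st -[X in setr f t X]ft setr_id.
have loop : forall s acc b, exists acc' b',
    foldl (fun g a => run (Case c (fun x => if x is Some _ then
       if next_letter a is Some a' then Seq (Push t a') (Clear S c)
       else Push t (head s0 (enum S)) else Push t a)) g) (st acc b) s = st acc' b' /\
    acc' ++ (if b' then [:: head s0 (enum S)] else [::]) = acc ++ (if b then next_word s0 s else s).
  elim=> [|a s IH] acc b; first by exists acc, b; split=> //; case: b.
  rewrite [foldl _ _ _]/= st_c; case: b => /=.
    case: next_letter => [a'|].
      rewrite /= st_t set_t (set_c _ _ false); have [acc' [b' [-> E]]] := IH (rcons acc a') false.
      by exists acc', b'; rewrite E cat_rcons.
    rewrite /= st_t set_t; have [acc' [b' [-> E]]] := IH (rcons acc (head s0 (enum S))) true.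
    by exists acc', b'; rewrite E cat_rcons.
  rewrite st_t set_t; have [acc' [b' [-> E]]] := IH (rcons acc a) false.
  by exists acc', b'; rewrite E cat_rcons.
have [acc [b [E1 E2]]] := loop (f d) [::] true.
have fin : run (Case c (fun x => if x is Some _ then Push t (head s0 (enum S)) else Skip S)) (st acc b)
    = st (next_word s0 (f d)) b.
  rewrite /= st_c; move: E2 => /= <-.
  by case: b {E1}; rewrite {1}/flag /= ?st_t ?set_t ?cats1 ?cats0.
have -> : run (next_prog s0 d t c) f = run (Seq (copy d t) (Seq (Clear S t) (Clear S c)))
    (st (next_word s0 (f d)) b).
  rewrite -fin -E1 -start /next_prog.
  by rewrite /= [setr f c _ d]setr_other.
rewrite -[LHS]/(setr (setr (run (copy d t) (st (next_word s0 (f d)) b)) t [::]) c [::]).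
rewrite run_copy // st_t.
apply: funext => r; rewrite /st /setr; case: (r =P c) => [->|rc].
  by rewrite fc eq_sym (negbTE dc).
case: (r =P t) => [->|rt]; first by rewrite ft eq_sym (negbTE dt).
by case: eqP.
Qed.

Lemma keeps_append r d r' : r <> d -> r <> r' -> keeps r (append d r').
Proof. by []. Qed.

Lemma keeps_next s0 r d t c : r <> d -> r <> t -> r <> c -> keeps r (next_prog s0 d t c).
Proof.
move=> rd rt rc; do 2 (split=> //).
  by split=> // a [x|] //=; case: next_letter.
by split=> // -[].
Qed.

Lemma wf_append k d r : d < k -> r < k -> d <> r -> wf k (append d r).
Proof. by move=> dk rk dr; split=> // a; split=> //= E; apply: dr. Qed.

Lemma wf_append_if k P d r : d < k -> r < k -> d <> r -> wf k (append_if P d r).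
Proof. by move=> dk rk dr; split=> // a; case: (P a); split=> //= E; apply: dr. Qed.

Lemma wf_next k s0 d t c : d < k -> t < k -> c < k -> d <> t -> d <> c -> wf k (next_prog s0 d t c).
Proof.
move=> dk tk ck dt dc; do 2 (split=> //).
  split=> // a; split=> [[x|] //=|]; first by case: next_letter.
  by split=> // -[x|] //; case: next_letter.
split; first by split=> // -[].
by do 2 (split=> //); apply: wf_append => //; move=> E; apply: dt.
Qed.
Lemma run_seq (p q : prog S) f : run (Seq p q) f = run q (run p f).
Proof. by []. Qed.

Lemma run_push r (a : S) f : run (Push r a) f = setr f r (rcons (f r) a).
Proof. by []. Qed.

Lemma run_repeat r (p : prog S) f : run (Foreach r (fun _ => p)) f = iter (size (f r)) (run p) f.
Proof.
rewrite /=; move: (f r) => s; elim: s f => //= a s IH f.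
by rewrite IH -iterSr.
Qed.

End Macros.

(** * The program that writes the instance attached to its input *)

Section ForwardProgram.
Variable A : finType.
Notation S := ('I_5 * option A)%type.

Definition has_tag (i : nat) : pred S := fun d => d.1 == i :> nat.

Definition separator : S := (ord0, None).

(** At turn m, register 4 holds the code of the bottom followed by m letters [true], and 7 the code
    of the top: their concatenation is the m-th forbidden word. Registers 8 and 9 accumulate the
    powers of the two letters. *)
Definition counter_body : prog S :=
  Seq (append S 1 4) (Seq (append S 1 7) (Seq (Push 1 separator)
    (Seq (append S 4 5) (Seq (append S 8 5) (append S 9 6))))).

(* The input selects the word of register 2, whose letters tagged 4 are the
   fixed part of the output and whose letters tagged 0 to 3 are the codes of the
   bottom, the two letters and the top of a stack. *)
Definition stack_program : prog S :=
  Seq (Foreach 0 (fun _ => next_prog separator 2 3 10))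
  (Seq (append_if (has_tag 4) 1 2) (Seq (append_if (has_tag 0) 4 2)
  (Seq (append_if (has_tag 1) 5 2) (Seq (append_if (has_tag 2) 6 2)
  (Seq (append_if (has_tag 3) 7 2) (Seq (Foreach 0 (fun _ => counter_body))
  (Seq (append S 8 5) (Seq (append S 9 6) (Seq (append S 1 8) (Seq (Push 1 separator)
  (Seq (append S 1 9) (Push 1 separator)))))))))))).

Lemma wf_stack_program : wf 11 stack_program.
Proof.
split; first by split=> // a; split; [apply: keeps_next | apply: wf_next].
do 5 (split; first exact: wf_append_if).
by repeat split.
Qed.

Definition power (n : nat) (w : seq S) : seq S := flatten (nseq n w).

Lemma powerS n w : power n.+1 w = power n w ++ w.
Proof. by rewrite /power -[n.+1]addn1 nseqD flatten_cat /= cats0. Qed.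

Definition stack_output (w : seq S) (n : nat) : seq S :=
  let t i := [seq d <- w | has_tag i d] in
  t 4 ++ flatten [seq (t 0 ++ power m (t 1)) ++ t 3 ++ [:: separator] | m <- iota 0 n] ++
  power n.+1 (t 1) ++ [:: separator] ++ power n.+1 (t 2) ++ [:: separator].

Lemma run_stack_program (s : seq unit) :
  run stack_program (input (fun=> separator) s) 1 =
  stack_output (iter (size s) (next_word separator) [::]) (size s).
Proof.
set w := iter _ _ _; pose t i := [seq d <- w | has_tag i d].
set f0 := input _ s; rewrite /stack_program !run_seq [run _ f0]run_repeat.
have -> : size (f0 0) = size s by rewrite /f0 /input /= size_map.
have -> : iter (size s) (run (next_prog separator 2 3 10)) f0 = setr f0 2 w.
  rewrite /w; elim: (size s) => [|n IH].
    by rewrite -[[::] in RHS]/(f0 2) setr_id.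
  by rewrite !iterS IH run_next // setr_setr setr_same.
pose out n := t 4 ++ flatten [seq (t 0 ++ power m (t 1)) ++ t 3 ++ [:: separator] | m <- iota 0 n].
pose inv n (g : regs S) := [/\ g 1 = out n, g 4 = t 0 ++ power n (t 1), g 5 = t 1, g 6 = t 2 &
  [/\ g 7 = t 3, g 8 = power n (t 1) & g 9 = power n (t 2)]].
rewrite !run_append_if // run_repeat; set g0 := setr _ 7 _.
have sg : size (g0 0) = size s by rewrite /g0 /setr /= /f0 /input /= size_map.
have i0 : inv 0 g0.
  by rewrite /g0 /inv /setr /= /f0 /input /= /out /= !cats0.
rewrite sg.
have : inv (size s) (iter (size s) (run counter_body) g0).
  elim: (size s) => // n; rewrite iterS; move: (iter n _ g0) => g [g1 g4 g5 g6 [g7 g8 g9]].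
  rewrite /counter_body !run_seq run_push !run_append //.
  rewrite /inv /setr /= g1 g4 g5 g6 g7 g8 g9 !powerS; split=> //.
    rewrite /out -[n.+1]addn1 iotaD map_cat flatten_cat /= cats0.
    by rewrite -cats1 -!catA.
  by rewrite -!catA.
move: (iter _ _ g0) => g [g1 g4 g5 g6 [g7 g8 g9]].
rewrite !run_append // !run_push.
rewrite /setr /= g1 g5 g6 g8 g9 /stack_output -/(t 1) -/(t 2) !powerS.
by rewrite /out -!cats1 -!catA.
Qed.
End ForwardProgram.

Lemma encode_cat (A : finType) (F G : seq (seq A)) : encode (F ++ G) = encode F ++ encode G.
Proof. by rewrite /encode map_cat flatten_cat. Qed.

Lemma encode_inj (A : finType) : injective (@encode A).
Proof.
have E (w : seq A) F : encode (w :: F) = map Some w ++ None :: encode F.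
  by rewrite /encode /= -cats1 -catA.
elim=> [|w F IH] [|w' F'] //; rewrite ?E; [by case: w' | by case: w | ].
elim: w w' => [|a w IHw] [|a' w'] //=; rewrite ?E /=; first by case=> /IH ->.
by case=> -> /IHw [-> ->].
Qed.

Lemma halts_with_inj (Sigma : finType) (M : turing_machine Sigma) s b b' :
  halts_with M s b -> halts_with M s b' -> b = b'.
Proof.
have stop c m : verdict (cstate c) <> None -> iter m (@step _ M) c = c.
  by move=> v; elim: m => //= m ->; rewrite /step; case: verdict v.
move=> [n nb] [n' nb'].
wlog le : n n' b b' nb nb' / n <= n'.
  by move=> W; have [|/ltnW] := leqP n n'; [apply: W | move/W => W'; apply/esym/W'].
move: nb'; rewrite -(subnK le) iterD stop; last by rewrite nb.
by rewrite nb => -[].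
Qed.

Lemma stack_output_encode (A : finType) (w : seq ('I_5 * option A)) n F0 c0 c1 c2 c3 :
  let t i := map snd [seq d <- w | has_tag i d] in
  t 0 = map Some c0 -> t 1 = map Some c1 -> t 2 = map Some c2 -> t 3 = map Some c3 ->
  t 4 = encode F0 ->
  map snd (stack_output w n) = encode (F0 ++
    [seq c0 ++ flatten (nseq m c1) ++ c3 | m <- iota 0 n] ++
    [:: flatten (nseq n.+1 c1); flatten (nseq n.+1 c2)]).
Proof.
move=> t t0 t1 t2 t3 t4.
have pw i m c : t i = map Some c ->
    map snd (power m [seq d <- w | has_tag i d]) = map Some (flatten (nseq m c)).
  by move=> ti; rewrite /power !map_flatten !map_nseq -/(t i) ti.
rewrite /stack_output !encode_cat !map_cat -/(t 4) t4; congr (_ ++ _).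
rewrite !(pw 1 _ c1 t1) (pw 2 _ c2 t2) /=.
rewrite {2}/encode /= -!cats1 -!catA; congr (_ ++ _).
rewrite /encode map_flatten -!map_comp; congr flatten; apply: eq_map => m /=.
by rewrite !map_cat -/(t 0) -/(t 3) t0 t3 (pw 1 _ c1 t1) -cats1 -!catA.
by rewrite !map_cat -/(t 1) -/(t 2) t1 t2 -!catA.
Qed.

Theorem decidable_condition_D (A : finType) (H : set (int -> A)) (hH : nearest_neighbor H) :
  turing_decidable (DP_I H) -> condition_D (rauzy H).
Proof.
move=> dec; apply: contrapT => nD.
have [M MP] := @loop_reduction unit (option A) ('I_5 * option A)%type (fun=> separator A)
  snd 11 (stack_program A) (DP_I H) (wf_stack_program A) isT dec.
have [F0 [code codeP]] := wang_coding hH nD (stack_wang M).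
pose tg i (s : seq (option A)) : seq ('I_5 * option A) := [seq (inord i, x) | x <- s].
pose c i : seq A := code (nth (inr (inl false)) [:: inr (inl false); inr (inr (inl true));
  inr (inr (inl false)); inr (inr (inr tt))] i).
pose w := tg 0 (map Some (c 0)) ++ tg 1 (map Some (c 1)) ++ tg 2 (map Some (c 2)) ++
  tg 3 (map Some (c 3)) ++ tg 4 (encode F0).
have tgE i j s : i < 5 -> j < 5 ->
    map snd [seq d <- tg i s | has_tag j d] = if i == j then s else [::].
  move=> i5 j5; elim: s => [|x s IH] /=; first by case: ifP.
  rewrite {1}/has_tag /= inordK //; case: eqP IH => [ij|ne] /= -> //.
(* The self-reference is closed here: N is the rank of the table [w], which describes the tile set
   of [M] itself. *)
have [N NE] := next_word_onto (separator A) w.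
pose F := F0 ++ [seq flatten (map code w) | w <- stack_words M N].
have outE : map snd (run (stack_program A) (input (fun=> separator A) (nseq N tt)) 1) = encode F.
  rewrite run_stack_program size_nseq NE.
  rewrite (@stack_output_encode _ w N F0 (c 0) (c 1) (c 2) (c 3));
    try by rewrite !filter_cat !map_cat !tgE //= ?cats0.
  rewrite /F /stack_words map_cat -map_comp /= !map_nseq; congr (encode (_ ++ _ ++ _)).
  apply: eq_map => m /=; congr (_ ++ _).
  by rewrite map_rcons map_nseq -cats1 flatten_cat /= cats0.
have nil : [::] \notin stack_words M N.
  by rewrite mem_cat negb_or !inE /= andbT; apply/mapP => -[].
have [pos neg] := MP (nseq N tt).
have [full|empty] := pselect (combined H (sft F) !=set0).
  have /pos acc : DP_I H (map snd (run (stack_program A) (input (fun=> separator A) (nseq N tt)) 1)).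
    by exists F => //; rewrite outE.
  have [/(_ full)[h [v [hv av]]] _] := codeP _ nil.
  exact: stack_forced hv av acc.
have /neg rej : ~ DP_I H (map snd (run (stack_program A) (input (fun=> separator A) (nseq N tt)) 1)).
  by rewrite outE => -[F' FH /encode_inj E]; apply: empty; rewrite -E.
have noacc : forall k, ~~ accepting (lst (iter k (@lstep M) (linitial M N))).
  move=> k; apply/negP => acc.
  have /accepting_run acc' : exists k, accepting (lst (iter k (@lstep M) (linitial M N))) by exists k.
  by have := halts_with_inj acc' rej.
apply: empty; have [_ ] := codeP _ nil; apply.
  exact: stack_tiling noacc.
by move=> u x y uP; apply: stack_avoids.
Qed.

(** * Condition D gives decidability *)

Lemma modz_addn (z : int) (k n : nat) : 0 < n ->
  absz (modz (z + Posz k)%R (Posz n)) = (absz (modz z (Posz n)) + k) %% n.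
Proof.
move=> n0; have [zE _] := divz_absz z n0; set r := absz (modz z _) in zE *.
have lt : (r + k) %% n < n by rewrite ltn_pmod.
have := divmod_unique (divz z (Posz n) + Posz ((r + k) %/ n))%R lt.
rewrite (_ : (_ * Posz n + _ = z + Posz k)%R) => [[_ ->]//|].
by rewrite mulrDl -PoszM -addrA -PoszD -divn_eq PoszD addrA -zE.
Qed.

(** Some letter recurs infinitely often; from one of its occurrences on, every position leads back
    to it, hence to all the others. *)
Lemma walk_recurrent (A : finType) (e : rel A) (y : nat -> A) : (forall i, e (y i) (y i.+1)) ->
  exists i0, forall i j, i0 <= i -> i0 <= j -> connect e (y i) (y j).
Proof.
move=> ye; have conn i j : i <= j -> connect e (y i) (y j).
  move=> /subnK <-; elim: (j - i) => [|d IH]; first exact: connect0.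
  by apply: connect_trans IH _; apply: connect1.
have [[a inf]|fin] := pselect (exists a, forall n, exists2 i, n <= i & y i = a).
  have [i0 _ i0a] := inf 0; exists i0 => i j li lj.
  have [i' li' i'a] := inf i; apply: connect_trans (conn _ _ li') _.
  by rewrite i'a -i0a; apply: conn.
have /choice[N NP] a : exists N, forall i, N <= i -> y i <> a.
  apply: contrapT => no; apply: fin; exists a => n; apply: contrapT => no'; apply: no.
  by exists n => i ni ya; apply: no'; exists i.
have := NP (y (\max_a N a)) (\max_a N a); case=> //.
exact: leq_bigmax.
Qed.

Section Periodic.
Variables (A : finType) (H : set (int -> A)).
Hypothesis hH : nearest_neighbor H.

Definition closing (P : nat) : Prop := forall S, scc (rauzy H) S ->
  forall g : nat -> A, (forall i, S (g i)) -> (forall i, redge H (g i) (g i.+1)) ->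
  redge H (g P.-1) (g 0).

(** P is 1 for loops and 2 for symmetric edges. For state-split cycles P is the factorial of the
    number of letters, a multiple of the number of classes of each component, since the classes are
    nonempty and disjoint. *)
Lemma condition_D_closing : condition_D (rauzy H) -> exists2 P, 0 < P & closing P.
Proof.
case=> D.
- exists 1 => // S sS g Sg _; exact/redgeE/(D S sS).
- exists 2 => // S sS g Sg ge; have [E|/eqP ne] := eqVneq (g 0) (g 1).
    by rewrite /= -E {2}E; apply: ge.
  by apply/redgeE; apply: (D S sS) => //; exact/redgeE.
exists (#|A|)`!; first exact: fact_gt0.
move=> S sS g Sg ge; have [p [W [p0 W0 Wt SE step]]] := D S sS.
have pA : p <= #|A|.
  have /choice[a aP] i : exists a, W i a by apply: W0.
  have : injective a.
    by move=> i j aij; apply: Wt => //; exists (a i); split; rewrite // aij.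
  by move/leq_card; rewrite card_ord.
have [i0 _ gi0] : exists2 i, True & W i (g 0).
  by have := Sg 0; rewrite SE => -[i _ Wi]; exists i.
have gW k : W (iter k (@ordS p) i0) (g k).
  elim: k => //= k IH; apply/(step _ _ _ IH (Sg k.+1)).
  exact/redgeE.
have ord_iter k : val (iter k (@ordS p) i0) = (i0 + k) %% p.
  elim: k => [|k IH] /=; first by rewrite addn0 modn_small.
  by rewrite IH -[(_ %% p).+1]addn1 modnDml addn1 addnS.
apply/redgeE/(step _ _ _ (gW _) (Sg 0)).
rewrite -iterS (_ : iter _ _ _ = i0) //; apply: val_inj.
rewrite ord_iter prednK ?fact_gt0 //.
by rewrite -modnDmr (eqP (dvdn_fact _)) ?addn0 ?modn_small // p0.
Qed.

Variable P : nat.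
Hypothesis P0 : 0 < P.

Definition cycle_word : finType := {ffun 'I_P -> A}.
Definition is_cycle (c : cycle_word) : bool := [forall i, redge H (c i) (c (ordS i))].
Definition track (j : 'I_P) (u : seq cycle_word) : seq A := [seq (c : cycle_word) j | c <- u].
Definition admissible (F : seq (seq A)) (u : seq cycle_word) : bool :=
  all is_cycle u && [forall j, all (fun w => ~~ infix w (track j u)) F].

(** Two of the windows of m consecutive cycles coincide by the pigeonhole principle. The part
    between them is repeated vertically, and each factor of length at most m of the repetition
    already occurs in [u]. *)
Lemma admissible_nonempty (F : seq (seq A)) u m : (forall w, w \in F -> size w <= m) ->
  #|cycle_word| ^ m + m <= size u -> admissible F u -> combined H (sft F) !=set0.
Proof.
move=> Fm su /andP[/allP cyc /forallP adm].
have [c0 _] : exists c0, c0 \in u.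
  case: u su {cyc adm} => [|c u] su; last by exists c; rewrite mem_head.
  by case: m su {Fm} => [|m]; rewrite /= ?expn0 //; lia.
pose win (i : 'I_(#|cycle_word| ^ m).+1) := [tuple nth c0 u (i + k) | k < m].
have [i [i' [lt wE]]] : exists i i' : 'I_(#|cycle_word| ^ m).+1, i < i' /\ win i = win i'.
  have /injectiveP : ~~ injectiveb win.
    by apply/injectiveP => /leq_card; rewrite card_tuple card_ord ltnn.
  have [//|no] := pselect (exists i j : 'I_(#|cycle_word| ^ m).+1, i < j /\ win i = win j).
  case=> i j gE; apply: val_inj; case: (ltngtP (val i) (val j)) => // l; case: no.
    by exists i, j.
  by exists j, i.
pose d := i' - i; have d0 : 0 < d by rewrite subn_gt0.
have per : forall k, k < d + m -> nth c0 u (i + k) = nth c0 u (i + k %% d).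
  elim/ltn_ind=> k IH lk; have [kd|dk] := ltnP k d; first by rewrite modn_small.
  have lm : k - d < m by lia.
  have := congr1 (fun t => tnth t (Ordinal lm)) wE; rewrite !tnth_mktuple /= => E.
  rewrite -{2}(subnK dk) modnDr -IH; [| lia | lia].
  by rewrite E addnBA // subnBA ?(ltnW lt) // -addnA addKn addnC.
pose U (z : int) := nth c0 u (i + absz (modz z (Posz d))).
have lu z : i + absz (modz z (Posz d)) < size u.
  by have [_] := divz_absz z d0; have := ltn_ord i'; rewrite /d; lia.
have om (z : int) : absz (modz z (Posz P)) < P by have [] := divz_absz z P0.
exists (fun ab => U ab.2 (Ordinal (om ab.1))) => a b /=; split.
  apply/(rauzyP hH) => k; have /forallP/(_ (Ordinal (om k))) := cyc _ (mem_nth c0 (lu b)).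
  congr (redge H _ (_ _)); apply: val_inj => /=.
  by rewrite (modz_addn _ 1 P0) addn1.
move=> w wF [t xw]; have /allP/(_ w wF)/negP := adm (Ordinal (om a)); apply.
set j := Ordinal _ in xw *; set r := absz (modz t (Posz d)).
have rd : r < d by have [] := divz_absz t d0.
have wm := Fm w wF.
apply/infixP; exists (take (i + r) (track j u)), (drop (i + r + size w) (track j u)).
have st : i + r + size w <= size (track j u).
  by rewrite size_map; have := ltn_ord i'; rewrite /d in rd; lia.
have wT : w = take (size w) (drop (i + r) (track j u)).
  rewrite {1}xw; apply: (@eq_from_nth _ (c0 j)).
    by rewrite size_mkseq size_takel // size_drop; lia.
  move=> k; rewrite size_mkseq => lk; rewrite nth_mkseq // nth_take // nth_drop.
  rewrite (nth_map c0); last first.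
    apply: leq_trans (_ : _ <= i + r + size w) _; first by rewrite ltn_add2l.
    by rewrite -(size_map (fun c : cycle_word => c j) u).
  rewrite /U modz_addn // -per; first by rewrite addnA.
  by rewrite -addSn leq_add // (leq_trans (ltnW lk) wm).
rewrite -{1}(cat_take_drop (i + r) (track j u)); congr cat.
by rewrite -{1}(cat_take_drop (size w) (drop (i + r) (track j u))) -wT drop_drop [size w + _]addnC.
Qed.

(** The n rows are read from a common column on, beyond which each stays in its own component, and
    [closing] bends P consecutive letters of each into a cycle. The columns are untouched, so no
    forbidden word appears. *)
Lemma nonempty_admissible (F : seq (seq A)) n : closing P -> combined H (sft F) !=set0 ->
  exists2 u, size u = n & admissible F u.
Proof.
move=> cl [x Hx].
have xe i j : redge H (x (i, j)) (x (i + 1, j)%R).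
  by have [/(rauzyP hH)/(_ i)] := Hx i j.
have /choice[I IP] (j : nat) : exists i0, forall i i', i0 <= i -> i0 <= i' ->
    connect (redge H) (x (Posz i, Posz j)) (x (Posz i', Posz j)).
  by apply: (@walk_recurrent _ _ (fun i => x (Posz i, Posz j))) => i; rewrite -addn1 PoszD.
pose i0 := \max_(j < n) I j.
have xs i j : redge H (x (Posz (i0 + i), Posz j)) (x (Posz (i0 + i.+1), Posz j)).
  by rewrite addnS -[(i0 + i).+1]addn1 PoszD.
exists (mkseq (fun j => [ffun k : 'I_P => x (Posz (i0 + k), Posz j)]) n).
  by rewrite size_mkseq.
have trackE k : track k (mkseq (fun j => [ffun k : 'I_P => x (Posz (i0 + k), Posz j)]) n) =
    mkseq (fun j => x (Posz (i0 + k), Posz j)) n.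
  by rewrite /track /mkseq -map_comp; apply: eq_map => j /=; rewrite ffunE.
apply/andP; split; last first.
  apply/forallP => k; apply/allP => w wF; apply/negP; rewrite trackE => /infixP[s1 [s2 sE]].
  have [_ /(_ w wF)] := Hx (Posz (i0 + k)) 0%R; apply; exists (Posz (size s1)).
  apply: (@eq_from_nth _ (x (0, 0)%R)) => [|l lw]; first by rewrite size_mkseq.
  rewrite nth_mkseq // -PoszD.
  have := congr1 (fun s => nth (x (0, 0)%R) s (size s1 + l)) sE.
  rewrite nth_cat ltnNge leq_addr /= addKn nth_cat lw nth_mkseq //.
  have := congr1 size sE; rewrite size_mkseq !size_cat => ->.
  by rewrite ltn_add2l ltn_addr.
apply/allP => c /mapP[j]; rewrite mem_iota /= add0n => jn ->.
apply/forallP => k; rewrite !ffunE /=.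
have [lt|ge] := ltnP k.+1 P; first by rewrite modn_small.
have kE : k.+1 = P by have := ltn_ord k; lia.
have Ij : I j <= i0 by apply: (leq_bigmax (Ordinal jn)).
rewrite kE modnn; have -> : k = P.-1 :> nat by lia.
pose g i := x (Posz (i0 + i), Posz j).
have gc i i' : connect (redge H) (g i) (g i') by apply: IP; lia.
have sS : scc (rauzy H) [set w | connect (redge H) (g 0) w /\ connect (redge H) w (g 0)].
  apply: class_scc; first by have [] := redge_vertex (xs 0 j).
  by exists (g 1); [apply: xs | apply: gc].
by apply: (cl _ sS g) => [i|i]; [split; apply: gc | apply: xs].
Qed.
End Periodic.

Ltac compare_registers :=
  apply: funext => r; rewrite /setr; repeat (case: eqP => ?); subst; try done; try congruence;
  match goal with ne : is_true (?x != ?x) |- _ => by rewrite eqxx in ne end.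

(** * The exhaustive search as a loop program *)

Section SearchProgram.
Variables (A C : finType) (P : nat) (good : pred C) (proj : 'I_P -> C -> A).
Notation S := (option A + C)%type.
Notation blank := (inl None : S).
Notation letter a := (inl (Some a) : S).
Implicit Types f : regs S.

(** Booleans are stored as an empty register or a single blank. Register 0 holds the code, 1 the
    answer, 2 the last input letter, 3 to 5 lengths in unary, 6 the candidate, 7 a failure, 8 the
    current track, 9 a suffix of it, 10 and 11 the state of a comparison, 12 and 13 scratch, 14 a
    success. *)
Definition flag (b : bool) : seq S := if b then [:: blank] else [::].
Definition raise (r : nat) : prog S := Seq (Clear S r) (Push r blank).
Definition unless (r : nat) (p : prog S) : prog S :=
  Case r (fun x => if x is Some _ then Skip S else p).
Definition pop (d : nat) : prog S :=
  Seq (Foreach d (fun a => Case 13 (fun x => if x is Some _ then Push 12 a else Push 13 a)))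
    (Seq (copy S d 12) (Seq (Clear S 12) (Clear S 13))).

Lemma run_raise r f : run (raise r) f = setr f r (flag true).
Proof. by rewrite /= setr_same setr_setr. Qed.

Lemma run_clear r f : run (Clear S r) f = setr f r [::].
Proof. by []. Qed.

Lemma run_unless r p f b : f r = flag b -> run (unless r p) f = if b then f else run p f.
Proof. by move=> /= ->; case: b. Qed.

Lemma run_pop d f : d != 12 -> d != 13 -> f 12 = [::] -> f 13 = [::] ->
  run (pop d) f = setr f d (behead (f d)).
Proof.
move=> d12 d13 f12 f13; rewrite /pop 3!run_seq.
pose body a := Case 13 (fun x => if x is Some _ then Push 12 a else Push 13 a) : prog S.
have tail : forall s g x, g 13 = [:: x] ->
    foldl (fun g a => run (body a) g) g s = setr g 12 (g 12 ++ s).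
  elim=> [|a s IH] g x gx; first by rewrite /= cats0 setr_id.
  by rewrite [foldl _ _ _]/= gx /= (IH _ x) ?setr_same ?setr_setr ?cat_rcons.
have -> : run (Foreach d body) f =
    if f d is a :: s then setr (setr f 13 [:: a]) 12 s else f.
  rewrite [LHS]/=; case: (f d) => //= a s; rewrite f13 /= f13 (tail _ _ a) ?setr_same //.
  by rewrite setr_other // f12.
rewrite run_copy // !run_clear; case E: (f d) => [|a s].
  by compare_registers.
rewrite setr_same; by compare_registers.
Qed.

(* Register 0 holds a list of words; register 7 is raised if one of them is a
   prefix of register 9. *)
Definition prefix_prog : prog S :=
  Seq (copy S 10 9) (Seq (Foreach 0 (fun a => match a with
    | inl None => Seq (unless 11 (raise 7)) (Seq (Clear S 11) (copy S 10 9))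
    | inl (Some y) => Seq (Case 10 (fun x => if x == Some (letter y) then Skip S else raise 11)) (pop 10)
    | inr _ => Skip S
    end)) (Seq (Clear S 10) (Clear S 11))).

Variable F : seq (seq A).
Notation code := [seq inl a | a <- encode F].

Lemma run_prefix f v b : f 0 = code -> f 9 = [seq letter a | a <- v] -> f 7 = flag b ->
  [/\ f 10 = [::], f 11 = [::], f 12 = [::] & f 13 = [::]] ->
  run prefix_prog f = setr f 7 (flag (b || has (fun w => prefix w v) F)).
Proof.
move=> f0 f9 f7 [f10 f11 f12 f13].
(* State of the loop: [cur] is the text left to compare with the current word, [m] a mismatch in
   this word, [b] a hit so far. *)
pose st cur m b := setr (setr (setr f 10 [seq letter a | a <- cur]) 11 (flag m)) 7 (flag b).
pose body (a : S) : prog S := match a with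
    | inl None => Seq (unless 11 (raise 7)) (Seq (Clear S 11) (copy S 10 9))
    | inl (Some y) => Seq (Case 10 (fun x => if x == Some (letter y) then Skip S else raise 11)) (pop 10)
    | inr _ => Skip S
    end.
have body_end cur m c : run (body blank) (st cur m c) = st v false (c || ~~ m).
  rewrite /body 2!run_seq (@run_unless 11 _ _ m) // run_copy // run_clear.
  have -> : (if m then st cur m c else run (raise 7) (st cur m c)) = st cur m (c || ~~ m).
    by case: m; rewrite ?orbF ?orbT // run_raise /st setr_setr.
  rewrite setr_other // /st !setr_other // f9.
  by compare_registers.
have body_letter y cur m c : run (body (letter y)) (st cur m c) =
    st (behead cur) (m || (ohead cur != Some y)) c.
  rewrite /body run_seq run_pop //; last 2 first.
  - by rewrite [run _ _]/=; case: ifP => _; rewrite ?run_raise /setr /= /st /setr /= ?f12.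
  - by rewrite [run _ _]/=; case: ifP => _; rewrite ?run_raise /setr /= /st /setr /= ?f13.
  have -> : run (Case 10 (fun x => if x == Some (letter y) then Skip S else raise 11)) (st cur m c) =
      st cur (m || (ohead cur != Some y)) c.
    rewrite [LHS]/= [st cur m c 10]/(st _ _ _ _) /st /setr /=.
    have -> : (ohead [seq letter a | a <- cur] == Some (letter y)) = (ohead cur == Some y).
      by case: cur.
    case: eqP => _ /=; first by rewrite orbF.
    by rewrite orbT; apply: funext => r; rewrite /setr; do ?case: eqP => [->|_].
  rewrite [st cur _ _ 10]/(st _ _ _ _) /st [setr _ 7 _ 10]/setr /= [setr _ 11 _ 10]/setr /= setr_same behead_map.
  by compare_registers.
pose step g a := run (body a) g.
have word w cur m c : exists cur', foldl step (st cur m c)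
    [seq inl a | a <- map Some w] = st cur' (m || ~~ prefix w cur) c.
  elim: w cur m => [|y w IH] cur m; first by exists cur; rewrite prefix0s orbF.
  have -> : foldl step (st cur m c) [seq inl a | a <- map Some (y :: w)] =
    foldl step (run (body (letter y)) (st cur m c)) [seq inl a | a <- map Some w] by [].
  rewrite body_letter; have [cur' ->] := IH (behead cur) (m || (ohead cur != Some y)).
  exists cur'; congr (st _ _ _); rewrite -orbA; congr orb.
  case: cur => [|z cur] //=; rewrite negb_and; congr (_ || _).
  by rewrite eq_sym; congr negb; apply/eqP/eqP => [[]|->].
have words : forall G c, foldl step (st v false c)
    [seq inl a | a <- encode G] = st v false (c || has (fun w => prefix w v) G).
  elim=> [|w G IH] c; first by rewrite orbF.
  rewrite /encode /= map_cat foldl_cat map_rcons -cats1 foldl_cat.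
  have [cur ->] := word w v false c.
  rewrite -[foldl step (st cur _ _) _]/(run (body blank) (st cur (false || ~~ prefix w v) c)).
  by rewrite body_end IH negbK orbA.
rewrite /prefix_prog 3!run_seq.
have -> : run (copy S 10 9) f = st v false b.
  rewrite run_copy // f9; apply: funext => r; rewrite /st /setr.
  by repeat (case: eqP => ?); subst; rewrite ?f11 ?f7.
have -> : run (Foreach 0 body) (st v false b) = st v false (b || has (fun w => prefix w v) F).
  by rewrite -words -f0.
rewrite !run_clear; apply: funext => r; rewrite /st /setr.
by repeat (case: eqP => ?); subst; rewrite ?f10 ?f11.
Qed.

(* The same for the factors of register 8. *)
Definition infix_prog : prog S :=
  Seq (copy S 9 8) (Seq (Foreach 8 (fun _ => Seq prefix_prog (pop 9))) (Seq prefix_prog (Clear S 9))).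

Lemma run_infix f v b : f 0 = code -> f 8 = [seq letter a | a <- v] -> f 7 = flag b ->
  f 9 = [::] -> [/\ f 10 = [::], f 11 = [::], f 12 = [::] & f 13 = [::]] ->
  run infix_prog f = setr f 7 (flag (b || has (fun w => infix w v) F)).
Proof.
move=> f0 f8 f7 f9 fs.
pose st v b := setr (setr f 9 [seq letter a | a <- v]) 7 (flag b).
have body u c : run (Seq prefix_prog (pop 9)) (st u c) =
    st (behead u) (c || has (fun w => prefix w u) F).
  rewrite run_seq (run_prefix (v := u) (b := c)) //.
  have [? ? f12 f13] := fs; rewrite run_pop // /st [setr _ 7 _ 9]/setr /= setr_other // setr_same behead_map.
  by compare_registers.
(* The iteration stops before the empty suffix, which the last call of [prefix_prog] treats; it
   matters when the empty word is forbidden. *)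
have all_ : forall u c, exists2 c', iter (size u) (run (Seq prefix_prog (pop 9))) (st u c) = st [::] c' &
    c' || has (fun w => prefix w [::]) F = c || has (fun w => infix w u) F.
  elim=> [|a u IH] c; first by exists c => //; congr orb; apply: eq_has => w; case: w.
  rewrite [size _]/= iterSr body; have [c' -> E] := IH (c || has (fun w => prefix w (a :: u)) F).
  by exists c' => //; rewrite E -orbA -has_predU; congr orb; apply: eq_has.
rewrite /infix_prog 3!run_seq.
have -> : run (copy S 9 8) f = st v b by rewrite run_copy // f8 /st; compare_registers.
rewrite run_repeat.
have -> : size (st v b 8) = size v by rewrite /st /setr /= f8 size_map.
have [c -> E] := all_ v b.
rewrite (run_prefix (v := [::]) (b := c)) // E run_clear /st.
by compare_registers.
Qed.

Definition is_good (a : S) : bool := if a is inr c then good c else false.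
Definition project (j : 'I_P) (W : seq S) : seq A :=
  pmap (fun a : S => if a is inr c then if good c then Some (proj j c) else None else None) W.
Definition bad_word (j : 'I_P) (W : seq S) : bool :=
  ~~ all is_good W || has (fun w => infix w (project j W)) F.

Definition track_prog (j : 'I_P) : prog S :=
  Seq (Foreach 6 (fun a => if a is inr c then
      if good c then Push 8 (letter (proj j c)) else raise 7 else raise 7))
    (Seq infix_prog (Clear S 8)).

Lemma run_track j f W b : f 0 = code -> f 6 = W -> f 7 = flag b -> f 8 = [::] ->
  f 9 = [::] -> [/\ f 10 = [::], f 11 = [::], f 12 = [::] & f 13 = [::]] ->
  run (track_prog j) f = setr f 7 (flag (b || bad_word j W)).
Proof.
move=> f0 f6 f7 f8 f9 fs.
pose st v b := setr (setr f 8 [seq letter a | a <- v]) 7 (flag b).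
pose step g (a : S) := run (if a is inr c then
      if good c then Push 8 (letter (proj j c)) else raise 7 else raise 7) g.
have loop : forall V v c, foldl step (st v c) V = st (v ++ project j V) (c || ~~ all is_good V).
  elim=> [|a V IH] v c; first by rewrite cats0 orbF.
  have bad : step (st v c) (inl None) = st v true.
    by rewrite /step run_raise /st setr_setr.
  have -> : foldl step (st v c) (a :: V) = foldl step (step (st v c) a) V by [].
  case: a => [x|d].
    by rewrite -[step _ (inl x)]/(step (st v c) (inl None)) bad IH /= orbT.
  rewrite /=; case gd: (good d) => /=.
    rewrite {2}/step gd run_push (_ : setr _ _ _ = st (rcons v (proj j d)) c).
      by rewrite IH cat_rcons.
    rewrite /st [setr _ 7 _ 8]/setr /= setr_same -map_rcons.
    by compare_registers.
  rewrite {2}/step gd -[run (raise 7) _]/(step (st v c) (inl None)) bad IH.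
  by rewrite orbT.
rewrite /track_prog 2!run_seq.
have -> : run (Foreach 6 (fun a => if a is inr c then
      if good c then Push 8 (letter (proj j c)) else raise 7 else raise 7)) f =
    st (project j W) (b || ~~ all is_good W).
  rewrite -[LHS]/(foldl step f (f 6)) f6 -(loop W [::] b) /st; congr foldl.
  by compare_registers.
rewrite (run_infix (v := project j W) (b := b || ~~ all is_good W)) // run_clear /bad_word orbA /st.
by compare_registers.
Qed.

Definition accepted_word (W : seq S) : bool := ~~ has (fun j => bad_word j W) (enum 'I_P).

Definition test_prog : prog S :=
  Seq (foldr (fun j q => Seq (track_prog j) q) (Skip S) (enum 'I_P))
    (Seq (unless 7 (raise 14)) (Clear S 7)).

Definition scratch_clear f := [/\ f 7 = [::], f 8 = [::], f 9 = [::], f 10 = [::] &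
  [/\ f 11 = [::], f 12 = [::] & f 13 = [::]]].

Lemma run_test f b : f 0 = code -> scratch_clear f -> f 14 = flag b ->
  run test_prog f = setr f 14 (flag (b || accepted_word (f 6))).
Proof.
move=> f0 [f7 f8 f9 f10 [f11 f12 f13]] f14.
have tracks : forall s c, run (foldr (fun j q => Seq (track_prog j) q) (Skip S) s) (setr f 7 (flag c)) =
    setr f 7 (flag (c || has (fun j => bad_word j (f 6)) s)).
  elim=> [|j s IH] c; first by rewrite orbF.
  rewrite [foldr _ _ _]/= run_seq (@run_track j _ (f 6) c) // setr_setr IH.
  by rewrite /= orbA.
rewrite /test_prog 2!run_seq -{1}(setr_id f 7) f7 -[[::]]/(flag false) tracks orFb.
rewrite (@run_unless 7 _ _ (has (fun j => bad_word j (f 6)) (enum 'I_P))); last by rewrite setr_same.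
rewrite run_raise run_clear /accepted_word.
by case: has => /=; rewrite ?orbF ?orbT; compare_registers.
Qed.

Definition search_step : prog S := Seq test_prog (next_prog blank 6 12 13).

Lemma run_search n f b : f 0 = code -> scratch_clear f -> f 14 = flag b ->
  iter n (run search_step) f =
  setr (setr f 6 (iter n (next_word blank) (f 6))) 14
    (flag (b || has (fun k => accepted_word (iter k (next_word blank) (f 6))) (iota 0 n))).
Proof.
move=> f0 [f7 f8 f9 f10 [f11 f12 f13]] f14; elim: n => [|n IH].
  by rewrite orbF; compare_registers.
rewrite iterS IH /search_step run_seq -[n.+1]addn1 iotaD has_cat addn1.
set c := b || _; rewrite (run_test (b := c)); last by rewrite setr_same.
- rewrite run_next; try by rewrite /setr.
  by rewrite [has _ (iota _ 1)]/= orbF orbA -/c /setr /=; compare_registers.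
- by rewrite /setr.
by split; rewrite /setr.
Qed.

Ltac check_program := repeat (simpl; match goal with
  | |- _ /\ _ => split
  | |- forall _, _ => intro
  | |- context [match ?x with _ => _ end] => destruct x
  end); simpl; try done; try lia.

Lemma keeps_track r j : r <> 0 -> r < 6 \/ 13 < r -> keeps r (track_prog j).
Proof. by move=> r0 r6; check_program. Qed.

Lemma wf_track j : wf 15 (track_prog j).
Proof. by check_program. Qed.

Lemma keeps_search r : r <> 0 -> r < 6 \/ 14 < r -> keeps r search_step.
Proof.
move=> r0 r6; split; last by apply: keeps_next; lia.
split.
  elim: (enum _) => //= j s IH; split=> //; apply: keeps_track => //; lia.
by split; [move=> [x|] //=; split; lia | move=> /= ?; lia].
Qed.

Lemma wf_search : wf 15 search_step.
Proof.
split; last exact: wf_next.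
split; first by elim: (enum _) => //= j s IH; split=> //; apply: wf_track.
by split=> //; split=> // -[].
Qed.

Definition push_many (n r : nat) : prog S := iter n (fun q => Seq (Push r blank) q) (Skip S).

Lemma run_push_many n r f : run (push_many n r) f = setr f r (f r ++ nseq n blank).
Proof.
elim: n f => [|n IH] f; first by rewrite /= cats0 setr_id.
by rewrite [push_many _ _]/= run_seq IH run_push setr_same setr_setr cat_rcons.
Qed.

(** The register [dst] is multiplied by [n] once per letter of [src]: nested loops produce the
    exponential length of the search. *)
Definition power_prog (n src dst tmp : nat) : prog S :=
  Seq (Push dst blank) (Foreach src (fun _ =>
    Seq (Foreach dst (fun _ => push_many n tmp)) (Seq (copy S dst tmp) (Clear S tmp)))).

Lemma run_power n src dst tmp f : src != dst -> src != tmp -> dst != tmp ->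
  f dst = [::] -> f tmp = [::] ->
  run (power_prog n src dst tmp) f = setr f dst (nseq (n ^ size (f src)) blank).
Proof.
move=> sd st dt fd ft; rewrite /power_prog run_seq run_repeat run_push fd.
rewrite [setr _ _ _ src]setr_other //; elim: (size (f src)) => [|m IH] //.
rewrite iterS IH 2!run_seq run_repeat setr_same size_nseq.
have many k g : iter k (run (push_many n tmp)) g = setr g tmp (g tmp ++ nseq (n * k) blank).
  elim: k => [|k IHk]; first by rewrite muln0 cats0 setr_id.
  by rewrite iterS IHk run_push_many setr_same setr_setr -catA -nseqD mulnS addnC.
rewrite many run_copy // run_clear setr_same setr_other // 1?eq_sym // ft -expnS cat0s.
by compare_registers.
Qed.

Lemma keeps_push_many n r r' : r <> r' -> keeps r (push_many n r').
Proof. by move=> rr; elim: n => //= n IH; split. Qed.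

Lemma keeps_power n r src dst tmp : r <> src -> r <> dst -> r <> tmp ->
  keeps r (power_prog n src dst tmp).
Proof.
move=> rs rd rt; split=> //; split=> // _; split; last by check_program.
by split=> // _; apply: keeps_push_many.
Qed.

Lemma wf_power n k src dst tmp : src < k -> dst < k -> tmp < k ->
  src <> dst -> src <> tmp -> dst <> tmp -> wf k (power_prog n src dst tmp).
Proof.
move=> sk dk tk sd st dt; split=> //; split=> // _; split.
  by split; [split=> // _; apply: keeps_push_many | check_program].
split; last by check_program; apply: nesym.
split=> // _; split; first exact: keeps_push_many.
by elim: n => //= n IH; split.
Qed.

Definition last_prog : prog S := Foreach 0 (fun a => Seq (Clear S 2) (Push 2 a)).

Lemma run_last f : run last_prog f = if f 0 is a :: s then setr f 2 [:: last a s] else f.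
Proof.
rewrite /=; move: (f 0) => s; elim: s f => //= a s IH f.
by rewrite IH; case: s {IH} => [|b s]; rewrite !setr_setr.
Qed.

Definition verdict_prog : prog S :=
  Case 2 (fun x => if x is Some (inl (Some _)) then Skip S else
    Case 14 (fun y => if y is Some _ then Push 1 blank else Skip S)).

Notation first_letter := (head blank (enum {: S})).

Definition middle_prog : prog S :=
  Seq (power_prog #|{: S}| 0 3 4) (Seq (append S 3 0) (Seq (power_prog #|{: S}|.+1 3 5 4)
  (Seq (Foreach 3 (fun _ => Push 6 first_letter)) (Foreach 5 (fun _ => search_step))))).

Definition decision_prog : prog S := Seq last_prog (Seq middle_prog verdict_prog).

Lemma keeps_middle r : r = 1 \/ r = 2 -> keeps r middle_prog.
Proof.
move=> r12; have r0 : r <> 0 by lia.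
split; first by apply: keeps_power; lia.
split; first by apply: keeps_append; lia.
split; first by apply: keeps_power; lia.
split; first by split=> /=; lia.
by split=> [|_]; [lia | apply: keeps_search => //; lia].
Qed.

Lemma wf_decision : wf 15 decision_prog.
Proof.
split; first by split.
split; last by do 2 (split=> // -[[[?|]|?]|] //=).
split; first exact: wf_power.
split; first exact: wf_append.
split; first exact: wf_power.
split; first by split.
by split=> // _; split; [apply: keeps_search => //; lia | apply: wf_search].
Qed.

(** The bound of [admissible_nonempty], with the alphabet of the program, which contains the cycles;
    m will be the length of the code, which bounds that of the forbidden words. *)
Definition search_length (m : nat) : nat := #|{: S}| ^ m + m.
Definition search_word (m k : nat) : seq S :=
  iter k (next_word blank) (nseq (search_length m) first_letter).

Lemma run_middle f : f 0 = code -> (forall r, 2 < r -> f r = [::]) ->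
  let m := size (encode F) in
  run middle_prog f 14 = flag (has (fun k => accepted_word (search_word m k))
    (iota 0 (#|{: S}|.+1 ^ search_length m))).
Proof.
move=> f0 fr m; rewrite /middle_prog 4!run_seq.
rewrite (@run_power _ 0 3 4 f) ?(fr 3) ?(fr 4) // run_append // setr_same setr_setr [setr _ _ _ 0]setr_other //.
rewrite f0 size_map -/m; set g := setr f 3 _.
have sg : size (g 3) = search_length m by rewrite /g setr_same size_cat size_nseq size_map.
rewrite run_power //; try by rewrite /g /setr /= ?fr.
rewrite sg [run (Foreach 3 _) _]run_repeat [setr _ _ _ 3]setr_other // sg.
have -> : forall k h, iter k (run (Push 6 first_letter)) h = setr h 6 (h 6 ++ nseq k first_letter).
  elim=> [|k IH] h; first by rewrite cats0 setr_id.
  by rewrite iterS IH run_push setr_same setr_setr -cats1 -catA -[k.+1]addn1 nseqD.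
rewrite run_repeat [setr _ 6 _ 5]setr_other // setr_same size_nseq.
rewrite (@run_search _ _ false).
- by rewrite setr_same /= [setr _ 6 _ 6]setr_same; congr flag; rewrite /setr /= /g /setr /= fr.
- by rewrite /g /setr /= f0.
- by split=> [||||]; [..|split]; rewrite /g /setr /= fr.
by rewrite /g /setr /= fr.
Qed.

Lemma run_verdict f : run verdict_prog f 1 =
  if ohead (f 2) is Some (inl (Some _)) then f 1 else
  if f 14 is [::] then f 1 else rcons (f 1) blank.
Proof. by rewrite /=; case: (f 2) => [|[[a|]|c] s] //=; case: (f 14) => [|[[b|]|b] u]. Qed.
End SearchProgram.

(** Valid inputs are recognised by their last letter alone: a nonempty word is a code exactly when
    it ends with a separator. *)
Definition closed_code (A : Type) (s : seq (option A)) : bool :=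
  if s is a :: s' then if last a s' is None then true else false else true.

Lemma closed_encode (A : finType) (s : seq (option A)) :
  closed_code s <-> exists F, encode F = s.
Proof.
split=> [|[F <-]]; last first.
  case/lastP: F => // F w; rewrite /encode map_rcons flatten_rcons -rcons_cat.
  by rewrite /closed_code; case: (_ ++ _) => [|a u] //=; rewrite last_rcons.
have [F [w ->]] : exists F w, s = encode F ++ map Some w.
  elim/last_ind: s => [|s [a|] [F [w ->]]]; first by exists [::], [::].
    by exists F, (rcons w a); rewrite map_rcons rcons_cat.
  exists (rcons F w), [::]; rewrite cats0 /encode map_rcons flatten_rcons.
  by rewrite rcons_cat.
case/lastP: w => [|w a]; first by rewrite cats0; exists F.
rewrite map_rcons -rcons_cat /closed_code.
by case: (_ ++ _) => [|b u] //=; rewrite last_rcons.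
Qed.

(** The decider placed after the search, whose answer is the presence of a letter in its output
    register. *)
Lemma nonempty_decidable (Sigma : finType) : turing_decidable [set s : seq Sigma | s <> [::]].
Proof.
exists (@TuringMachine Sigma (option bool) unit None id
  (fun _ c => (Some (if c is Some (inl _) then true else false), c, Stay))) => s.
by split=> [|/contrapT ->]; [case: s => // a s _|]; exists 1.
Qed.

Section Odometer.
Variables (S : finType) (s0 : S).

Lemma size_next_word w : size w <= size (next_word s0 w).
Proof. by elim: w => //= d w IH; case: next_letter. Qed.

Lemma size_iter_next k w : size w <= size (iter k (next_word s0) w).
Proof. by elim: k => //= k IH; apply: leq_trans IH (size_next_word _). Qed.

Lemma word_value_bound (w : seq S) : word_value w < #|S|.+1 ^ size w.
Proof.
elim: w => //= d w IH; rewrite expnS.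
have : index d (enum S) < #|S| by rewrite cardT index_mem mem_enum.
by move: (word_value w) (index d _) (#|S|) (_ ^ _) IH => v i b t IH; nia.
Qed.

Lemma word_value_first (w : seq S) : word_value (nseq (size w) (head s0 (enum S))) <= word_value w.
Proof.
elim: w => //= d w IH; have -> : index (head s0 (enum S)) (enum S) = 0.
  by have := mem_enum S d; case: (enum S) => //= a s; rewrite eqxx.
by rewrite leq_add // leq_mul2l IH orbT.
Qed.

Lemma next_word_reach (w : seq S) : exists2 k, k < #|S|.+1 ^ size w &
  iter k (next_word s0) (nseq (size w) (head s0 (enum S))) = w.
Proof.
have valI k u : word_value (iter k (next_word s0) u) = word_value u + k.
  by elim: k => [|k IH]; rewrite ?addn0 // iterS word_value_next IH addnS.
exists (word_value w - word_value (nseq (size w) (head s0 (enum S)))).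
  exact: leq_ltn_trans (leq_subr _ _) (word_value_bound w).
by apply: (word_value_inj s0); rewrite valI subnKC // word_value_first.
Qed.
End Odometer.

Lemma encode_size (A : finType) (F : seq (seq A)) w : w \in F -> size w <= size (encode F).
Proof.
elim: F => // u F IH; rewrite inE /encode /= size_cat size_rcons size_map => /orP[/eqP ->|/IH].
  by rewrite (leq_trans (leqnSn _)) ?leq_addr.
by move=> le; apply: leq_trans le (leq_addl _ _).
Qed.

Section Decision.
Variables (A : finType) (H : set (int -> A)) (P : nat).
Hypotheses (hH : nearest_neighbor H) (P0 : 0 < P) (cl : closing H P).

Notation C := (cycle_word A P).
Notation S := (option A + C)%type.
Notation good := (@is_cycle A H P).
Notation proj := (fun (j : 'I_P) (c : C) => c j).

Lemma accepted_admissible F (W : seq S) : accepted_word good proj F W ->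
  exists2 u, W = map inr u & admissible H F u.
Proof.
move=> /hasPn acc; have accj j : ~~ bad_word good proj F j W by apply: acc; rewrite mem_enum.
have [u WE gu] : exists2 u : seq C, W = map inr u & all good u.
  have := accj (Ordinal P0); rewrite negb_or negbK => /andP[+ _].
  elim: W {acc accj} => [|[x|c] W IH] //=; first by exists [::].
  by case/andP=> gc /IH[u -> gu]; exists (c :: u); rewrite //= gc.
exists u => //; rewrite /admissible gu; apply/forallP => j.
have := accj j; rewrite negb_or => /andP[_]; rewrite -all_predC WE.
suff -> : project good proj j (map inr u) = track j u by [].
by elim: u gu {WE} => //= c u IH /andP[gc /IH]; rewrite /project /= gc /= => ->.
Qed.

Lemma admissible_accepted F (u : seq C) : admissible H F u -> accepted_word good proj F (map inr u).
Proof.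
move=> /andP[gu /forallP adm]; apply/hasPn => j _; rewrite negb_or negbK.
rewrite -all_predC (_ : project good proj j (map inr u) = track j u); last first.
  by elim: u gu {adm} => //= c u IH /andP[gc /IH]; rewrite /project /= gc /= => ->.
rewrite (adm j) andbT all_map; apply: sub_all gu => c /=.
by [].
Qed.

(** The enumeration starts at the least word of the required length and runs through all words of
    this length. The longer words that it may meet are harmless, since [admissible_nonempty] only
    needs a lower bound. *)
Lemma search_correct F :
  has (fun k => accepted_word good proj F (@search_word A C (size (encode F)) k))
    (iota 0 (#|{: S}|.+1 ^ @search_length A C (size (encode F)))) <->
  combined H (sft F) !=set0.
Proof.
set m := size (encode F); split.
  case/hasP=> k _ /accepted_admissible[u WE adm].
  apply: (admissible_nonempty hH P0 (m := m)) adm => [w|]; first exact: encode_size.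
  have := size_iter_next (inl None : S) k (nseq (@search_length A C m) (head (inl None) (enum {: S}))).
  rewrite -/(search_word _ _ _ _) WE size_map size_nseq; apply: leq_trans.
  rewrite leq_add2r; case: (m) => // n; rewrite leq_exp2r //.
  by rewrite card_sum leq_addl.
move=> /(nonempty_admissible hH P0 (@search_length A C m) cl)[u su adm].
have [k kl kE] := next_word_reach (inl None : S) (map inr u).
rewrite size_map su in kl kE.
apply/hasP; exists k; first by rewrite mem_iota.
by rewrite /search_word kE; apply: admissible_accepted.
Qed.

Lemma decision_correct (s : seq (option A)) :
  run (decision_prog good proj) (input (fun a => inl a : S) s) 1 <> [::] <-> DP_I H s.
Proof.
set f0 := input _ s; rewrite /decision_prog 2!run_seq run_verdict.
set f1 := run (@last_prog A C) f0.
have f1E : f1 = if s is a :: s' then setr f0 2 [:: inl (last a s')] else f0.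
  by rewrite /f1 run_last /f0 /input /=; case: (s) => //= a s'; rewrite last_map.
have k1 : run (middle_prog good proj) f1 1 = [::].
  rewrite keeps_run; last by apply: keeps_middle; left.
  by rewrite f1E; case: (s).
have k2 : run (middle_prog good proj) f1 2 = f1 2 by rewrite keeps_run //; apply: keeps_middle; right.
rewrite k1 k2; have [/closed_encode[F FE]|ncl] := boolP (closed_code s); last first.
  split=> [|[F _ FE]]; last by exfalso; apply: (negP ncl); apply/closed_encode; exists F.
  by rewrite f1E; move: ncl; case: (s) => //= a s'; case: last.
have f1o r : r != 2 -> f1 r = f0 r.
  by move=> r2; rewrite f1E; case: (s) => // a s'; rewrite setr_other.
have f10 : f1 0 = [seq inl a | a <- encode F] by rewrite f1o // FE.
have f1r r : 2 < r -> f1 r = [::].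
  by move=> r2; rewrite f1o; [case: r r2 | lia].
have oh : ohead (f1 2) = None \/ ohead (f1 2) = Some (inl None).
  have : closed_code s by apply/closed_encode; exists F.
  rewrite f1E; case: (s) => [|a s'] /=; first by left.
  by case: last => // _; right.
have -> : DP_I H s <-> combined H (sft F) !=set0.
  split=> [[F' F'H]|ne]; last by exists F.
  by rewrite -FE => /encode_inj <-.
rewrite -search_correct (@run_middle A C P good proj F f1 f10 f1r).
by case: oh => ->; case: has.
Qed.
End Decision.

Theorem condition_D_decidable (A : finType) (H : set (int -> A)) (hH : nearest_neighbor H) :
  condition_D (rauzy H) -> turing_decidable (DP_I H).
Proof.
case/(condition_D_closing) => P P0 cl.
have := @loop_reduction (option A) (option A + cycle_word A P)%type (option A + cycle_word A P)%type
  (fun a => inl a) id 15 (decision_prog (@is_cycle A H P) (fun j c => c j)) _ (wf_decision _ _) isT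
  (nonempty_decidable _).
congr turing_decidable; apply/seteqP; split=> s /=; rewrite map_id.
  by move/(decision_correct hH P0 cl).
by move/(decision_correct hH P0 cl).
Qed.

Theorem theorem5p2 (A : finType) (H : set (int -> A))
  (hH : nearest_neighbor H) :
  turing_decidable (DP_I H) <-> condition_D (rauzy H).
Proof. by split; [apply: decidable_condition_D | apply: condition_D_decidable]. Qed.
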